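(* Let $\mathcal{P}$ be a quadratic properad whose $\mathcal{P}_\infty$-gebras are twistable and let $A$ be a complete graded module. For any complete $\mathcal{P}_\infty$-gebra structure $\bar\alpha\in\mathrm{MC}(\mathfrak{g}_{\mathcal{P}^{¡},A})$ on $A$, viewed as an element $\alpha\in\mathrm{MC}(\mathfrak{g}_{c\mathcal{P}^{¡},A})$ of the extended convolution algebra, and for any element $a\in\mathrm{F}_1A_0$, the Maurer--Cartan element $$(\mathbb{1}-a)\cdot\alpha=\alpha\lhd(\mathbb{1}+a)\in\mathrm{MC}(\mathfrak{g}_{c\mathcal{P}^{¡},A})$$ of the extended convolution algebra is a $\mathcal{P}_\infty$-gebra structure on $A$ if and only if its image on $\mathcal{K}$ vanishes: $$\big(\alpha\lhd(\mathbb{1}+a)\big)(\mathcal{K})=0,$$ where $\mathcal{K}$ is the kernel of the projection $c\mathcal{P}^{¡}\twoheadrightarrow\mathcal{P}^{¡}$.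
   Context: Ground field $\Bbbk$ of characteristic $0$, homological grading. $M(m,n)$ denotes the component with $m$ outputs and $n$ inputs. Quadratic data $(E,R)$: an $\mathbb{S}$-bimodule $E$ and $R\subset\mathcal{G}(E)^{(2)}$ (two-vertex part of the free properad); $\mathcal{P}=\mathcal{P}(E,R)=\mathcal{G}(E)/(R)$. Its Koszul dual coproperad $\mathcal{P}^{¡}$ is the coproperad cogenerated by $sE$ with corelations $s^2R$; $\mathcal{P}_\infty=\Omega\mathcal{P}^{¡}$ is its cobar construction. When $E$ is arity-wise and degree-wise finite dimensional, $\mathcal{P}^!=(\mathcal{P}^{¡})^*=\mathcal{P}(s^{-1}E^*,s^{-2}R^\perp)$ is the Koszul dual properad. Unital extension: given quadratic data $(E,R)$, a datum $\chi$ consists of two linear maps $\chi_1,\chi_2\colon E(1,2)\to\Bbbk$, a choice of some basis elements $e$ of $E(m,n)$ for $(m,n)\neq(1,2)$, and for each such $e$ a choice of some of its inputs. With $u$ a degree $0$ generator of arity $(1,0)$ (one output, no input), $u_\chi\mathcal{P}$ is the properad generated by $E\oplus\Bbbk u$ with relations $R$, $\mu\circ_1^1u=\chi_1(\mu)\mathrm{id}$ and $\mu\circ_2^1u=\chi_2(\mu)\mathrm{id}$ for $\mu\in E(1,2)$, and $e\circ_i^1u=0$ for each chosen $e$ and each chosen input $i$ of $e$. $(E,R)$ is extendable if there is $\chi$ with $(\chi_1,\chi_2)\neq(0,0)$ such that the canonical map $\mathcal{P}\to u_\chi\mathcal{P}$ is a monomorphism. $\mathcal{P}_\infty$-gebras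 (for an arity-wise and degree-wise finite dimensional presentation) are twistable if $\mathcal{P}^!$ is extendable, by some fixed $\chi$, and the linear dual $c\mathcal{P}^{¡}:=(u_\chi\mathcal{P}^!)^*$ is an infinitesimal coproperad, i.e. the duals of the two-vertex composition maps land in finite sums. The inclusion $\mathcal{P}^!\hookrightarrow u_\chi\mathcal{P}^!$ dualises to the projection $c\mathcal{P}^{¡}\twoheadrightarrow\mathcal{P}^{¡}$, and hence induces an inclusion of convolution algebras. Complete graded module: a graded module $A$ with a complete descending filtration $A=\mathrm{F}_0A\supset\mathrm{F}_1A\supset\cdots$; $A_0$ is its degree $0$ part; $\mathrm{end}_A(m,n)=\hom(A^{\hat\otimes n},A^{\hat\otimes m})$ denotes filtration-preserving maps. $\mathfrak{g}_{c\mathcal{P}^{¡},A}=\hom_{\mathbb{S}}(c\mathcal{P}^{¡},\mathrm{end}_A)$ carries the product $f\star g$ given by decomposing into two-vertex connected graphs with bottom vertex labelled by $f$ and top vertex labelled by $g$, and the bracket $[f,g]=f\star g-(-1)^{|f||g|}g\star f$. Its Maurer--Cartan elements here are the degree $-1$ elements $\alpha$ with $\alpha\star\alpha=0$ (curved $\mathcal{P}_\infty$-gebra structures on $A$). A $\mathcal{P}_\infty$-gebra structure $\bar\alpha$ on $A$, together with the differential $\partial_A$ of $A$, is viewed as the Maurer--Cartan element $\alpha=\delta+\bar\alpha\pi$, where $\delta\colon c\mathcal{P}^{¡}\xrightarrow{\varepsilon}\mathcal{I}\xrightarrow{\partial_A}\mathrm{end}_A$ ($\varepsilon$ the counit, evaluation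 on $\mathrm{id}$) and $\pi\colon c\mathcal{P}^{¡}\twoheadrightarrow\overline{\mathcal{P}}^{¡}$. A Maurer--Cartan element of $\mathfrak{g}_{c\mathcal{P}^{¡},A}$ is said to be a $\mathcal{P}_\infty$-gebra structure if it factors through the projection $c\mathcal{P}^{¡}\twoheadrightarrow\mathcal{P}^{¡}$ (its value on the counit part being the differential). Gauge action: $a\in\mathrm{F}_1A_0$ is viewed as the element of $\mathfrak{g}_{c\mathcal{P}^{¡},A}$ which is zero outside arity $(1,0)$ and sends $\varphi\in(u_\chi\mathcal{P}^!(1,0))^*$ to $\varphi(u)\,a$; $\mathbb{1}$ is $c\mathcal{P}^{¡}\xrightarrow{\varepsilon}\mathcal{I}\xrightarrow{\mathrm{id}_A}\mathrm{end}_A$. The gauge element $\mathbb{1}-a=\exp(-a)$ acts by $(\mathbb{1}-a)\cdot\alpha=e^{\mathrm{ad}_{-a}}(\alpha)$. The element $\alpha\lhd(\mathbb{1}+a)$ is obtained by plugging, in all possible ways, $a$ or the identity at the inputs of $\alpha$. Explicitly, for $\varphi\in c\mathcal{P}^{¡}(m,n)$, $$\big(\alpha\lhd(\mathbb{1}+a)\big)(\varphi)=\sum_{k\geqslant0}\tfrac1{k!}\,\alpha(\varphi^{(k)})(\underbrace{a,\ldots,a}_{k},-,\ldots,-),$$ where $\varphi^{(k)}\in c\mathcal{P}^{¡}(m,n+k)$ is the functional $\rho\mapsto\varphi(\rho\circ(u,\ldots,u,\mathrm{id},\ldots,\mathrm{id}))$ with $u$ plugged at the first $k$ inputs. *)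

(* Defs.v *)
From HB Require Import structures.
From mathcomp Require Import all_boot all_order all_algebra all_fingroup.
From mathcomp Require Import boolp.

Set Implicit Arguments.
Unset Strict Implicit.
Unset Printing Implicit Defensive.
Import GRing.Theory.
Local Open Scope ring_scope.

(* Conventions.
   - A graded module is a family of modules indexed by int; all elements are
     homogeneous.  Where degrees or arities have to be added, operations take
     the equation between degrees (or a wiring) as an argument, so that no
     transport along equalities of indices is needed.
   - M d m n is the degree d component of M(m,n): m outputs, n inputs.
   - Vertices of a two-vertex graph are ordered (bottom, top). *)

(* A directed graph with global inputs 1..n, global outputs 1..m and vertices
   of prescribed arities amounts to a bijection from the "sinks" (global
   outputs and vertex inputs) to the "sources" (global inputs and vertex
   outputs): each sink is sent to the source at the other end of its edge. *)
Section Wirings.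
Variables m1 n1 m2 n2 m n : nat.

Definition sink := ('I_m + ('I_n1 + 'I_n2))%type.
Definition source := ('I_n + ('I_m1 + 'I_m2))%type.

Definition gout (o : 'I_m) : sink := inl o.
Definition bin (i : 'I_n1) : sink := inr (inl i).
Definition tin (i : 'I_n2) : sink := inr (inr i).
Definition gin (i : 'I_n) : source := inl i.
Definition bout (o : 'I_m1) : source := inr (inl o).
Definition tout (o : 'I_m2) : source := inr (inr o).

Definition is_gin (s : source) : bool := if s is inl _ then true else false.
Definition is_bout (s : source) : bool :=
  if s is inr (inl _) then true else false.
Definition is_tout (s : source) : bool :=
  if s is inr (inr _) then true else false.

(* Connected: at least one edge joins the two vertices, and no global input is
   directly a global output.  Acyclic with the first vertex at the bottom: the
   internal edges all go from the top vertex to the bottom vertex. *)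
Definition wiring_ok (w : {ffun sink -> source}) : bool :=
  [&& injectiveb w, [forall s, s \in codom w],
      [forall i, is_gin (w (tin i))],
      [forall i, ~~ is_bout (w (bin i))],
      [forall o, ~~ is_gin (w (gout o))] &
      [exists i, is_tout (w (bin i))]].

Record wiring := Wiring {
  wmap :> {ffun sink -> source};
  wmapP : wiring_ok wmap }.

HB.instance Definition _ := [isSub for wmap].
HB.instance Definition _ := [Finite of wiring by <:].

(* Relabelling: w' is obtained by inserting w into the corolla (s,t), and the
   corollas (s1,t1) and (s2,t2) into the bottom and top vertices of w, where
   the corolla (s,t) joins its output o to the output s o of its vertex, and
   the input i of its vertex to its input t i.  Accordingly (s,t) acts on
   elements of arity (m,n) as composition along that corolla, which is a left
   action of s and a right action of t. *)
Definition relabels (s : 'S_m) (t : 'S_n) (s1 : 'S_m1) (t1 : 'S_n1)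
    (s2 : 'S_m2) (t2 : 'S_n2) (w w' : wiring) : bool :=
  [forall x : sink,
     w' x == match w (match x with
                      | inl o => gout (s o)
                      | inr (inl i) => bin (t1 i)
                      | inr (inr i) => tin (t2 i)
                      end) with
             | inl i => gin (t i)
             | inr (inl o) => bout (s1 o)
             | inr (inr o) => tout (s2 o)
             end].

End Wirings.

Arguments gout {n1 n2 m}.
Arguments bin {n1 n2 m}.
Arguments tin {n1 n2 m}.
Arguments gin {m1 m2 n}.
Arguments bout {m1 m2 n}.
Arguments tout {m1 m2 n}.

(* The graph of  e o_i^1 u  for u of arity (1,0). *)
Section Plug.
Variables (m n : nat) (i : 'I_n.+1).

Definition plug_fun : {ffun sink n.+1 0 m -> source m 1 n} :=
  [ffun x => match x with
             | inl o => bout o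
             | inr (inl j) => if unlift i j is Some j' then gin j' else tout ord0
             | inr (inr _) => tout ord0
             end].

Lemma plug_ok : wiring_ok plug_fun.
Proof.
apply/and5P; split; last (apply/andP; split).
- apply/injectiveP => -[o|[j|[]//]] [o'|[j'|[]//]]; rewrite !ffunE //=.
  + by case=> ->.
  + by case: (unliftP i j').
  + by case: (unliftP i j).
  + by case: (unliftP i j) => [a ->|->]; case: (unliftP i j') => [b ->|->] // [->].
- apply/forallP => -[j|[o|o]]; apply/codomP.
  + by exists (bin (lift i j)); rewrite ffunE /= liftK.
  + by exists (gout o); rewrite ffunE.
  + by exists (bin i); rewrite ffunE /= unlift_none (ord1 o).
- by apply/forallP => -[].
- by apply/forallP => j; rewrite ffunE /=; case: (unliftP i j).
- by apply/forallP => o; rewrite ffunE.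
- by apply/existsP; exists i; rewrite ffunE /= unlift_none.
Qed.

Definition plug : wiring m n.+1 1 0 m n := Wiring plug_ok.

End Plug.

(* Nested two-vertex graphs, as partial functions from the sinks to the sources
   of the resulting graph with three vertices A, B, C. *)
Section Nesting.

Definition leg3 (G A B C : Type) := (G + (A + (B + C)))%type.
Definition legG {G A B C} (x : G) : leg3 G A B C := inl x.
Definition legA {G A B C} (x : A) : leg3 G A B C := inr (inl x).
Definition legB {G A B C} (x : B) : leg3 G A B C := inr (inr (inl x)).
Definition legC {G A B C} (x : C) : leg3 G A B C := inr (inr (inr x)).

Definition swapAB {G A B C} (x : leg3 G A B C) : leg3 G B A C :=
  match x with
  | inl g => legG g
  | inr (inl a) => legB a
  | inr (inr (inl b)) => legA b
  | inr (inr (inr c)) => legC c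
  end.
Definition swapBC {G A B C} (x : leg3 G A B C) : leg3 G A C B :=
  match x with
  | inl g => legG g
  | inr (inl a) => legA a
  | inr (inr (inl b)) => legC b
  | inr (inr (inr c)) => legB c
  end.

Variables ma na mb nb mc nc m' n' m n : nat.

Let snk := leg3 'I_m 'I_na 'I_nb 'I_nc.
Let src := leg3 'I_n 'I_ma 'I_mb 'I_mc.

(* w' (A below B) inserted at the bottom vertex of w, whose top vertex is C. *)
Definition nest_bot (w : wiring m' n' mc nc m n)
    (w' : wiring ma na mb nb m' n') (x : snk) : option src :=
  let inner s := match s with
    | inl _ => None
    | inr (inl o) => Some (legA o)
    | inr (inr o) => Some (legB o) end in
  let outer s := match s with
    | inl i => Some (legG i)
    | inr (inl o) => inner (w' (gout o))
    | inr (inr o) => Some (legC o) end in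
  let into s := match s with
    | inl i => outer (w (bin i))
    | inr _ => inner s end in
  match x with
  | inl o => outer (w (gout o))
  | inr (inl i) => into (w' (bin i))
  | inr (inr (inl i)) => into (w' (tin i))
  | inr (inr (inr i)) => outer (w (tin i))
  end.

(* w' (B below C) inserted at the top vertex of w, whose bottom vertex is A. *)
Definition nest_top (w : wiring ma na m' n' m n)
    (w' : wiring mb nb mc nc m' n') (x : snk) : option src :=
  let inner s := match s with
    | inl _ => None
    | inr (inl o) => Some (legB o)
    | inr (inr o) => Some (legC o) end in
  let outer s := match s with
    | inl i => Some (legG i)
    | inr (inl o) => Some (legA o)
    | inr (inr o) => inner (w' (gout o)) end in
  let into s := match s with
    | inl i => outer (w (tin i))
    | inr _ => inner s end in
  match x with
  | inl o => outer (w (gout o))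
  | inr (inl i) => outer (w (bin i))
  | inr (inr (inl i)) => into (w' (bin i))
  | inr (inr (inr i)) => into (w' (tin i))
  end.

End Nesting.

Section Properads.
Variable k : fieldType.

Definition sg (e : int) : k := (-1) ^+ absz e.

Record sbimod := SBimod {
  sbcar :> int -> nat -> nat -> lmodType k;
  sact : forall d m n, 'S_m -> 'S_n -> sbcar d m n -> sbcar d m n;
  sact_lin : forall d m n s t, linear (@sact d m n s t);
  sact1 : forall d m n (x : sbcar d m n), sact 1%g 1%g x = x;
  sactM : forall d m n s t s' t' (x : sbcar d m n),
    sact s t (sact s' t' x) = sact (s * s')%g (t' * t)%g x }.

(* Properads through their compositions along two-vertex connected graphs.
   The axioms: bilinearity, equivariance, units, and independence of the way
   a composition along a three-vertex connected graph is nested (the three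
   vertices in a chain, two vertices above a third one, two vertices below a
   third one). *)
Record properad := Properad {
  pcar :> sbimod;
  pid : pcar 0 1%N 1%N;
  pcomp : forall (d1 d2 d : int) m1 n1 m2 n2 m n, d1 + d2 = d ->
    wiring m1 n1 m2 n2 m n -> pcar d1 m1 n1 -> pcar d2 m2 n2 -> pcar d m n;
  pcomp_linl : forall (d1 d2 d : int) m1 n1 m2 n2 m n (h : d1 + d2 = d)
    (w : wiring m1 n1 m2 n2 m n) (y : pcar d2 m2 n2),
    linear (fun x => pcomp h w x y);
  pcomp_linr : forall (d1 d2 d : int) m1 n1 m2 n2 m n (h : d1 + d2 = d)
    (w : wiring m1 n1 m2 n2 m n) (x : pcar d1 m1 n1),
    linear (pcomp h w x);
  pcomp_act : forall (d1 d2 d : int) m1 n1 m2 n2 m n (h : d1 + d2 = d)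
    (w w' : wiring m1 n1 m2 n2 m n) s t s1 t1 s2 t2
    (x : pcar d1 m1 n1) (y : pcar d2 m2 n2),
    relabels s t s1 t1 s2 t2 w w' ->
    sact s t (pcomp h w (sact s1 t1 x) (sact s2 t2 y)) = pcomp h w' x y;
  pcomp_idl : forall d m n (h : 0 + d = d) (w : wiring 1 1 m n m n)
    (s : 'S_m) (t : 'S_n) (y : pcar d m n),
    (forall i, w (tin i) = gin (t i)) ->
    (forall o, w (gout o) = tout (s o) \/
       w (gout o) = bout ord0 /\ w (bin ord0) = tout (s o)) ->
    pcomp h w pid y = sact s t y;
  pcomp_idr : forall d m n (h : d + 0 = d) (w : wiring m n 1 1 m n)
    (s : 'S_m) (t : 'S_n) (x : pcar d m n),
    (forall o, w (gout o) = bout (s o)) ->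
    (forall i, w (bin i) = gin (t i) \/
       w (bin i) = tout ord0 /\ w (tin ord0) = gin (t i)) ->
    pcomp h w x pid = sact s t x;
  pcomp_chain : forall (da db dc dab dbc d : int) ma na mb nb mc nc mx nx my ny m n
    (hab : da + db = dab) (h : dab + dc = d)
    (hbc : db + dc = dbc) (h' : da + dbc = d)
    (w : wiring mx nx mc nc m n) (w' : wiring ma na mb nb mx nx)
    (v : wiring ma na my ny m n) (v' : wiring mb nb mc nc my ny)
    (x : pcar da ma na) (y : pcar db mb nb) (z : pcar dc mc nc),
    nest_bot w w' =1 nest_top v v' ->
    pcomp h w (pcomp hab w' x y) z = pcomp h' v x (pcomp hbc v' y z);
  pcomp_tops : forall (da db dc dab dac d : int) ma na mb nb mc nc mx nx my ny m n
    (hab : da + db = dab) (h : dab + dc = d)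
    (hac : da + dc = dac) (h' : dac + db = d)
    (w : wiring mx nx mc nc m n) (w' : wiring ma na mb nb mx nx)
    (v : wiring my ny mb nb m n) (v' : wiring ma na mc nc my ny)
    (x : pcar da ma na) (y : pcar db mb nb) (z : pcar dc mc nc),
    (forall l, nest_bot w w' l = omap swapBC (nest_bot v v' (swapBC l))) ->
    pcomp h w (pcomp hab w' x y) z =
      sg (db * dc) *: pcomp h' v (pcomp hac v' x z) y;
  pcomp_bots : forall (da db dc dbc dac d : int) ma na mb nb mc nc mx nx my ny m n
    (hbc : db + dc = dbc) (h : da + dbc = d)
    (hac : da + dc = dac) (h' : db + dac = d)
    (w : wiring ma na mx nx m n) (w' : wiring mb nb mc nc mx nx)
    (v : wiring mb nb my ny m n) (v' : wiring ma na mc nc my ny)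
    (x : pcar da ma na) (y : pcar db mb nb) (z : pcar dc mc nc),
    (forall l, nest_top w w' l = omap swapAB (nest_top v v' (swapAB l))) ->
    pcomp h w x (pcomp hbc w' y z) =
      sg (da * db) *: pcomp h' v y (pcomp hac v' x z) }.

(* Properadic terms over an S-bimodule E and extra symbols X; a symbol of
   arity (1,0) contributes a direct summand k to the S-bimodule of
   generators. *)
Inductive term (E : sbimod) (X : int -> nat -> nat -> Type) :
    int -> nat -> nat -> Type :=
| Tgen d m n : E d m n -> term E X d m n
| Tsym d m n : X d m n -> term E X d m n
| Tid : term E X 0 1 1
| Tact d m n : 'S_m -> 'S_n -> term E X d m n -> term E X d m n
| Tcomp (d1 d2 d : int) m1 n1 m2 n2 m n : d1 + d2 = d -> wiring m1 n1 m2 n2 m n ->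
    term E X d1 m1 n1 -> term E X d2 m2 n2 -> term E X d m n
| Tzero d m n : term E X d m n
| Tadd d m n : term E X d m n -> term E X d m n -> term E X d m n
| Tscale d m n : k -> term E X d m n -> term E X d m n.

Arguments Tgen {E X d m n}.
Arguments Tsym {E X d m n}.
Arguments Tid {E X}.
Arguments Tzero {E X d m n}.

Section Presented.
Variables (E : sbimod) (X : int -> nat -> nat -> Type).
Local Notation T := (term E X).
Variable Rel : forall d m n, T d m n -> Prop.

(* The congruence generated by the axioms of properads, the S-bimodule
   structure of E and t = 0 for all t in Rel. *)
Inductive teq : forall d m n, T d m n -> T d m n -> Prop :=
| teq_rel d m n (t : T d m n) : Rel t -> teq t Tzero
| teq_refl d m n (t : T d m n) : teq t t
| teq_sym d m n (t t' : T d m n) : teq t t' -> teq t' t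
| teq_trans d m n (t t' t'' : T d m n) : teq t t' -> teq t' t'' -> teq t t''
| teq_act d m n s s' (t t' : T d m n) :
    teq t t' -> teq (Tact s s' t) (Tact s s' t')
| teq_comp (d1 d2 d : int) m1 n1 m2 n2 m n (h : d1 + d2 = d)
    (w : wiring m1 n1 m2 n2 m n) (t t' : T d1 m1 n1) (r r' : T d2 m2 n2) :
    teq t t' -> teq r r' -> teq (Tcomp h w t r) (Tcomp h w t' r')
| teq_add d m n (t t' r r' : T d m n) :
    teq t t' -> teq r r' -> teq (Tadd t r) (Tadd t' r')
| teq_scale d m n c (t t' : T d m n) :
    teq t t' -> teq (Tscale c t) (Tscale c t')
| teq_addA d m n (x y z : T d m n) :
    teq (Tadd x (Tadd y z)) (Tadd (Tadd x y) z)
| teq_addC d m n (x y : T d m n) : teq (Tadd x y) (Tadd y x)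
| teq_add0 d m n (x : T d m n) : teq (Tadd Tzero x) x
| teq_addN d m n (x : T d m n) : teq (Tadd (Tscale (-1) x) x) Tzero
| teq_scaleA d m n a b (x : T d m n) :
    teq (Tscale a (Tscale b x)) (Tscale (a * b) x)
| teq_scale1 d m n (x : T d m n) : teq (Tscale 1 x) x
| teq_scaleDr d m n a (x y : T d m n) :
    teq (Tscale a (Tadd x y)) (Tadd (Tscale a x) (Tscale a y))
| teq_scaleDl d m n a b (x : T d m n) :
    teq (Tscale (a + b) x) (Tadd (Tscale a x) (Tscale b x))
| teq_gen_lin d m n c (x y : E d m n) :
    teq (Tgen (c *: x + y)) (Tadd (Tscale c (Tgen x)) (Tgen y))
| teq_gen_act d m n s t (x : E d m n) :
    teq (Tgen (sact s t x)) (Tact s t (Tgen x))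
| teq_act_lin d m n s t c (x y : T d m n) :
    teq (Tact s t (Tadd (Tscale c x) y)) (Tadd (Tscale c (Tact s t x)) (Tact s t y))
| teq_act1 d m n (x : T d m n) : teq (Tact 1%g 1%g x) x
| teq_actM d m n s t s' t' (x : T d m n) :
    teq (Tact s t (Tact s' t' x)) (Tact (s * s')%g (t' * t)%g x)
| teq_linl (d1 d2 d : int) m1 n1 m2 n2 m n (h : d1 + d2 = d)
    (w : wiring m1 n1 m2 n2 m n) c (x x' : T d1 m1 n1) (y : T d2 m2 n2) :
    teq (Tcomp h w (Tadd (Tscale c x) x') y)
        (Tadd (Tscale c (Tcomp h w x y)) (Tcomp h w x' y))
| teq_linr (d1 d2 d : int) m1 n1 m2 n2 m n (h : d1 + d2 = d)
    (w : wiring m1 n1 m2 n2 m n) c (x : T d1 m1 n1) (y y' : T d2 m2 n2) :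
    teq (Tcomp h w x (Tadd (Tscale c y) y'))
        (Tadd (Tscale c (Tcomp h w x y)) (Tcomp h w x y'))
| teq_comp_act (d1 d2 d : int) m1 n1 m2 n2 m n (h : d1 + d2 = d)
    (w w' : wiring m1 n1 m2 n2 m n) s t s1 t1 s2 t2
    (x : T d1 m1 n1) (y : T d2 m2 n2) :
    relabels s t s1 t1 s2 t2 w w' ->
    teq (Tact s t (Tcomp h w (Tact s1 t1 x) (Tact s2 t2 y))) (Tcomp h w' x y)
| teq_idl d m n (h : 0 + d = d) (w : wiring 1 1 m n m n)
    (s : 'S_m) (t : 'S_n) (y : T d m n) :
    (forall i, w (tin i) = gin (t i)) ->
    (forall o, w (gout o) = tout (s o) \/
       w (gout o) = bout ord0 /\ w (bin ord0) = tout (s o)) ->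
    teq (Tcomp h w Tid y) (Tact s t y)
| teq_idr d m n (h : d + 0 = d) (w : wiring m n 1 1 m n)
    (s : 'S_m) (t : 'S_n) (x : T d m n) :
    (forall o, w (gout o) = bout (s o)) ->
    (forall i, w (bin i) = gin (t i) \/
       w (bin i) = tout ord0 /\ w (tin ord0) = gin (t i)) ->
    teq (Tcomp h w x Tid) (Tact s t x)
| teq_chain (da db dc dab dbc d : int) ma na mb nb mc nc mx nx my ny m n
    (hab : da + db = dab) (h : dab + dc = d)
    (hbc : db + dc = dbc) (h' : da + dbc = d)
    (w : wiring mx nx mc nc m n) (w' : wiring ma na mb nb mx nx)
    (v : wiring ma na my ny m n) (v' : wiring mb nb mc nc my ny)
    (x : T da ma na) (y : T db mb nb) (z : T dc mc nc) :
    nest_bot w w' =1 nest_top v v' ->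
    teq (Tcomp h w (Tcomp hab w' x y) z) (Tcomp h' v x (Tcomp hbc v' y z))
| teq_tops (da db dc dab dac d : int) ma na mb nb mc nc mx nx my ny m n
    (hab : da + db = dab) (h : dab + dc = d)
    (hac : da + dc = dac) (h' : dac + db = d)
    (w : wiring mx nx mc nc m n) (w' : wiring ma na mb nb mx nx)
    (v : wiring my ny mb nb m n) (v' : wiring ma na mc nc my ny)
    (x : T da ma na) (y : T db mb nb) (z : T dc mc nc) :
    (forall l, nest_bot w w' l = omap swapBC (nest_bot v v' (swapBC l))) ->
    teq (Tcomp h w (Tcomp hab w' x y) z)
        (Tscale (sg (db * dc)) (Tcomp h' v (Tcomp hac v' x z) y))
| teq_bots (da db dc dbc dac d : int) ma na mb nb mc nc mx nx my ny m n
    (hbc : db + dc = dbc) (h : da + dbc = d)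
    (hac : da + dc = dac) (h' : db + dac = d)
    (w : wiring ma na mx nx m n) (w' : wiring mb nb mc nc mx nx)
    (v : wiring mb nb my ny m n) (v' : wiring ma na mc nc my ny)
    (x : T da ma na) (y : T db mb nb) (z : T dc mc nc) :
    (forall l, nest_top w w' l = omap swapAB (nest_top v v' (swapAB l))) ->
    teq (Tcomp h w x (Tcomp hbc w' y z))
        (Tscale (sg (da * db)) (Tcomp h' v y (Tcomp hac v' x z))).

Definition pres d m n : Type :=
  {p : T d m n -> Prop | exists t, p = teq t}.

Definition cl d m n (t : T d m n) : pres d m n :=
  exist _ (teq t) (ex_intro _ t erefl).
Definition rep d m n (x : pres d m n) : T d m n := projT1 (cid (svalP x)).

Lemma clP d m n (t t' : T d m n) : cl t = cl t' <-> teq t t'.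
Proof.
split=> [E0|E0].
  by have /= -> := congr1 sval E0; exact: teq_refl.
apply: eq_exist; apply/funext => r /=; apply/propext; split => H.
  by apply: teq_trans H; apply: teq_sym.
exact: teq_trans H.
Qed.

Lemma cl_eq d m n (t t' : T d m n) : teq t t' -> cl t = cl t'.
Proof. by move/clP. Qed.

Lemma repK d m n (x : pres d m n) : cl (rep x) = x.
Proof.
by case: x => p Hp; rewrite /rep; case: cid => t /= Et; exact: eq_exist.
Qed.

Lemma rep_cl d m n (t : T d m n) : teq (rep (cl t)) t.
Proof. by apply/clP; rewrite repK. Qed.

Lemma presP d m n (x : pres d m n) : exists t, x = cl t.
Proof. by exists (rep x); rewrite repK. Qed.

HB.instance Definition _ d m n := gen_eqMixin (pres d m n).
HB.instance Definition _ d m n := gen_choiceMixin (pres d m n).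

Definition pres_zero d m n : pres d m n := cl Tzero.
Definition pres_opp d m n (x : pres d m n) := cl (Tscale (-1) (rep x)).
Definition pres_add d m n (x y : pres d m n) := cl (Tadd (rep x) (rep y)).
Definition pres_scale d m n c (x : pres d m n) := cl (Tscale c (rep x)).

Lemma pres_addE d m n (x y : T d m n) : pres_add (cl x) (cl y) = cl (Tadd x y).
Proof. by apply: cl_eq; apply: teq_add; exact: rep_cl. Qed.
Lemma pres_scaleE d m n c (x : T d m n) : pres_scale c (cl x) = cl (Tscale c x).
Proof. by apply: cl_eq; apply: teq_scale; exact: rep_cl. Qed.
Lemma pres_oppE d m n (x : T d m n) : pres_opp (cl x) = cl (Tscale (-1) x).
Proof. exact: pres_scaleE. Qed.

Lemma pres_addA d m n : associative (@pres_add d m n).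
Proof.
move=> x y z; have [t ->] := presP x; have [r ->] := presP y.
by have [s ->] := presP z; rewrite !pres_addE; apply: cl_eq; exact: teq_addA.
Qed.
Lemma pres_addC d m n : commutative (@pres_add d m n).
Proof.
move=> x y; have [t ->] := presP x; have [r ->] := presP y.
by rewrite !pres_addE; apply: cl_eq; exact: teq_addC.
Qed.
Lemma pres_add0 d m n : left_id (@pres_zero d m n) (@pres_add d m n).
Proof.
by move=> x; have [t ->] := presP x; rewrite pres_addE; apply: cl_eq; exact: teq_add0.
Qed.
Lemma pres_addN d m n :
  left_inverse (@pres_zero d m n) (@pres_opp d m n) (@pres_add d m n).
Proof.
move=> x; have [t ->] := presP x.
by rewrite pres_oppE pres_addE; apply: cl_eq; exact: teq_addN.
Qed.

HB.instance Definition _ d m n := GRing.isZmodule.Build (pres d m n)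
  (@pres_addA d m n) (@pres_addC d m n) (@pres_add0 d m n) (@pres_addN d m n).

Lemma pres_scaleA d m n a b (x : pres d m n) :
  pres_scale a (pres_scale b x) = pres_scale (a * b) x.
Proof.
by have [t ->] := presP x; rewrite !pres_scaleE; apply: cl_eq; exact: teq_scaleA.
Qed.
Lemma pres_scale1 d m n : left_id 1 (@pres_scale d m n).
Proof.
by move=> x; have [t ->] := presP x; rewrite pres_scaleE; apply: cl_eq; exact: teq_scale1.
Qed.
Lemma pres_scaleDr d m n : right_distributive (@pres_scale d m n) +%R.
Proof.
move=> a x y; have [t ->] := presP x; have [r ->] := presP y.
rewrite /GRing.add /= pres_addE !pres_scaleE pres_addE.
by apply: cl_eq; exact: teq_scaleDr.
Qed.
Lemma pres_scaleDl d m n (x : pres d m n) :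
  {morph (fun a => pres_scale a x) : a b / a + b}.
Proof.
move=> a b; have [t ->] := presP x.
rewrite [in RHS]/GRing.add /= !pres_scaleE pres_addE.
by apply: cl_eq; exact: teq_scaleDl.
Qed.

HB.instance Definition _ d m n := GRing.Zmodule_isLmodule.Build k (pres d m n)
  (@pres_scaleA d m n) (@pres_scale1 d m n) (@pres_scaleDr d m n)
  (@pres_scaleDl d m n).

Lemma cl_lin d m n c (x y : T d m n) :
  cl (Tadd (Tscale c x) y) = c *: cl x + cl y.
Proof. by rewrite /GRing.add /= /GRing.scale /= pres_scaleE pres_addE. Qed.
Lemma cl_scale d m n c (x : T d m n) : cl (Tscale c x) = c *: cl x.
Proof. by rewrite /GRing.scale /= pres_scaleE. Qed.

Definition pres_act d m n s t (x : pres d m n) : pres d m n :=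
  cl (Tact s t (rep x)).
Lemma pres_actE d m n s t (x : T d m n) : pres_act s t (cl x) = cl (Tact s t x).
Proof. by apply: cl_eq; apply: teq_act; exact: rep_cl. Qed.

Lemma pres_act_lin d m n s t : linear (@pres_act d m n s t).
Proof.
move=> c x y; have [r ->] := presP x; have [r' ->] := presP y.
by rewrite -cl_lin !pres_actE -cl_lin; apply: cl_eq; exact: teq_act_lin.
Qed.
Lemma pres_act1 d m n (x : pres d m n) : pres_act 1%g 1%g x = x.
Proof.
by have [r ->] := presP x; rewrite pres_actE; apply: cl_eq; exact: teq_act1.
Qed.
Lemma pres_actM d m n s t s' t' (x : pres d m n) :
  pres_act s t (pres_act s' t' x) = pres_act (s * s')%g (t' * t)%g x.
Proof.
by have [r ->] := presP x; rewrite !pres_actE; apply: cl_eq; exact: teq_actM.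
Qed.

Definition pres_sbimod : sbimod :=
  @SBimod (fun d m n => pres d m n) pres_act pres_act_lin pres_act1 pres_actM.

Definition pres_comp (d1 d2 d : int) m1 n1 m2 n2 m n (h : d1 + d2 = d)
    (w : wiring m1 n1 m2 n2 m n) (x : pres d1 m1 n1) (y : pres d2 m2 n2) :
    pres d m n := cl (Tcomp h w (rep x) (rep y)).
Lemma pres_compE (d1 d2 d : int) m1 n1 m2 n2 m n (h : d1 + d2 = d)
    (w : wiring m1 n1 m2 n2 m n) (x : T d1 m1 n1) (y : T d2 m2 n2) :
  pres_comp h w (cl x) (cl y) = cl (Tcomp h w x y).
Proof. by apply: cl_eq; apply: teq_comp; exact: rep_cl. Qed.

Lemma pres_comp_linl (d1 d2 d : int) m1 n1 m2 n2 m n (h : d1 + d2 = d)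
    (w : wiring m1 n1 m2 n2 m n) (y : pres d2 m2 n2) :
  linear (fun x : pres d1 m1 n1 => pres_comp h w x y).
Proof.
move=> c x x'; have [r ->] := presP x; have [r' ->] := presP x'.
have [s ->] := presP y.
by rewrite -cl_lin !pres_compE -cl_lin; apply: cl_eq; exact: teq_linl.
Qed.

Lemma pres_comp_linr (d1 d2 d : int) m1 n1 m2 n2 m n (h : d1 + d2 = d)
    (w : wiring m1 n1 m2 n2 m n) (x : pres d1 m1 n1) :
  linear (pres_comp h w x : pres d2 m2 n2 -> pres d m n).
Proof.
move=> c y y'; have [r ->] := presP x; have [s ->] := presP y.
have [s' ->] := presP y'.
by rewrite -cl_lin !pres_compE -cl_lin; apply: cl_eq; exact: teq_linr.
Qed.

Lemma pres_comp_act (d1 d2 d : int) m1 n1 m2 n2 m n (h : d1 + d2 = d)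
    (w w' : wiring m1 n1 m2 n2 m n) s t s1 t1 s2 t2
    (x : pres d1 m1 n1) (y : pres d2 m2 n2) :
  relabels s t s1 t1 s2 t2 w w' ->
  pres_act s t (pres_comp h w (pres_act s1 t1 x) (pres_act s2 t2 y)) =
  pres_comp h w' x y.
Proof.
move=> ww'; have [r ->] := presP x; have [r' ->] := presP y.
rewrite (pres_actE s1) (pres_actE s2) (pres_compE h w) (pres_compE h w').
by rewrite (pres_actE s); apply: cl_eq; exact: teq_comp_act.
Qed.

Lemma pres_comp_idl d m n (h : 0 + d = d) (w : wiring 1 1 m n m n)
    (s : 'S_m) (t : 'S_n) (y : pres d m n) :
  (forall i, w (tin i) = gin (t i)) ->
  (forall o, w (gout o) = tout (s o) \/
     w (gout o) = bout ord0 /\ w (bin ord0) = tout (s o)) ->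
  pres_comp h w (cl Tid) y = pres_act s t y.
Proof.
move=> H1 H2; have [r ->] := presP y.
by rewrite pres_compE pres_actE; apply: cl_eq; exact: teq_idl.
Qed.

Lemma pres_comp_idr d m n (h : d + 0 = d) (w : wiring m n 1 1 m n)
    (s : 'S_m) (t : 'S_n) (x : pres d m n) :
  (forall o, w (gout o) = bout (s o)) ->
  (forall i, w (bin i) = gin (t i) \/
     w (bin i) = tout ord0 /\ w (tin ord0) = gin (t i)) ->
  pres_comp h w x (cl Tid) = pres_act s t x.
Proof.
move=> H1 H2; have [r ->] := presP x.
by rewrite pres_compE pres_actE; apply: cl_eq; exact: teq_idr.
Qed.

Lemma pres_comp_chain (da db dc dab dbc d : int) ma na mb nb mc nc mx nx my ny m n
    (hab : da + db = dab) (h : dab + dc = d)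
    (hbc : db + dc = dbc) (h' : da + dbc = d)
    (w : wiring mx nx mc nc m n) (w' : wiring ma na mb nb mx nx)
    (v : wiring ma na my ny m n) (v' : wiring mb nb mc nc my ny)
    (x : pres da ma na) (y : pres db mb nb) (z : pres dc mc nc) :
  nest_bot w w' =1 nest_top v v' ->
  pres_comp h w (pres_comp hab w' x y) z =
  pres_comp h' v x (pres_comp hbc v' y z).
Proof.
move=> H; have [rx ->] := presP x; have [ry ->] := presP y.
have [rz ->] := presP z.
by rewrite !pres_compE; apply: cl_eq; exact: teq_chain.
Qed.

Lemma pres_comp_tops (da db dc dab dac d : int) ma na mb nb mc nc mx nx my ny m n
    (hab : da + db = dab) (h : dab + dc = d)
    (hac : da + dc = dac) (h' : dac + db = d)
    (w : wiring mx nx mc nc m n) (w' : wiring ma na mb nb mx nx)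
    (v : wiring my ny mb nb m n) (v' : wiring ma na mc nc my ny)
    (x : pres da ma na) (y : pres db mb nb) (z : pres dc mc nc) :
  (forall l, nest_bot w w' l = omap swapBC (nest_bot v v' (swapBC l))) ->
  pres_comp h w (pres_comp hab w' x y) z =
  sg (db * dc) *: pres_comp h' v (pres_comp hac v' x z) y.
Proof.
move=> H; have [rx ->] := presP x; have [ry ->] := presP y.
have [rz ->] := presP z.
by rewrite !pres_compE -cl_scale; apply: cl_eq; exact: teq_tops.
Qed.

Lemma pres_comp_bots (da db dc dbc dac d : int) ma na mb nb mc nc mx nx my ny m n
    (hbc : db + dc = dbc) (h : da + dbc = d)
    (hac : da + dc = dac) (h' : db + dac = d)
    (w : wiring ma na mx nx m n) (w' : wiring mb nb mc nc mx nx)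
    (v : wiring mb nb my ny m n) (v' : wiring ma na mc nc my ny)
    (x : pres da ma na) (y : pres db mb nb) (z : pres dc mc nc) :
  (forall l, nest_top w w' l = omap swapAB (nest_top v v' (swapAB l))) ->
  pres_comp h w x (pres_comp hbc w' y z) =
  sg (da * db) *: pres_comp h' v y (pres_comp hac v' x z).
Proof.
move=> H; have [rx ->] := presP x; have [ry ->] := presP y.
have [rz ->] := presP z.
by rewrite !pres_compE -cl_scale; apply: cl_eq; exact: teq_bots.
Qed.

Definition presented : properad :=
  @Properad pres_sbimod (cl Tid) pres_comp pres_comp_linl pres_comp_linr
    pres_comp_act pres_comp_idl pres_comp_idr pres_comp_chain pres_comp_tops
    pres_comp_bots.

Definition gen d m n (x : E d m n) : presented d m n := cl (Tgen x).

End Presented.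

Fixpoint tmap (E : sbimod) (X Y : int -> nat -> nat -> Type)
    (f : forall d m n, X d m n -> Y d m n) d m n (t : term E X d m n) :
    term E Y d m n :=
  match t with
  | Tgen _ _ _ e => Tgen e
  | Tsym _ _ _ x => Tsym (f _ _ _ x)
  | Tid => Tid
  | Tact _ _ _ s s' t => Tact s s' (tmap f t)
  | Tcomp _ _ _ _ _ _ _ _ _ h w t t' => Tcomp h w (tmap f t) (tmap f t')
  | Tzero _ _ _ => Tzero
  | Tadd _ _ _ t t' => Tadd (tmap f t) (tmap f t')
  | Tscale _ _ _ c t => Tscale c (tmap f t)
  end.

Definition no_sym (d : int) (m n : nat) : Type := void.

(* The free properad G(E) and its two-vertex part. *)
Definition free_properad (E : sbimod) : properad :=
  @presented E no_sym (fun _ _ _ _ => False).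

Inductive two_vertex (E : sbimod) :
    forall d m n, free_properad E d m n -> Prop :=
| tv_comp (d1 d2 d : int) m1 n1 m2 n2 m n (h : d1 + d2 = d)
    (w : wiring m1 n1 m2 n2 m n) (x : E d1 m1 n1) (y : E d2 m2 n2) :
    two_vertex (pcomp h w (gen _ x) (gen _ y) : free_properad E d m n)
| tv_zero d m n : two_vertex (0 : free_properad E d m n)
| tv_lin d m n c (x y : free_properad E d m n) :
    two_vertex x -> two_vertex y -> two_vertex (c *: x + y).

Record quad_data := QuadData {
  qgen :> sbimod;
  qrel : forall d m n, free_properad qgen d m n -> Prop;
  qrel_tv : forall d m n (x : free_properad qgen d m n),
    qrel x -> two_vertex x;
  qrel0 : forall d m n, qrel (0 : free_properad qgen d m n);
  qrel_lin : forall d m n c (x y : free_properad qgen d m n),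
    qrel x -> qrel y -> qrel (c *: x + y);
  qrel_act : forall d m n s t (x : free_properad qgen d m n),
    qrel x -> qrel (sact s t x) }.

Definition quad_rel (E : sbimod)
    (R : forall d m n, free_properad E d m n -> Prop)
    d m n (t : term E no_sym d m n) : Prop := R d m n (cl _ t).

(* P(E,R) = G(E)/(R) *)
Definition quad_properad (E : sbimod)
    (R : forall d m n, free_properad E d m n -> Prop) : properad :=
  presented (quad_rel R).

Definition fin_dim_sbimod (E : sbimod) : Prop :=
  forall d m n, exists s : seq (E d m n), forall x : E d m n,
    exists c : 'I_(size s) -> k, x = \sum_i c i *: s`_i.

Definition dual (V : lmodType k) : Type := {scalar V}.

Section Dual.
Variable V : lmodType k.

Definition mkdual (f : V -> k) (hf : scalar f) : dual V :=
  HB.pack f (GRing.isLinear.Build k V k *%R f hf).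

Lemma dual_ext (f g : dual V) : (forall x, f x = g x) -> f = g.
Proof.
case: f => f [[f1] [f2]]; case: g => g [[g1] [g2]] /= /funext E0.
rewrite /= in E0; subst g; congr (GRing.Linear.Pack (GRing.Linear.Class _ _)).
  by congr (_ _); exact: Prop_irrelevance.
by congr (_ _); exact: Prop_irrelevance.
Qed.

HB.instance Definition _ := gen_eqMixin (dual V).
HB.instance Definition _ := gen_choiceMixin (dual V).

Lemma dual_zero_subproof : scalar (fun _ : V => 0 : k).
Proof. by move=> c x y; rewrite mulr0 addr0. Qed.
Lemma dual_opp_subproof (f : dual V) : scalar (fun x => - f x).
Proof. by move=> c x y; rewrite linearP opprD mulrN. Qed.
Lemma dual_add_subproof (f g : dual V) : scalar (fun x => f x + g x).
Proof. by move=> c x y; rewrite !linearP mulrDr addrACA. Qed.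
Lemma dual_scale_subproof a (f : dual V) : scalar (fun x => a * f x).
Proof. by move=> c x y; rewrite linearP mulrDr mulrCA. Qed.

Definition dual_zero := mkdual dual_zero_subproof.
Definition dual_opp f := mkdual (dual_opp_subproof f).
Definition dual_add f g := mkdual (dual_add_subproof f g).
Definition dual_scale a f := mkdual (dual_scale_subproof a f).

Lemma dual_addA : associative dual_add.
Proof. by move=> f g h; apply: dual_ext => x /=; rewrite addrA. Qed.
Lemma dual_addC : commutative dual_add.
Proof. by move=> f g; apply: dual_ext => x /=; rewrite addrC. Qed.
Lemma dual_add0 : left_id dual_zero dual_add.
Proof. by move=> f; apply: dual_ext => x /=; rewrite add0r. Qed.
Lemma dual_addN : left_inverse dual_zero dual_opp dual_add.
Proof. by move=> f; apply: dual_ext => x /=; rewrite addNr. Qed.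

HB.instance Definition _ := GRing.isZmodule.Build (dual V)
  dual_addA dual_addC dual_add0 dual_addN.

Lemma dual_scaleA a b f : dual_scale a (dual_scale b f) = dual_scale (a * b) f.
Proof. by apply: dual_ext => x /=; rewrite mulrA. Qed.
Lemma dual_scale1 : left_id 1 dual_scale.
Proof. by move=> f; apply: dual_ext => x /=; rewrite mul1r. Qed.
Lemma dual_scaleDr : right_distributive dual_scale +%R.
Proof. by move=> a f g; apply: dual_ext => x /=; rewrite mulrDr. Qed.
Lemma dual_scaleDl f : {morph (fun a => dual_scale a f) : a b / a + b}.
Proof. by move=> a b; apply: dual_ext => x /=; rewrite mulrDl. Qed.

HB.instance Definition _ := GRing.Zmodule_isLmodule.Build k (dual V)
  dual_scaleA dual_scale1 dual_scaleDr dual_scaleDl.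

End Dual.

(* The S-bimodule whose degree d component is the dual of the degree r d
   component of E, with the contragredient action. *)
Section DualSbimod.
Variables (r : int -> int) (E : sbimod).

Lemma dual_act_subproof d m n (s : 'S_m) (t : 'S_n) (f : dual (E (r d) m n)) :
  scalar (fun x => f (sact s^-1%g t^-1%g x)).
Proof. by move=> c x y; rewrite sact_lin linearP. Qed.

Definition dual_act d m n s t (f : dual (E (r d) m n)) : dual (E (r d) m n) :=
  mkdual (dual_act_subproof s t f).

Lemma dual_act_lin d m n s t : linear (@dual_act d m n s t).
Proof. by move=> c f g; apply: dual_ext. Qed.
Lemma dual_act1 d m n (f : dual (E (r d) m n)) : dual_act 1%g 1%g f = f.
Proof. by apply: dual_ext => x /=; rewrite !invg1 sact1. Qed.
Lemma dual_actM d m n s t s' t' (f : dual (E (r d) m n)) :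
  dual_act s t (dual_act s' t' f) = dual_act (s * s')%g (t' * t)%g f.
Proof. by apply: dual_ext => x /=; rewrite sactM !invMg. Qed.

Definition dual_sbimod : sbimod :=
  @SBimod (fun d m n => dual (E (r d) m n)) dual_act dual_act_lin dual_act1
    dual_actM.

End DualSbimod.

Definition gdual (E : sbimod) : sbimod := dual_sbimod (fun d => - d) E.

(* s^{-1} E^* *)
Definition sdual (E : sbimod) : sbimod := dual_sbimod (fun d => - (d + 1)) E.

(* (number of outputs, number of inputs, degree) of a decoration *)
Definition prof : Type := (nat * nat * int)%type.
Definition pouts (b : prof) : nat := b.1.1.
Definition pins (b : prof) : nat := b.1.2.
Definition pdeg (b : prof) : int := b.2.
Definition at_prof (E : sbimod) (b : prof) : lmodType k :=
  E (pdeg b) (pouts b) (pins b).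

Definition wiring_of (b t : prof) (m n : nat) : Type :=
  wiring (pouts b) (pins b) (pouts t) (pins t) m n.

(* A finite formal sum of two-vertex graphs decorated by pairs of elements of
   E, of total degree d and arity (m,n). *)
Record gsum (E : sbimod) (d : int) (m n : nat) := GSum {
  gsupp : seq (prof * prof);
  gsupp_uniq : uniq gsupp;
  gterms : forall b t : prof, pdeg b + pdeg t = d -> wiring_of b t m n ->
    seq (at_prof E b * at_prof E t);
  gterms_out : forall b t h (w : wiring_of b t m n),
    (b, t) \notin gsupp -> gterms h w = [::] }.

Definition gsum0 (E : sbimod) d m n : gsum E d m n :=
  @GSum E d m n [::] isT (fun _ _ _ _ => [::]) (fun _ _ _ _ _ => erefl).

Definition gsum_eval (E : sbimod) d m n (V : nmodType) (q : gsum E d m n)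
    (F : forall b t, pdeg b + pdeg t = d -> wiring_of b t m n ->
         at_prof E b -> at_prof E t -> V) : V :=
  \sum_(i <- gsupp q)
    if @eqP _ (pdeg i.1 + pdeg i.2) d is ReflectT h
    then \sum_(w : wiring_of i.1 i.2 m n) \sum_(p <- gterms q h w) F _ _ h w p.1 p.2
    else 0.

Definition gsum_free (E : sbimod) d m n (q : gsum E d m n) :
    free_properad E d m n :=
  gsum_eval q (fun b t h w x y => pcomp h w (gen _ x) (gen _ y)).

Section Orthogonal.
Variable E : sbimod.

Definition sprof (b : prof) : prof := (pouts b, pins b, - (pdeg b + 1)).

Lemma sprof_deg b t d : pdeg b + pdeg t = d ->
  pdeg (sprof b) + pdeg (sprof t) = - (d + 2).
Proof. by move=> <-; rewrite /= -opprD addrACA. Qed.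

(* The pairing of G(s^{-1}E^* )^(2) with G(E)^(2), on formal sums.  On the graph
   w0 decorated by (s^{-1}f, s^{-1}g) and the graph w decorated by (x, y), it
   is the sum of the values of f (x) g over all isomorphisms between the two
   graphs.  The sign is the one of
   s^{-1}f (x) s^{-1}g = (-1)^{|f|} s^{-2}(f (x) g) and
   (f (x) g)(x (x) y) = (-1)^{|g||x|} f(x) g(y). *)
Definition pairing d m n (q' : gsum (sdual E) d m n)
    (q : gsum E (- (d + 2)) m n) : k :=
  gsum_eval (V := k) q' (fun b t h w0 f g =>
    \sum_(w : wiring_of (sprof b) (sprof t) m n)
    \sum_(s1 : 'S_(pouts b)) \sum_(t1 : 'S_(pins b))
    \sum_(s2 : 'S_(pouts t)) \sum_(t2 : 'S_(pins t) |
        relabels 1%g 1%g s1 t1 s2 t2 (w0 : wiring _ _ _ _ m n) w)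
    \sum_(p <- gterms q (sprof_deg h) w)
      sg (pdeg (sprof b) + pdeg (sprof b) * pdeg (sprof t)) *
      (f : dual _) (sact s1 t1 p.1) * (g : dual _) (sact s2 t2 p.2)).

(* s^{-2} R^\perp *)
Definition orth (R : forall d m n, free_properad E d m n -> Prop)
    d m n (x : free_properad (sdual E) d m n) : Prop :=
  exists2 q' : gsum (sdual E) d m n, gsum_free q' = x &
    forall q : gsum E (- (d + 2)) m n, R _ _ _ (gsum_free q) -> pairing q' q = 0.

End Orthogonal.

(* P^! = P(s^{-1}E^*, s^{-2}R^\perp) *)
Definition koszul_dual (Q : quad_data) : properad :=
  quad_properad (orth (@qrel Q)).

Inductive unit_sym : int -> nat -> nat -> Type := Unit_sym : unit_sym 0 1 0.

Definition is_basis (V : lmodType k) (s : seq V) : Prop :=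
  forall x : V, exists! c : {ffun 'I_(size s) -> k}, x = \sum_i c i *: s`_i.

(* chi_null e i: the basis element e is chosen, and so is its input i.  The
   maps chi_1, chi_2 : E(1,2) -> k are of degree 0, hence vanish outside
   degree 0. *)
Record chi_datum (E : sbimod) := ChiDatum {
  chi1 : dual (E 0 1%N 2%N);
  chi2 : dual (E 0 1%N 2%N);
  chi_null : forall d m n, E d m n.+1 -> 'I_n.+1 -> Prop;
  chi_nullP : forall d m n, (m, n.+1) <> (1%N, 2%N) ->
    exists2 s : seq (E d m n.+1), is_basis s &
      forall e i, chi_null e i -> e \in s;
  chi_null12 : forall d (e : E d 1%N 2%N) i, ~ chi_null e i }.

Section Unital.
Variables (E : sbimod) (R : forall d m n, free_properad E d m n -> Prop).
Variable chi : chi_datum E.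

Lemma void_elim d m n (x : no_sym d m n) : unit_sym d m n.
Proof. by case: x. Qed.

Local Notation T := (term E unit_sym).
Let u : T 0 1 0 := Tsym Unit_sym.
Let inc d m n (t : term E no_sym d m n) : T d m n := tmap void_elim t.

(* e o_i^1 u *)
Let eu d m n (e : E d m n.+1) (i : 'I_n.+1) : T d m n :=
  Tcomp (addr0 d) (plug m i) (Tgen e) u.

Inductive unital_rel : forall d m n, T d m n -> Prop :=
| ur_rel d m n (t : term E no_sym d m n) : quad_rel R t -> unital_rel (inc t)
| ur_chi1 (e : E 0 1%N 2%N) :
    unital_rel (Tadd (eu e ord0) (Tscale (- chi1 chi e) Tid))
| ur_chi2 (e : E 0 1%N 2%N) :
    unital_rel (Tadd (eu e ord_max) (Tscale (- chi2 chi e) Tid))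
| ur_chi_deg d (e : E d 1%N 2%N) i : d <> 0 -> unital_rel (eu e i)
| ur_null d m n (e : E d m n.+1) i : chi_null chi e i -> unital_rel (eu e i).

(* u_chi P *)
Definition unital_properad : properad := presented unital_rel.

Definition unit_elt : unital_properad 0 1%N 0%N := cl _ u.

Lemma inc_teq d m n (t t' : term E no_sym d m n) :
  teq (quad_rel R) t t' -> teq unital_rel (inc t) (inc t').
Proof.
elim=> *; rewrite /inc /=.
by apply: teq_rel; apply: ur_rel.
all: by econstructor; eauto.
Qed.

Definition canon d m n (x : quad_properad R d m n) : unital_properad d m n :=
  cl unital_rel (inc (rep x)).

Lemma canonE d m n (t : term E no_sym d m n) : canon (cl _ t) = cl _ (inc t).
Proof. by apply: cl_eq; apply: inc_teq; exact: rep_cl. Qed.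

Lemma canon_lin d m n : linear (@canon d m n).
Proof.
move=> c x y; have [t ->] := presP x; have [r ->] := presP y.
by rewrite -cl_lin !canonE -cl_lin.
Qed.

Definition extendable_by : Prop :=
  ~ ((forall e, chi1 chi e = 0) /\ (forall e, chi2 chi e = 0)) /\
  forall d m n, injective (@canon d m n).

End Unital.

(* q represents the image of phi under the dual of the two-vertex compositions
   of Q; here (phi1 (x) phi2)(x (x) y) = (-1)^{|phi2||x|} phi1(x) phi2(y). *)
Definition is_decomp (Q : properad) d m n (phi : gdual Q d m n)
    (q : gsum (gdual Q) d m n) : Prop :=
  forall (b t : prof) (hd : pdeg b + pdeg t = d) (h : - pdeg b + - pdeg t = - d)
    (w : wiring_of b t m n) (x : Q (- pdeg b) (pouts b) (pins b))
    (y : Q (- pdeg t) (pouts t) (pins t)),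
    (phi : dual _) (pcomp h w x y) =
    \sum_(p <- gterms q hd w)
      sg (pdeg t * pdeg b) * (p.1 : dual _) x * (p.2 : dual _) y.

Definition inf_coproperad (Q : properad) : Prop :=
  forall d m n (phi : gdual Q d m n), exists q, is_decomp phi q.

Definition decomp (Q : properad) d m n (phi : gdual Q d m n) :
    gsum (gdual Q) d m n :=
  if pselect (exists q, is_decomp phi q) is left e then projT1 (cid e)
  else gsum0 _ d m n.

Definition twistable_by (Q : quad_data) (chi : chi_datum (sdual Q)) : Prop :=
  extendable_by (orth (@qrel Q)) chi /\
  inf_coproperad (unital_properad (orth (@qrel Q)) chi).

Record cmod := CMod {
  cmcar :> int -> lmodType k;
  fil : nat -> forall d, cmcar d -> Prop;
  fil_zero : forall p d, fil p (0 : cmcar d);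
  fil_lin : forall p d c (x y : cmcar d),
    fil p x -> fil p y -> fil p (c *: x + y);
  fil_all : forall d (x : cmcar d), fil 0 x;
  fil_desc : forall p d (x : cmcar d), fil p.+1 x -> fil p x;
  fil_sep : forall d (x : cmcar d), (forall p, fil p x) -> x = 0;
  fil_complete : forall d (s : nat -> cmcar d),
    (forall p, fil p (s p.+1 - s p)) -> exists l, forall p, fil p (l - s p) }.

(* Families of maps between the graded components; those of degree e are
   required to vanish outside B_i -> C_{i+e}. *)
Definition gmap (B C : cmod) : Type := forall i j, B i -> C j.

Definition gmorph (B C : cmod) (e : int) (f : gmap B C) : Prop :=
  [/\ forall i j, linear (f i j),
      forall i j x, j <> i + e -> f i j x = 0 &
      forall p i j x, fil p x -> fil p (f i j x)].

Definition gzero {B C : cmod} : gmap B C := fun _ _ _ => 0.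
Definition gadd {B C : cmod} (f g : gmap B C) : gmap B C :=
  fun i j x => f i j x + g i j x.
Definition gscale {B C : cmod} (c : k) (f : gmap B C) : gmap B C :=
  fun i j x => c *: f i j x.
Definition gid {B : cmod} : gmap B B := fun i j x =>
  if @eqP _ i j is ReflectT E then eq_rect i (fun l => B l) x j E else 0.
(* f o g for g of degree e *)
Definition gcomp {B C D : cmod} (e : int) (f : gmap C D) (g : gmap B C) :
    gmap B D := fun i j x => f (i + e) j (g i (i + e) x).

Definition the_gmap {B C : cmod} (P : gmap B C -> Prop) : gmap B C :=
  if pselect (exists f, P f) is left e then projT1 (cid e) else gzero.

Section Concat.
Variables (V : int -> Type) (a b : nat).

Definition cat_deg (d1 : 'I_a -> int) (d2 : 'I_b -> int) (l : 'I_(a + b)) : int :=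
  match split l with inl i => d1 i | inr j => d2 j end.

Definition cat_elt (d1 : 'I_a -> int) (d2 : 'I_b -> int)
    (x : forall i, V (d1 i)) (y : forall j, V (d2 j)) (l : 'I_(a + b)) :
    V (cat_deg d1 d2 l) :=
  match split l as s return V (match s with inl i => d1 i | inr j => d2 j end)
  with inl i => x i | inr j => y j end.

End Concat.

(* Multilinear maps A^n -> B of degree e compatible with the filtrations. *)
Definition multilin (A B : cmod) (n : nat) (e : int)
    (f : forall (dl : 'I_n -> int) (d : int), \sum_i dl i + e = d ->
         (forall i, A (dl i)) -> B d) : Prop :=
  (forall dl d h i c (x y z : forall i, A (dl i)),
     z i = c *: x i + y i ->
     (forall j, j != i -> x j = z j /\ y j = z j) ->
     f dl d h z = c *: f dl d h x + f dl d h y) /\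
  (forall dl d h (p : 'I_n -> nat) (x : forall i, A (dl i)),
     (forall i, fil (p i) (x i)) -> fil (\sum_i p i)%N (f dl d h x)).

(* Completed tensor powers of A: the universal multilinear maps from A^n to
   complete graded modules, together with the concatenation products (which
   are determined by the universal property). *)
Record tensor_powers (A : cmod) := TensorPowers {
  tpow :> nat -> cmod;
  tens : forall n (dl : 'I_n -> int) (d : int), \sum_i dl i + 0 = d ->
    (forall i, A (dl i)) -> tpow n d;
  tens_multilin : forall n, multilin (@tens n);
  tens_univ : forall (B : cmod) n e f, @multilin A B n e f ->
    exists2 g : gmap (tpow n) B, gmorph e g &
      forall (dl : 'I_n -> int) (d d' : int) (h : \sum_i dl i + 0 = d)
          (h' : \sum_i dl i + e = d') x,
        g d d' (tens h x) = f dl d' h' x;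
  tens_uniq : forall (B : cmod) n e (g g' : gmap (tpow n) B),
    gmorph e g -> gmorph e g' ->
    (forall (dl : 'I_n -> int) (d d' : int) (h : \sum_i dl i + 0 = d) x,
        g d d' (tens h x) = g' d d' (tens h x)) ->
    forall i j x, g i j x = g' i j x;
  tcat : forall a b i j, tpow a i -> tpow b j -> tpow (a + b)%N (i + j);
  tcat_linl : forall a b i j (y : tpow b j),
    linear (fun x : tpow a i => tcat x y);
  tcat_linr : forall a b i j (x : tpow a i),
    linear (fun y : tpow b j => tcat x y);
  tcat_fil : forall a b i j p q (x : tpow a i) (y : tpow b j),
    fil p x -> fil q y -> fil (p + q) (tcat x y);
  tcat_tens : forall a b (d1 : 'I_a -> int) (d2 : 'I_b -> int) (i j : int)
    (h1 : \sum_l d1 l + 0 = i) (h2 : \sum_l d2 l + 0 = j)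
    (h : \sum_l cat_deg d1 d2 l + 0 = i + j) x y,
    tcat (tens h1 x) (tens h2 y) = tens h (@cat_elt (fun l => A l) a b d1 d2 x y) }.

Section Endo.
Variables (A : cmod) (T : tensor_powers A).

(* For a bijection s, the map x_1 (x) ... (x) x_b |-> +/- x_{s 1} (x) ... (x)
   x_{s a}, with the Koszul sign. *)
Definition koszul_sign a b (s : 'I_a -> 'I_b) (dl : 'I_b -> int) : k :=
  sg (\sum_(i : 'I_a) \sum_(j : 'I_a | (i < j)%N && (s j < s i)%N)
        dl (s i) * dl (s j)).

Definition reorder a b (s : 'I_a -> 'I_b) : gmap (T b) (T a) :=
  the_gmap (fun f => gmorph 0 f /\
    forall dl d (h : \sum_i dl i + 0 = d) (h' : \sum_i dl (s i) + 0 = d)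
      (x : forall i, A (dl i)),
      f d d (tens T h x) = koszul_sign s dl *: tens T h' (fun i => x (s i))).

Arguments reorder {a b} s i j x : rename.

(* f (x) g for f of degree e1 and g of degree e2:
   (f (x) g)(x (x) y) = (-1)^{|g||x|} f(x) (x) g(y). *)
Definition gtens (e1 e2 : int) a a' b b' (f : gmap (T a) (T a'))
    (g : gmap (T b) (T b')) : gmap (T (a + b)%N) (T (a' + b')%N) :=
  the_gmap (fun h => gmorph (e1 + e2) h /\
    forall i j (x : T a i) (y : T b j),
      h (i + j) ((i + e1) + (j + e2)) (tcat x y) =
      sg (e2 * i) *: tcat (f i (i + e1) x) (g j (j + e2) y)).

(* The action of (s,t) on end_A(m,n). *)
Definition end_act m n (s : 'S_m) (t : 'S_n) (f : gmap (T n) (T m)) :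
    gmap (T n) (T m) :=
  fun i j x => reorder s j j (f i j (reorder t i i x)).

Arguments end_act {m n} s t f i j x : rename.

(* Composition along a two-vertex graph w: with p the number of global inputs
   at the bottom vertex and q the number of global outputs at the top vertex,
   the composite
     A^n -> A^{p+n2} -> A^{p+m2} -> A^{n1+q} -> A^{m1+q} -> A^m
   of reorderings with id (x) g and f (x) id. *)
Section EndComp.
Variables m1 n1 m2 n2 m n : nat.
Variable w : wiring m1 n1 m2 n2 m n.

Definition ext_in : {set 'I_n1} := [set i | is_gin (w (bin i))].
Definition ext_out : {set 'I_m2} := [set l | [exists o, w (gout o) == tout l]].

Definition get_gin (s : source m1 m2 n) : is_gin s -> 'I_n :=
  match s with inl i => fun _ => i | inr _ => fun h => match notF h with end end.
Definition get_tout (s : source m1 m2 n) : is_tout s -> 'I_m2 :=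
  match s with
  | inr (inr o) => fun _ => o
  | _ => fun h => match notF h with end
  end.

Lemma ext_inP (i : 'I_#|ext_in|) : is_gin (w (bin (enum_val i))).
Proof. by have := enum_valP i; rewrite inE. Qed.
Lemma tin_gin (j : 'I_n2) : is_gin (w (tin j)).
Proof. by have /and5P[_ _ /forallP/(_ j)] := wmapP w. Qed.
Lemma int_inP (i : 'I_n1) : i \notin ext_in -> is_tout (w (bin i)).
Proof.
rewrite inE; have /and5P[_ _ _ /forallP/(_ i)] := wmapP w.
by case: (w (bin i)) => [|[]].
Qed.
Lemma gout_gin o i : w (gout o) = gin i -> False.
Proof.
by have /and5P[_ _ _ _ /andP[/forallP/(_ o) + _]] := wmapP w => + E; rewrite E.
Qed.
Lemma ext_outP o l : w (gout o) = tout l -> l \in ext_out.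
Proof. by move=> E; rewrite inE; apply/existsP; exists o; rewrite E. Qed.

Definition in_order (l : 'I_(#|ext_in| + n2)) : 'I_n :=
  match split l with
  | inl i => get_gin (ext_inP i)
  | inr j => get_gin (tin_gin j)
  end.

Definition mid_order (l : 'I_(n1 + #|ext_out|)) : 'I_(#|ext_in| + m2) :=
  match split l with
  | inl i => match @idP (i \in ext_in) with
             | ReflectT h => lshift m2 (enum_rank_in h i)
             | ReflectF h => rshift _ (get_tout (int_inP (introN idP h)))
             end
  | inr j => rshift _ (enum_val j)
  end.

Definition out_order (o : 'I_m) : 'I_(m1 + #|ext_out|) :=
  match w (gout o) as s return w (gout o) = s -> 'I_(m1 + #|ext_out|) with
  | inl i => fun E => match gout_gin E with end
  | inr (inl j) => fun _ => lshift _ j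
  | inr (inr l) => fun E => rshift _ (enum_rank_in (ext_outP E) l)
  end erefl.

Definition end_comp (e1 e2 : int) (f : gmap (T n1) (T m1))
    (g : gmap (T n2) (T m2)) : gmap (T n) (T m) :=
  gcomp (e1 + e2) (reorder out_order)
    (gcomp e2 (gtens e1 0 f (gid : gmap (T #|ext_out|) _))
      (gcomp e2 (reorder mid_order)
        (gcomp 0 (gtens 0 e2 (gid : gmap (T #|ext_in|) _) g)
          (reorder in_order)))).

End EndComp.

Arguments end_comp {m1 n1 m2 n2 m n} w e1 e2 f g i j x : rename.

(* Families of maps from the dual of Q to end_A; conv_elt singles out the
   elements of degree e of hom_S(Q^*, end_A). *)
Definition conv (Q : properad) : Type :=
  forall d m n, gdual Q d m n -> gmap (T n) (T m).

Section Conv.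
Variable Q : properad.

Definition conv_eq (f g : conv Q) : Prop :=
  forall d m n (phi : gdual Q d m n) i j x, f d m n phi i j x = g d m n phi i j x.

Definition conv_elt (e : int) (f : conv Q) : Prop :=
  [/\ forall d m n (phi : gdual Q d m n), gmorph (d + e) (f d m n phi),
      forall d m n c (phi psi : gdual Q d m n) i j x,
        f d m n (c *: phi + psi) i j x = c *: f d m n phi i j x + f d m n psi i j x &
      forall d m n s t (phi : gdual Q d m n) i j x,
        f d m n (sact s t phi) i j x = end_act s t (f d m n phi) i j x].

Definition czero : conv Q := fun _ _ _ _ => gzero.
Definition cadd (f g : conv Q) : conv Q :=
  fun d m n phi => gadd (f d m n phi) (g d m n phi).
Definition cscale (c : k) (f : conv Q) : conv Q :=
  fun d m n phi => gscale c (f d m n phi).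

(* f * g for f of degree e1 and g of degree e2.  The sum over isomorphism
   classes of two-vertex graphs is written as a sum over all wirings: a graph
   with unlabelled vertices of arities (m1,n1), (m2,n2) and r internal edges
   comes from m1! n1! m2! n2! / r! wirings, and the identification of the
   invariants under its group S_r of automorphisms, where the dual of the
   composition maps takes its values, with the coinvariants carries 1/r!. *)
Definition star (e1 e2 : int) (f g : conv Q) : conv Q :=
  fun d m n phi i j x =>
    gsum_eval (V := T m j) (decomp phi) (fun b t h w phi1 phi2 =>
      ((((pouts b)`! * (pins b)`! * (pouts t)`! * (pins t)`!)%N%:R)^-1
         * sg (e2 * pdeg b)) *:
      end_comp w (pdeg b + e1) (pdeg t + e2)
        (f _ _ _ phi1) (g _ _ _ phi2) i j x).

Definition bracket (e1 e2 : int) (f g : conv Q) : conv Q :=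
  cadd (star e1 e2 f g) (cscale (- sg (e1 * e2)) (star e2 e1 g f)).

Definition MC (f : conv Q) : Prop :=
  conv_elt (-1) f /\ conv_eq (star (-1) (-1) f f) czero.

(* Convergence of series for the filtration of the convolution algebra induced
   by the one of A. *)
Definition series_to (s : nat -> conv Q) (f : conv Q) : Prop :=
  forall p, exists N, forall N', (N <= N')%N ->
    forall d m n (phi : gdual Q d m n) q i j (x : T n i), fil q x ->
      fil (p + q) (f d m n phi i j x - \sum_(l < N') s l d m n phi i j x).

(* The differential on the counit part: phi |-> phi(id) dA. *)
Definition counit_conv (dA : gmap (T 1%N) (T 1%N)) : conv Q :=
  fun d m n => match d, m, n return gdual Q d m n -> gmap (T n) (T m) with
  | Posz 0, 1%N, 1%N => fun phi => gscale ((phi : dual _) (pid Q)) dA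
  | _, _, _ => fun _ => gzero
  end.

Lemma sum_zero_deg p : \sum_(i < p) (0 : int) + 0 = 0 :> int.
Proof. by rewrite big1. Qed.

(* a (x) ... (x) a (x) - : A^n -> A^{p+n} for a of degree 0 *)
Definition insert (p : nat) (a : A 0) n : gmap (T n) (T (p + n)%N) :=
  the_gmap (fun f => gmorph 0 f /\
    forall i (x : T n i),
      f i (0 + i) x = tcat (tens T (sum_zero_deg p) (fun _ => a)) x).

Arguments insert p a n i j x : rename, clear implicits.

Variable u : Q 0 1%N 0%N.

Definition elt_conv (a : A 0) : conv Q :=
  fun d m n => match d, m, n return gdual Q d m n -> gmap (T n) (T m) with
  | Posz 0, 1%N, 0%N => fun phi => gscale ((phi : dual _) u) (insert 1 a 0)
  | _, _, _ => fun _ => gzero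
  end.

(* The terms of e^{ad_{-a}}(f) for f of degree -1. *)
Definition gauge_term (a : A 0) (f : conv Q) (p : nat) : conv Q :=
  cscale (p`!%:R^-1)
    (iter p (bracket 0 (-1) (cscale (-1) (elt_conv a))) f).

Fixpoint plug_units d m p n : Q d m (p + n)%N -> Q d m n :=
  match p return Q d m (p + n)%N -> Q d m n with
  | 0 => id
  | p'.+1 => fun x => plug_units (pcomp (addr0 d) (plug m (ord0 : 'I_(p' + n).+1)) x u)
  end.

Lemma plug_units_lin d m p n : linear (@plug_units d m p n).
Proof.
elim: p => [|p IH] c x y //=.
by rewrite pcomp_linl IH.
Qed.

Lemma unit_shift_subproof d m n p (phi : gdual Q d m n) :
  scalar (fun x : Q (- d) m (p + n)%N => (phi : dual _) (plug_units x)).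
Proof. by move=> c x y; rewrite plug_units_lin linearP. Qed.

(* phi^(p) *)
Definition unit_shift d m n p (phi : gdual Q d m n) : gdual Q d m (p + n)%N :=
  mkdual (unit_shift_subproof phi).

(* The terms of f <| (1 + a). *)
Definition twist_term (a : A 0) (f : conv Q) (p : nat) : conv Q :=
  fun d m n phi =>
    gscale (p`!%:R^-1)
      (gcomp 0 (f d m (p + n)%N (unit_shift p phi)) (insert p a n)).

End Conv.
End Endo.

Section Twisting.
Variables (Q : quad_data) (chi : chi_datum (sdual Q)).

Definition dualP : properad := koszul_dual Q.
Definition udualP : properad := unital_properad (orth (@qrel Q)) chi.

(* The projection  cP^¡ ->> P^¡  dual to  P^! -> u_chi P^! . *)
Lemma proj_subproof d m n (phi : gdual udualP d m n) :
  scalar (fun x : dualP (- d) m n => (phi : dual _) (canon chi x)).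
Proof. by move=> c x y; rewrite canon_lin linearP. Qed.

Definition proj d m n (phi : gdual udualP d m n) : gdual dualP d m n :=
  mkdual (proj_subproof phi).

Definition in_kernel d m n (phi : gdual udualP d m n) : Prop := proj phi = 0.

(* The augmentation ideal of P^!. *)
Inductive aug_ideal : forall d m n, dualP d m n -> Prop :=
| aug_gen d m n (e : sdual Q d m n) : aug_ideal (gen _ e : dualP d m n)
| aug_zero d m n : aug_ideal (0 : dualP d m n)
| aug_lin d m n c (x y : dualP d m n) :
    aug_ideal x -> aug_ideal y -> aug_ideal (c *: x + y)
| aug_act d m n s t (x : dualP d m n) : aug_ideal x -> aug_ideal (sact s t x)
| aug_compl (d1 d2 d : int) m1 n1 m2 n2 m n (h : d1 + d2 = d)
    (w : wiring m1 n1 m2 n2 m n) (x : dualP d1 m1 n1) (y : dualP d2 m2 n2) :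
    aug_ideal x -> aug_ideal (pcomp h w x y)
| aug_compr (d1 d2 d : int) m1 n1 m2 n2 m n (h : d1 + d2 = d)
    (w : wiring m1 n1 m2 n2 m n) (x : dualP d1 m1 n1) (y : dualP d2 m2 n2) :
    aug_ideal y -> aug_ideal (pcomp h w x y).

Variables (A : cmod) (T : tensor_powers A).

Definition differential (dA : gmap (T 1%N) (T 1%N)) : Prop :=
  gmorph (-1) dA /\ forall i j l x, dA j l (dA i j x) = 0.

(* A P_oo-gebra structure on (A, dA): abar is defined on the quotient of P^¡ by
   its coaugmentation, the latter being the annihilator of the augmentation
   ideal of P^!; the Maurer-Cartan equation involves the differential. *)
Definition Pinf_gebra (dA : gmap (T 1%N) (T 1%N)) (abar : conv T dualP) : Prop :=
  [/\ differential dA, conv_elt (-1) abar,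
      forall d m n (phi : gdual dualP d m n),
        (forall x, aug_ideal x -> (phi : dual _) x = 0) ->
        forall i j x, abar d m n phi i j x = 0 &
      MC (cadd (counit_conv dA) abar)].

Definition pull (f : conv T dualP) : conv T udualP :=
  fun d m n phi => f d m n (proj phi).

(* delta + abar pi *)
Definition extended (dA : gmap (T 1%N) (T 1%N)) (abar : conv T dualP) :
    conv T udualP := cadd (counit_conv dA) (pull abar).

Definition is_Pinf (f : conv T udualP) : Prop :=
  MC f /\ exists2 g : conv T dualP, conv_elt (-1) g & conv_eq f (pull g).

Definition vanishes_on_kernel (f : conv T udualP) : Prop :=
  forall d m n (phi : gdual udualP d m n), in_kernel phi ->
    forall i j x, f d m n phi i j x = 0.

Definition unit_of : udualP 0 1%N 0%N := unit_elt (orth (@qrel Q)) chi.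

(* beta = (1 - a) . alpha = e^{ad_{-a}}(alpha) *)
Definition is_gauge (a : A 0) (alpha beta : conv T udualP) : Prop :=
  series_to (gauge_term unit_of a alpha) beta.

(* beta = alpha <| (1 + a) *)
Definition is_twist (a : A 0) (alpha beta : conv T udualP) : Prop :=
  series_to (twist_term unit_of a alpha) beta.

End Twisting.

End Properads.

Arguments dualP {k} Q.
Arguments udualP {k Q} chi.
Arguments extended {k Q} chi {A T} dA abar.
Arguments pull {k Q} chi {A T} f.
Arguments Pinf_gebra {k Q A T} dA abar.
Arguments MC {k A T Q} f.
Arguments is_gauge {k Q chi A T} a alpha beta.
Arguments is_twist {k Q chi A T} a alpha beta.
Arguments is_Pinf {k Q chi A T} f.
Arguments vanishes_on_kernel {k Q chi A T} f.

(* Main.v *)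
(* Since a has degree 0 and no input, a * f = 0 and ad_{-a} is the operator
   D : f |-> f * a, which plugs a at one input of f.  By equivariance the
   m! (n+1)! graphs occurring in (f * a)(phi) all contribute the same term,
   namely f(phi^(1))(a, -), so the exponential series of D is the expansion of
   f <| (1 + a).  It converges because D raises the filtration by 1.

   In a two-vertex graph decorated by f and g, the element a can be plugged at an
   input of f or at an input of g: D is a derivation of *.  Hence
     D (\sum_{p+q=r} t_p * t_q) = (r+1) \sum_{p+q=r+1} t_p * t_q
   for t_p = D^p(alpha)/p!, so alpha * alpha = 0 propagates to the sum beta of
   the t_p.

   The Koszul signs in End_A are dealt with by expressing all reorderings and
   insertions of a as "placing maps", which are determined on elementary tensors
   by a partial bijection of slots and are closed under composition and tensor
   product.

   Finally beta factors through P^! as soon as it vanishes on K because every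
   functional on P^! extends along the injection P^! -> u_chi P^!. *)

Require Import Defs.
From HB Require Import structures.
From mathcomp Require Import all_boot all_order all_algebra all_fingroup.
From mathcomp Require Import boolp.
From mathcomp Require Import ring.
From mathcomp Require classical_sets.

Set Implicit Arguments.
Unset Strict Implicit.
Unset Printing Implicit Defensive.
Import GRing.Theory.
Local Open Scope ring_scope.

(* mathcomp's homonyms are loaded after Defs. *)
Local Notation pcomp := Defs.pcomp.
Local Notation canon := Defs.canon.

(** The product [star] is computed from an arbitrarily chosen decomposition of a functional, whereas
    the derivation property compares the decompositions of phi and of phi^(1). The choice is
    harmless because a finite sum of tensors of functionals is determined by the bilinear form it
    defines, and two decompositions of phi define the same form. That a can land on either vertex
    becomes a partition of the graphs by the vertex which receives the first global input; the
    number of inputs of that vertex compensates the factorial by which [star] divides. These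
    factorials, the p! of the series and the factor r+1 of the recursion are where characteristic 0
    enters. The equation for beta involves infinite sums, so it is proved modulo every step of the
    filtration: beta is a partial sum plus a remainder which raises the filtration by the length of
    that sum. Maps between tensor powers are only given by a universal property, hence their
    identities are checked on elementary tensors, where Koszul signs become counts of inversions. *)

Section LinearFunctions.
Variables (k : fieldType) (V W : lmodType k) (f : V -> W).
Hypothesis f_lin : linear f.

Lemma lin_add x y : f (x + y) = f x + f y.
Proof. by have := f_lin 1 x y; rewrite !scale1r. Qed.

Lemma lin_zero : f 0 = 0.
Proof. by apply: (addrI (f 0)); rewrite -lin_add !addr0. Qed.

Lemma lin_scale c x : f (c *: x) = c *: f x.
Proof. by have := f_lin c x 0; rewrite lin_zero !addr0. Qed.

Lemma lin_sum I (r : seq I) (P : pred I) F :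
  f (\sum_(i <- r | P i) F i) = \sum_(i <- r | P i) f (F i).
Proof. exact: (big_morph f lin_add lin_zero). Qed.

End LinearFunctions.

Section Signs.
Variable k : fieldType.

Lemma sgE (e : int) : sg k e = (-1) ^ e.
Proof.
case: e => n //; rewrite NegzE /sg abszN absz_nat.
by rewrite -exprnN -[RHS]exprVn invrN1.
Qed.

Lemma sgD (e e' : int) : sg k (e + e') = sg k e * sg k e'.
Proof. by rewrite !sgE expfzDr // oppr_eq0 oner_eq0. Qed.

Lemma sg0 : sg k 0 = 1. Proof. by []. Qed.

Lemma sg_sum I (r : seq I) (P : pred I) F :
  sg k (\sum_(i <- r | P i) F i) = \prod_(i <- r | P i) sg k (F i).
Proof. exact: (big_morph _ sgD sg0). Qed.

Lemma sg_sqr (e : int) : sg k e * sg k e = 1.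
Proof. by rewrite /sg -expr2 sqrr_sign. Qed.

End Signs.

(** * Placings and Koszul signs *)

(* A placing s of n' elements in n slots: slot i receives the element u if
   s i = Some u and is filled with a fixed element of degree 0 if s i = None. *)
Section Placings.

Definition placing n n' (s : 'I_n -> option 'I_n') : Prop :=
  exists t : 'I_n' -> 'I_n,
    (forall u, s (t u) = Some u) /\ (forall i u, s i = Some u -> t u = i).

Lemma big_placing (R : Type) (idx : R) (op : Monoid.com_law idx) n n'
    (s : 'I_n -> option 'I_n') (F : 'I_n' -> R) : placing s ->
  \big[op/idx]_i oapp F idx (s i) = \big[op/idx]_u F u.
Proof.
case=> t [st ts]; rewrite (bigID (fun i => isSome (s i))) /=.
rewrite [X in op _ X]big1 ?Monoid.mulm1; last by move=> i; case: (s i).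
rewrite (reindex_omap t s) => [|i]; last first.
  by case E: (s i) => [u|] //= _; rewrite (ts _ _ E).
by apply: eq_big => u /=; rewrite st ?eqxx.
Qed.

Lemma placing_id n : placing (@Some 'I_n).
Proof. by exists id; split=> // i u []. Qed.

Lemma placing_bij n n' (s : 'I_n -> 'I_n') : bijective s -> placing (Some \o s).
Proof. by case=> t st ts; exists t; split=> [u|i u []] /= => [|<-]; rewrite ?ts ?st. Qed.

Lemma placing_inj n n' (s : 'I_n -> 'I_n') :
  injective s -> (forall u, exists i, s i = u) -> placing (Some \o s).
Proof.
move=> s_inj s_surj; exists (fun u => projT1 (cid (s_surj u))).
by split=> [u|i u [<-]]; case: cid => j //= E; [rewrite E | exact: s_inj].
Qed.

Lemma placing_obind n n' n'' (s : 'I_n -> option 'I_n')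
    (s' : 'I_n'' -> option 'I_n) :
  placing s -> placing s' -> placing (obind s \o s').
Proof.
move=> [t [st ts]] [t' [st' ts']]; exists (t' \o t); split=> [u|i u] /=.
  by rewrite st' /= st.
by case E: (s' i) => [v|] //= /ts ->; exact: ts'.
Qed.

Definition osum a a' b b' (s : 'I_a -> option 'I_a') (r : 'I_b -> option 'I_b')
    (i : 'I_(a + b)) : option 'I_(a' + b') :=
  match split i with
  | inl i => omap (lshift b') (s i)
  | inr i => omap (@rshift a' b') (r i)
  end.

Lemma split_lshift a b (i : 'I_a) : split (lshift b i) = inl i.
Proof. exact: (unsplitK (inl i)). Qed.
Lemma split_rshift a b (i : 'I_b) : split (rshift a i) = inr i.
Proof. exact: (unsplitK (inr i)). Qed.

Lemma osum_lshift a a' b b' (s : 'I_a -> option 'I_a')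
    (r : 'I_b -> option 'I_b') i :
  osum s r (lshift b i) = omap (lshift b') (s i).
Proof. by rewrite /osum split_lshift. Qed.
Lemma osum_rshift a a' b b' (s : 'I_a -> option 'I_a')
    (r : 'I_b -> option 'I_b') i :
  osum s r (rshift a i) = omap (@rshift a' b') (r i).
Proof. by rewrite /osum split_rshift. Qed.

Lemma split_ind a b (P : 'I_(a + b) -> Prop) :
  (forall i, P (lshift b i)) -> (forall i, P (rshift a i)) -> forall i, P i.
Proof. by move=> Pl Pr i; case: (split_ordP i) => j ->. Qed.

Lemma placing_osum a a' b b' (s : 'I_a -> option 'I_a')
    (r : 'I_b -> option 'I_b') :
  placing s -> placing r -> placing (osum s r).
Proof.
move=> [t [st ts]] [q [rq qr]].
exists (fun u => match split u with
                 | inl u => lshift b (t u) | inr u => rshift a (q u) end).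
split; first apply: split_ind => u; rewrite ?split_lshift ?split_rshift.
- by rewrite osum_lshift st.
- by rewrite osum_rshift rq.
apply: split_ind => i u; rewrite ?osum_lshift ?osum_rshift.
  by case E: (s i) => [v|] //= [<-]; rewrite split_lshift (ts _ _ E).
by case E: (r i) => [v|] //= [<-]; rewrite split_rshift (qr _ _ E).
Qed.

End Placings.

Section KoszulSigns.
Variable k : fieldType.

Definition kfac n (dl : 'I_n -> int) (o o' : option 'I_n) : k :=
  if o is Some u then
    if o' is Some v then if (v < u)%N then sg k (dl u * dl v) else 1 else 1
  else 1.

Definition ksign n n' (s : 'I_n -> option 'I_n') (dl : 'I_n' -> int) : k :=
  \prod_(i : 'I_n) \prod_(j : 'I_n | (i < j)%N) kfac dl (s i) (s j).

Lemma koszul_signE n n' (s : 'I_n -> 'I_n') dl :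
  koszul_sign k s dl = ksign (Some \o s) dl.
Proof.
rewrite /koszul_sign sg_sum; apply: eq_bigr => i _; rewrite sg_sum.
by rewrite big_mkcondr; apply: eq_bigr => j _ /=; case: ifP.
Qed.

(* The sign of an injective rearrangement is a product over unordered pairs,
   which may be oriented by any injective numbering q. *)
Lemma prod_pairs n (q : 'I_n -> nat) (h : 'I_n -> 'I_n -> k) :
  injective q -> (forall i j, i != j -> h i j = h j i) ->
  \prod_(i : 'I_n) \prod_(j : 'I_n | (i < j)%N) h i j =
  \prod_(i : 'I_n) \prod_(j | (q i < q j)%N) h i j.
Proof.
move=> q_inj hC.
have split_q (P : 'I_n -> 'I_n -> bool) :
    \prod_(i : 'I_n) \prod_(j | P i j) h i j =
    (\prod_(i : 'I_n) \prod_(j | P i j && (i < j)%N) h i j) *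
    (\prod_(i : 'I_n) \prod_(j | P i j && ~~ (i < j)%N) h i j).
  by rewrite -big_split; apply: eq_bigr => i _; rewrite (bigID (fun j : 'I_n => (i < j)%N)).
rewrite [RHS]split_q.
have -> : \prod_(i : 'I_n) \prod_(j : 'I_n | (i < j)%N) h i j =
    (\prod_(i : 'I_n) \prod_(j | (q i < q j)%N && (i < j)%N) h i j) *
    (\prod_(i : 'I_n) \prod_(j | ~~ (q i < q j)%N && (i < j)%N) h i j).
  rewrite -big_split; apply: eq_bigr => i _ /=.
  rewrite (bigID (fun j => (q i < q j)%N)) /=.
  by congr (_ * _); apply: eq_bigl => j; rewrite andbC.
(* What remains are the pairs oriented differently by the two orders; exchanging i and j turns one
   product into the other. *)
congr (_ * _).
under eq_bigr => i _ do rewrite big_mkcond.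
rewrite exchange_big; apply: eq_bigr => i _; rewrite [RHS]big_mkcond.
apply: eq_bigr => j _ /=; rewrite -!leqNgt.
have [->|ij] := eqVneq i j; first by rewrite !ltnn andbF.
have qij : q i != q j by apply: contra ij => /eqP/q_inj->.
rewrite [(q i < q j)%N]ltn_neqAle qij /= [(j <= i)%N]leq_eqVlt [val j == _]eq_sym.
by rewrite (negPf (ij : i != j :> nat)) /= (hC _ _ ij).
Qed.

(** Cocycle identity: a pair is inverted by the composite exactly when one, but not both, of the two
    placings inverts it, and a sign squares to 1. Slots left empty by [s] carry degree 0, so
    inversions involving them do not count. *)
Lemma ksign_obind n n' n'' (s : 'I_n -> option 'I_n')
    (s' : 'I_n'' -> option 'I_n) (dl : 'I_n' -> int) :
  placing s -> placing s' ->
  ksign s' (fun i => oapp dl 0 (s i)) * ksign s dl = ksign (obind s \o s') dl.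
Proof.
move=> [t [st ts]] ps'; have [t' [st' ts']] := ps'.
(* [h] is the contribution of an unordered pair to [ksign s]. Being symmetric, it may be oriented by
   the order of the slots in which [s'] puts i and j, so that all three signs become products over
   the same pairs. *)
pose h i j := if s i is Some u then if s j is Some v then
  if (i < j)%N (+) (u < v)%N then sg k (dl u * dl v) else 1 else 1 else 1 : k.
have s_inj i j u : s i = Some u -> s j = Some u -> i = j.
  by move=> /ts <- /ts <-.
have hC i j : i != j -> h i j = h j i.
  rewrite /h => ij; case Ei: (s i) => [u|]; case Ej: (s j) => [v|] //.
  have uv : u != v by apply: contra ij => /eqP uv; rewrite uv in Ei; apply/eqP/(s_inj _ _ _ Ei).
  move: ij uv; rewrite -!(inj_eq val_inj) /= (mulrC (dl u)).
  by case: (ltngtP i j) => // _ _; case: (ltngtP u v).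
have t'_inj : injective (fun i => val (t' i)).
  by move=> i j /val_inj E; have := st' i; rewrite E st' => -[].
have -> : ksign s dl = \prod_(i : 'I_n) \prod_(j | (val (t' i) < val (t' j))%N) h i j.
  rewrite -(prod_pairs t'_inj hC); apply: eq_bigr => i _; apply: eq_bigr => j ij.
  rewrite /kfac /h ij; case Ei: (s i) => [u|]; case Ej: (s j) => [v|] //.
  rewrite addTb; case: (ltngtP u v) => // /ord_inj E; rewrite E in Ei.
  by rewrite (s_inj _ _ _ Ei Ej) ltnn in ij.
have -> : \prod_(i : 'I_n) \prod_(j | (val (t' i) < val (t' j))%N) h i j =
    \prod_(a : 'I_n'') \prod_(b : 'I_n'' | (a < b)%N)
       oapp (fun i => oapp (h i) 1 (s' b)) 1 (s' a).
  rewrite -(big_placing _ _ ps'); apply: eq_bigr => a _.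
  case Ea: (s' a) => [i|] /=; last by rewrite big1.
  rewrite [LHS]big_mkcond -(big_placing _ _ ps') [RHS]big_mkcond.
  apply: eq_bigr => b _; case Eb: (s' b) => [j|] /=; last by case: ifP.
  by rewrite (ts' _ _ Ea) (ts' _ _ Eb).
rewrite -big_split; apply: eq_bigr => a _; rewrite -big_split; apply: eq_bigr => b ab.
rewrite /kfac /= /h; case Ea: (s' a) => [i|] /=; last by rewrite mulr1.
case Eb: (s' b) => [j|] /=; last by case: (s i); rewrite mulr1.
have ij : i != j.
  by apply: contraTneq ab => ij; rewrite -(ts' _ _ Ea) -(ts' _ _ Eb) ij ltnn.
case Ei: (s i) => [u|] /=; last first.
  by rewrite mul0r sg0 if_same mulr1.
case Ej: (s j) => [v|] /=; last by rewrite mulr0 sg0 if_same mulr1.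
have uv : u != v by apply: contra ij => /eqP uv; rewrite uv in Ei; apply/eqP/(s_inj _ _ _ Ei).
move: ij uv ab; rewrite -!(inj_eq val_inj) /=.
case: (ltngtP i j) => // _ _; case: (ltngtP u v) => //= _ _ _.
all: by rewrite ?sg_sqr ?mulr1 ?mul1r.
Qed.

(** Blocks stay in order, so no pair with one slot in each block is inverted. *)
Lemma ksign_osum a a' b b' (s : 'I_a -> option 'I_a')
    (r : 'I_b -> option 'I_b') dl :
  ksign (osum s r) dl =
  ksign s (dl \o lshift b') * ksign r (dl \o @rshift a' b').
Proof.
rewrite /ksign big_split_ord /=; congr (_ * _).
  apply: eq_bigr => i _; rewrite big_mkcond big_split_ord /=.
  rewrite [X in _ * X]big1 ?mulr1 => [|j _].
    rewrite -big_mkcond; apply: eq_bigr => j _.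
    by rewrite !osum_lshift /kfac; case: (s i) => // u; case: (s j).
  case: ifP => // _; rewrite osum_lshift osum_rshift /kfac.
  case: (s i) => //= u; case: (r j) => //= v.
  by rewrite ltnNge (leq_trans (ltnW (ltn_ord u))) // leq_addr.
apply: eq_bigr => i _; rewrite big_mkcond big_split_ord /=.
rewrite big1 ?mul1r => [|j _]; last first.
  by rewrite ltnNge (leq_trans (ltnW (ltn_ord j))) // leq_addr.
rewrite [RHS]big_mkcond; apply: eq_bigr => j _.
rewrite ltn_add2l !osum_rshift /kfac.
by case: ifP => // _; case: (r i) => // u; case: (r j) => //= v; rewrite ltn_add2l.
Qed.

Lemma ksign_mono n n' (s : 'I_n -> option 'I_n') dl :
  (forall (i j : 'I_n) (u v : 'I_n'), (i < j)%N -> s i = Some u -> s j = Some v -> (u <= v)%N) ->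
  ksign s dl = 1.
Proof.
move=> s_mono; rewrite /ksign big1 // => i _; rewrite big1 // => j ij.
rewrite /kfac; case Ei: (s i) => [u|] //; case Ej: (s j) => [v|] //.
by rewrite ltnNge (s_mono _ _ _ _ ij Ei Ej).
Qed.

End KoszulSigns.

(** * Graded maps and filtrations *)

Arguments gid {k B} i j x : rename.
Arguments gzero {k B C} i j x : rename.

Section GradedMaps.
Variable k : fieldType.
Implicit Types B C D : cmod k.

Lemma gmap_ext B C (f g : gmap B C) : (forall i j x, f i j x = g i j x) -> f = g.
Proof.
move=> H; apply: functional_extensionality_dep => i.
by apply: functional_extensionality_dep => j; apply/funext => x.
Qed.

Lemma gid_diag B i (x : B i) : gid i i x = x.
Proof. by rewrite /gid; case: eqP => // E; rewrite eq_axiomK. Qed.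

Lemma gid_off B i j (x : B i) : i <> j -> gid i j x = 0.
Proof. by rewrite /gid; case: eqP. Qed.

Lemma gmorph_lin B C e (f : gmap B C) (mf : gmorph e f) i j : linear (f i j).
Proof. by case: mf. Qed.
Arguments gmorph_lin {B C e f} mf i j.

Lemma gmorph_off B C e (f : gmap B C) (mf : gmorph e f) i j x : j <> i + e -> f i j x = 0.
Proof. by case: mf => _ + _; apply. Qed.

Lemma gmorph_fil B C e (f : gmap B C) (mf : gmorph e f) p i j x : fil p x -> fil p (f i j x).
Proof. by case: mf => _ _; apply. Qed.

Lemma gmorph_gid B : gmorph 0 (@gid k B).
Proof.
split=> [i j c x y|i j x ji|p i j x px].
- have [<-|ij] := eqVneq i j; first by rewrite !gid_diag.
  by rewrite !gid_off ?scaler0 ?addr0 //; exact/eqP.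
- by apply: gid_off => ij; apply: ji; rewrite ij addr0.
- have [<-|ij] := eqVneq i j; first by rewrite gid_diag.
  by rewrite gid_off; [exact: fil_zero | exact/eqP].
Qed.

Lemma fil_scale B p d c (x : B d) : fil p x -> fil p (c *: x).
Proof. by move=> px; rewrite -[_ *: _]addr0; apply: fil_lin => //; exact: fil_zero. Qed.
Lemma fil_add B p d (x y : B d) : fil p x -> fil p y -> fil p (x + y).
Proof. by move=> px py; rewrite -[x]scale1r; exact: fil_lin. Qed.
Lemma fil_sum B p d I (r : seq I) (P : pred I) (F : I -> B d) :
  (forall i, P i -> fil p (F i)) -> fil p (\sum_(i <- r | P i) F i).
Proof.
by move=> H; elim/big_rec: _ => [|i x /H Pi px]; [exact: fil_zero | exact: fil_add].
Qed.
Lemma fil_le B p q d (x : B d) : (p <= q)%N -> fil q x -> fil p x.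
Proof. by move=> /subnK <-; elim: (q - p)%N => //= n IH /fil_desc. Qed.

Lemma gmorph_gcomp B C D e e' (f : gmap C D) (g : gmap B C) :
  gmorph e f -> gmorph e' g -> gmorph (e' + e) (gcomp e' f g).
Proof.
move=> mf mg; split=> [i j c x y|i j x ji|p i j x px]; rewrite /gcomp.
- by rewrite (gmorph_lin mg) (gmorph_lin mf).
- by apply: (gmorph_off mf); rewrite -addrA.
- by apply: (gmorph_fil mf); exact: (gmorph_fil mg).
Qed.

Lemma gmorph_gzero B C e : gmorph e (@gzero k B C).
Proof.
split=> [i j c x y|i j x ji|p i j x px] //; rewrite /gzero ?scaler0 ?addr0 //.
exact: fil_zero.
Qed.

Lemma gmorph_comb B C e c (f g : gmap B C) :
  gmorph e f -> gmorph e g -> gmorph e (gadd (gscale c f) g).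
Proof.
move=> mf mg; split=> [i j c' x y|i j x ji|p i j x px]; rewrite /gadd /gscale.
- rewrite (gmorph_lin mg) (gmorph_lin mf) !scalerDr !scalerA mulrC.
  by rewrite addrACA.
- by rewrite (gmorph_off mf _ ji) (gmorph_off mg _ ji) scaler0 addr0.
- by apply: fil_lin; [exact: (gmorph_fil mf) | exact: (gmorph_fil mg)].
Qed.

Lemma gmorph_gscale B C e c (f : gmap B C) : gmorph e f -> gmorph e (gscale c f).
Proof.
move=> mf; have := gmorph_comb c mf (gmorph_gzero B C e).
by congr (gmorph e _); apply: gmap_ext => i j x; rewrite /gadd /gzero addr0.
Qed.

Lemma gcompA B C D D' e e1 e2 (f : gmap D D') (g : gmap C D) (h : gmap B C) :
  e = e1 + e2 -> gcomp e f (gcomp e1 g h) = gcomp e1 (gcomp e2 f g) h.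
Proof.
by move=> ->; apply: gmap_ext => i j x; rewrite /gcomp addrA.
Qed.

Lemma gcompA0 B C D D' e (f : gmap D D') (g : gmap C D) (h : gmap B C) :
  gcomp 0 (gcomp e f g) h = gcomp e f (gcomp 0 g h).
Proof. by rewrite (@gcompA _ _ _ _ e 0 e) ?add0r. Qed.

Lemma gcomp0A B C D D' e (f : gmap D D') (g : gmap C D) (h : gmap B C) :
  gcomp e (gcomp 0 f g) h = gcomp e f (gcomp e g h).
Proof. by rewrite (@gcompA _ _ _ _ e e 0) ?addr0. Qed.

Lemma gcompAD B C D D' e e' (f : gmap D D') (g : gmap C D) (h : gmap B C) :
  gcomp e' (gcomp e f g) h = gcomp (e + e') f (gcomp e' g h).
Proof. by rewrite (@gcompA _ _ _ _ (e + e') e' e) // addrC. Qed.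

Lemma gcomp_idl B C e (f : gmap B C) : gmorph e f -> gcomp e gid f = f.
Proof.
move=> mf; apply: gmap_ext => i j x; rewrite /gcomp.
have [->|/eqP ji] := eqVneq j (i + e); first by rewrite gid_diag.
by rewrite (gmorph_off mf _ ji) gid_off // => /esym.
Qed.

Lemma gcomp_idr B C (f : gmap B C) : gcomp 0 f gid = f.
Proof. by apply: gmap_ext => i j x; rewrite /gcomp addr0 gid_diag. Qed.

Lemma the_gmapP B C (P : gmap B C -> Prop) : (exists f, P f) -> P (the_gmap P).
Proof. by move=> H; rewrite /the_gmap; case: pselect => // e; case: cid. Qed.

Lemma the_gmap_eq B C (P : gmap B C -> Prop) f :
  P f -> (forall g, P g -> g = f) -> the_gmap P = f.
Proof. by move=> Pf; apply; apply: the_gmapP; exists f. Qed.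

Definition fshift B C p (f : gmap B C) : Prop :=
  forall q i j x, fil q x -> fil (p + q) (f i j x).

Lemma fshift_gmorph B C e (f : gmap B C) : gmorph e f -> fshift 0 f.
Proof. by case=> _ _ H q i j x; exact: H. Qed.

Lemma fshift_gcomp B C D e p q (f : gmap C D) (g : gmap B C) :
  fshift p f -> fshift q g -> fshift (p + q) (gcomp e f g).
Proof. by move=> Hf Hg r i j x rx; rewrite -addnA; apply/Hf/Hg. Qed.

End GradedMaps.
Arguments gmorph_lin {k B C e f} mf i j.

(* F_p B as a complete graded module.  The universal property of the tensor
   powers, applied with this target, shows that a morphism raises the filtration
   by p as soon as it does so on elementary tensors (tn_shift). *)
Section FilteredPart.
Variables (k : fieldType) (B : cmod k) (p : nat).

Definition fpred d : pred (B d) := fun x => `[< fil p x >].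

Lemma fpred_submod d : submod_closed (@fpred d).
Proof.
split=> [|c x y /asboolP px /asboolP py]; apply/asboolP; first exact: fil_zero.
exact: fil_lin.
Qed.

HB.instance Definition _ d := GRing.isSubmodClosed.Build k (B d) (@fpred d)
  (fpred_submod d).

Record fpart (d : int) := FPart { fval : B d; fvalP : fval \in @fpred d }.

HB.instance Definition _ d := [isSub for @fval d].
HB.instance Definition _ d := [Choice of fpart d by <:].
HB.instance Definition _ d := [SubChoice_isSubLmodule of fpart d by <:].

Lemma fvalF d (x : fpart d) : fil p (fval x).
Proof. exact/asboolP/fvalP. Qed.

Lemma fval_lin d : linear (@fval d).
Proof. by move=> c x y; exact: (linearP (val : fpart d -> B d)). Qed.

Lemma fvalB d (x y : fpart d) : fval (x - y) = fval x - fval y.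
Proof. exact: (raddfB (val : fpart d -> B d)). Qed.

Definition mkfpart d (x : B d) (px : fil p x) : fpart d :=
  @FPart d x (introT (asboolP _) px).

Lemma fpart_complete d (s : nat -> fpart d) :
  (forall q, fil (p + q) (fval (s q.+1 - s q))) ->
  exists l : fpart d, forall q, fil (p + q) (fval (l - s q)).
Proof.
(* The shift by p converts the filtration of F_p B into that of B. Truncated subtraction makes [s']
   constant up to q = p; beyond, its q-th increment lies in F_q. *)
move=> Hs; pose s' q := fval (s (q - p)%N).
have [q|l Hl] := @fil_complete k B d s'.
  rewrite /s'; case: (leqP p q) => pq.
    by have := Hs (q - p)%N; rewrite subSn // fvalB subnKC.
  by rewrite (eqP pq) (eqP (ltnW pq)) subrr; exact: fil_zero.
have pl : fil p l.
  rewrite -[l](subrK (s' p)); apply: fil_add; first exact: Hl.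
  exact: fvalF.
exists (mkfpart pl) => q.
by have := Hl (p + q)%N; rewrite /s' addKn fvalB.
Qed.

Definition fpart_cmod : cmod k.
Proof.
refine (@CMod k (fun d => fpart d) (fun q d x => fil (p + q) (fval x)) _ _ _ _ _ _).
- by move=> q d; exact: fil_zero.
- by move=> q d c x y; exact: fil_lin.
- by move=> d x; rewrite addn0; exact: fvalF.
- by move=> q d x; rewrite addnS; exact: fil_desc.
- move=> d x Hx; apply/val_inj/fil_sep => q.
  by apply: fil_le (Hx q); exact: leq_addl.
- exact: fpart_complete.
Defined.

End FilteredPart.

(** * Elementary tensors *)

Section Tensors.
Variables (k : fieldType) (A : cmod k) (T : tensor_powers A).

Definition hel : Type := {d : int & A d}.

Definition deg n (X : 'I_n -> hel) : int := \sum_i tag (X i).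

(* x_1 (x) ... (x) x_n, with the junk value 0 when d is not its degree *)
Definition tn n (X : 'I_n -> hel) (d : int) : T n d :=
  if @eqP _ (\sum_i tag (X i) + 0) d is ReflectT h
  then tens T h (fun i => tagged (X i)) else 0.

Lemma tens_tn n (dl : 'I_n -> int) d (h : \sum_i dl i + 0 = d) x :
  tens T h x = tn (fun i => Tagged (fun d => A d) (x i)) d.
Proof. by rewrite /tn; case: eqP => // h'; congr (tens T _ _); exact: eq_irrelevance. Qed.

Lemma tn_tens n (X : 'I_n -> hel) d (h : \sum_i tag (X i) + 0 = d) :
  tn X d = tens T h (fun i => tagged (X i)).
Proof. by rewrite /tn; case: eqP => // h'; congr (tens T _ _); exact: eq_irrelevance. Qed.

Lemma tn_off n (X : 'I_n -> hel) d : d <> deg X -> tn X d = 0.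
Proof. by rewrite /tn; case: eqP => // h []; rewrite -h addr0. Qed.

Lemma helE (X : hel) d : tag X = d -> exists x : A d, X = Tagged (fun d => A d) x.
Proof. by case: X => d' x /= <-; exists x. Qed.

Lemma hel_fun n (X : 'I_n -> hel) (dl : 'I_n -> int) :
  (forall i, tag (X i) = dl i) ->
  exists x : forall i, A (dl i), X = fun i => Tagged (fun d => A d) (x i).
Proof.
move=> H; exists (fun i => projT1 (cid (helE (H i)))).
by apply/funext => i; case: cid.
Qed.

(** Multilinearity in slot i, as a relation between three families: their degrees agree only
    propositionally, so that no sum of families can be formed. *)
Definition lin_at n (X Y Z : 'I_n -> hel) (c : k) (i : 'I_n) : Prop :=
  (exists d (x y : A d), [/\ X i = Tagged (fun d => A d) x,
     Y i = Tagged (fun d => A d) y & Z i = Tagged (fun d => A d) (c *: x + y)]) /\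
  forall j, j != i -> X j = Z j /\ Y j = Z j.

Lemma lin_at_tag n (X Y Z : 'I_n -> hel) c i : lin_at X Y Z c i ->
  forall j, tag (X j) = tag (Z j) /\ tag (Y j) = tag (Z j).
Proof.
case=> -[d [x [y [Ex Ey Ez]]]] H j.
have [->|/H[-> ->]//] := eqVneq j i; by rewrite Ex Ey Ez.
Qed.

Lemma Tagged_inj d (x y : A d) :
  Tagged (fun d => A d) x = Tagged (fun d => A d) y -> x = y.
Proof. by move=> E; have := projT2_eq E; rewrite /= eq_axiomK. Qed.

Lemma lin_at_deg n (X Y Z : 'I_n -> hel) c i : lin_at X Y Z c i ->
  deg X = deg Z /\ deg Y = deg Z.
Proof.
move=> /lin_at_tag H.
by split; apply: eq_bigr => j _; have [] := H j.
Qed.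

Lemma lin_atP n (X Y Z : 'I_n -> hel) c i : lin_at X Y Z c i ->
  exists (dl : 'I_n -> int) (x y z : forall i, A (dl i)),
  [/\ X = fun i => Tagged (fun d => A d) (x i),
     Y = fun i => Tagged (fun d => A d) (y i),
     Z = fun i => Tagged (fun d => A d) (z i), z i = c *: x i + y i &
     forall j, j != i -> x j = z j /\ y j = z j].
Proof.
move=> H; have Ht := lin_at_tag H.
have [x Ex] := @hel_fun _ X (fun i => tag (Z i)) (fun j => (Ht j).1).
have [y Ey] := @hel_fun _ Y (fun i => tag (Z i)) (fun j => (Ht j).2).
have [z Ez] := @hel_fun _ Z (fun i => tag (Z i)) (fun=> erefl).
exists (fun i => tag (Z i)), x, y, z; split=> //; last first.
  move=> j /H.2; rewrite Ex Ey {2 4}Ez => -[E1 E2].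
  by split; apply: Tagged_inj.
case: H => -[d [x' [y' [Ex' Ey' Ez']]]] _.
move: (x i) (y i) (z i) (congr1 (@^~ i) Ex) (congr1 (@^~ i) Ey) (congr1 (@^~ i) Ez).
rewrite Ex' Ey' Ez' /= => a b c' Ea Eb Ec.
by rewrite -(Tagged_inj Ea) -(Tagged_inj Eb) -(Tagged_inj Ec).
Qed.

Lemma tn_lin n (X Y Z : 'I_n -> hel) c i d : lin_at X Y Z c i ->
  tn Z d = c *: tn X d + tn Y d.
Proof.
move=> H; have [<-|/eqP dZ] := eqVneq (deg Z) d; last first.
  have [EX EY] := lin_at_deg H.
  by rewrite !tn_off ?EX ?EY ?scaler0 ?addr0 // => /esym.
have [dl [x [y [z [EX EY EZ E1 E2]]]]] := lin_atP H.
have h : \sum_i dl i + 0 = deg Z by rewrite addr0 EZ.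
move: (deg Z) h => d' h; rewrite EZ EX EY -!(tens_tn h).
by have [+ _] := tens_multilin T n => /(_ dl _ h i c x y z E1 E2).
Qed.

Lemma tn_fil n (X : 'I_n -> hel) (p : 'I_n -> nat) d :
  (forall i, fil (p i) (tagged (X i))) -> fil (\sum_i p i)%N (tn X d).
Proof.
move=> H; rewrite /tn; case: eqP => [h|_]; last exact: fil_zero.
by have [_ +] := tens_multilin T n; apply.
Qed.

Lemma tn_univ n (B : cmod k) e (F : ('I_n -> hel) -> forall d, B d) :
  (forall X Y Z c i d, lin_at X Y Z c i -> F Z d = c *: F X d + F Y d) ->
  (forall X p d, (forall i, fil (p i) (tagged (X i))) ->
     fil (\sum_i p i)%N (F X d)) ->
  exists2 g : gmap (T n) B, gmorph e g &
    forall X, g (deg X) (deg X + e) (tn X (deg X)) = F X (deg X + e).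
Proof.
move=> Flin Ffil.
pose f (dl : 'I_n -> int) d (h : \sum_i dl i + e = d) (x : forall i, A (dl i)) :=
  F (fun i => Tagged (fun d => A d) (x i)) d.
have mf : multilin f.
  split=> [dl d h i c x y z E1 E2|dl d h p x Hx]; last exact: Ffil.
  apply: (Flin _ _ _ _ i); split; first by exists (dl i), (x i), (y i); rewrite E1.
  by move=> j /E2[-> ->].
have [g mg Hg] := tens_univ T mf; exists g => // X.
by rewrite (tn_tens (addr0 (deg X))) (Hg _ _ _ _ erefl) /f;
   suff -> : (fun i => Tagged (fun d => A d) (tagged (X i))) = X by []; apply/funext => i; case: (X i).
Qed.

Lemma tn_uniq n (B : cmod k) e (g g' : gmap (T n) B) :
  gmorph e g -> gmorph e g' ->
  (forall X, g (deg X) (deg X + e) (tn X (deg X)) =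
             g' (deg X) (deg X + e) (tn X (deg X))) -> g = g'.
Proof.
move=> mg mg' H; apply: gmap_ext; apply: (tens_uniq mg mg') => dl d d' h x.
have [->|/eqP dd] := eqVneq d' (d + e); last first.
  by rewrite (gmorph_off mg _ dd) (gmorph_off mg' _ dd).
have Ed : deg (fun i => Tagged (fun d => A d) (x i)) = d by rewrite -h addr0.
by rewrite tens_tn -Ed.
Qed.

Lemma tn_shift n (B : cmod k) e p (g : gmap (T n) B) : gmorph e g ->
  (forall X q, (forall i, fil (q i) (tagged (X i))) ->
     fil (p + \sum_i q i) (g (deg X) (deg X + e) (tn X (deg X)))) ->
  fshift p g.
Proof.
move=> mg Hg.
have gp X d : fil p (g (deg X) d (tn X (deg X))).
  have [->|/eqP dd] := eqVneq d (deg X + e); last first.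
    by rewrite (gmorph_off mg _ dd); exact: fil_zero.
  have := Hg X (fun=> 0%N); rewrite big1 // addn0; apply=> i; exact: fil_all.
(* The universal property lifts [g] to a filtered map into F_p B. By uniqueness the lift composed
   with the inclusion is [g], and filtration q of F_p B is filtration p + q of B. *)
have [g' mg' Hg'] : exists2 g' : gmap (T n) (fpart_cmod B p), gmorph e g' &
    forall X, g' (deg X) (deg X + e) (tn X (deg X)) = mkfpart (gp X (deg X + e)).
  apply: (@tn_univ n (fpart_cmod B p) e (fun X d => mkfpart (gp X d))).
    move=> X Y Z c i d H; apply: val_inj.
    rewrite [RHS](fval_lin c) /=; have [-> ->] := lin_at_deg H.
    by rewrite (tn_lin _ H) (gmorph_lin mg).
  move=> X q d Hq /=.
  have [->|/eqP dd] := eqVneq d (deg X + e); first exact: Hg.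
  by rewrite (gmorph_off mg _ dd); exact: fil_zero.
have -> : g = fun i j x => fval (g' i j x).
  apply: (tn_uniq mg) => [|X]; last by rewrite Hg'.
  split=> [i j c x y|i j x ji|q i j x qx].
  - by rewrite (gmorph_lin mg') fval_lin.
  - by rewrite (gmorph_off mg').
  - by apply: fil_le (leq_addl p q) _; have := @gmorph_fil _ _ _ _ _ mg' q i j x qx.
by move=> q i j x qx; have := @gmorph_fil _ _ _ _ _ mg' q i j x qx.
Qed.

Definition hcat a b (X : 'I_a -> hel) (Y : 'I_b -> hel) (l : 'I_(a + b)) : hel :=
  match split l with inl i => X i | inr j => Y j end.

Lemma hcat_lshift a b (X : 'I_a -> hel) (Y : 'I_b -> hel) i :
  hcat X Y (lshift b i) = X i.
Proof. by rewrite /hcat split_lshift. Qed.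
Lemma hcat_rshift a b (X : 'I_a -> hel) (Y : 'I_b -> hel) i :
  hcat X Y (rshift a i) = Y i.
Proof. by rewrite /hcat split_rshift. Qed.

Lemma hcat_fun a b (X : 'I_a -> hel) (Y : 'I_b -> hel) Z :
  (forall i, Z (lshift b i) = X i) -> (forall i, Z (rshift a i) = Y i) ->
  Z = hcat X Y.
Proof.
by move=> H1 H2; apply/funext; apply: split_ind => i; rewrite ?hcat_lshift ?hcat_rshift.
Qed.

Lemma deg_hcat a b (X : 'I_a -> hel) (Y : 'I_b -> hel) :
  deg (hcat X Y) = deg X + deg Y.
Proof.
rewrite /deg big_split_ord /=; congr (_ + _); apply: eq_bigr => i _.
  by rewrite hcat_lshift.
by rewrite hcat_rshift.
Qed.

Lemma tcat_tn a b (X : 'I_a -> hel) (Y : 'I_b -> hel) :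
  tcat (tn X (deg X)) (tn Y (deg Y)) = tn (hcat X Y) (deg X + deg Y).
Proof.
rewrite (tn_tens (addr0 (deg X))) (tn_tens (addr0 (deg Y))).
have h : \sum_l cat_deg (fun i => tag (X i)) (fun i => tag (Y i)) l + 0 = deg X + deg Y.
  rewrite -deg_hcat addr0; apply: eq_bigr => l _.
  by rewrite /cat_deg /hcat; case: split.
rewrite (@tcat_tens _ _ T _ _ _ _ _ _ _ _ h) tens_tn.
move: (deg X + deg Y) h => d h; suff -> : (fun i => Tagged (fun d => A d)
  (cat_elt (V := fun d => A d) (fun i => tagged (X i)) (fun i => tagged (Y i)) i)) =
  hcat X Y by [].
apply/funext => l; rewrite /cat_elt /cat_deg /hcat; case: split => i /=.
  by case: (X i).
by case: (Y i).
Qed.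

Lemma tcat_tn_deg a b (X : 'I_a -> hel) (Y : 'I_b -> hel) i j :
  i = deg X -> j = deg Y -> tcat (tn X i) (tn Y j) = tn (hcat X Y) (i + j).
Proof. by move=> -> ->; exact: tcat_tn. Qed.

Lemma tcat_lin_l a b i j c (x x' : T a i) (y : T b j) :
  tcat (c *: x + x') y = c *: tcat x y + tcat x' y.
Proof. exact: tcat_linl. Qed.
Lemma tcat_lin_r a b i j c (x : T a i) (y y' : T b j) :
  tcat x (c *: y + y') = c *: tcat x y + tcat x y'.
Proof. exact: tcat_linr. Qed.

Lemma tcat_scale a b i j c c' (x : T a i) (y : T b j) :
  tcat (c *: x) (c' *: y) = (c * c') *: tcat x y.
Proof.
rewrite (lin_scale (f := fun x => tcat x _)) => [|? ? ?]; last exact: tcat_lin_l.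
by rewrite (lin_scale (f := fun y => tcat _ y)) ?scalerA // => ? ? ?; exact: tcat_lin_r.
Qed.

Lemma tn_hcat_split a b (X : 'I_(a + b) -> hel) :
  X = hcat (X \o lshift b) (X \o @rshift a b).
Proof. exact: hcat_fun. Qed.

(** Every elementary tensor of length a + b is a concatenation of two elementary tensors. *)
Lemma tcat_uniq a b (B : cmod k) e (g g' : gmap (T (a + b)%N) B) :
  gmorph e g -> gmorph e g' ->
  (forall (X : 'I_a -> hel) (Y : 'I_b -> hel),
    g (deg X + deg Y) (deg X + deg Y + e) (tcat (tn X (deg X)) (tn Y (deg Y))) =
    g' (deg X + deg Y) (deg X + deg Y + e) (tcat (tn X (deg X)) (tn Y (deg Y)))) ->
  g = g'.
Proof.
move=> mg mg' H; apply: (tn_uniq mg mg') => X.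
rewrite (tn_hcat_split X); move: (_ \o lshift b) (_ \o @rshift a b) => X1 X2.
by rewrite deg_hcat -tcat_tn.
Qed.

End Tensors.

(** * Placing maps and tensor products of maps *)

Arguments reorder {k A T a b} s i j x : rename.
Arguments gtens {k A T} e1 e2 {a a' b b'} f g i j x : rename.
Arguments insert {k A T} p a {n} i j x : rename.
Arguments end_comp {k A T m1 n1 m2 n2 m n} w e1 e2 f g i j x : rename.
Arguments gcomp {k B C D} e f g i j x : rename.
Arguments tn {k A T n} X d.
Arguments end_act {k A T m n} s t f i j x : rename.

Section Place.
Variables (k : fieldType) (A : cmod k) (T : tensor_powers A) (a : A 0).
Local Notation hel := (hel A).
Local Notation tn := (@tn k A T _).

Definition osel n n' (s : 'I_n -> option 'I_n') (X : 'I_n' -> hel) (i : 'I_n) : hel :=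
  if s i is Some u then X u else Tagged (fun d => A d) a.

Definition xsign n n' (s : 'I_n -> option 'I_n') (X : 'I_n' -> hel) : k :=
  ksign k s (fun u => tag (X u)).

(* The map x_1 (x) ... (x) x_n' |-> +/- (the tensor with x_u in the slot filled
   with u by s and a in the other slots). *)
Definition place_map n n' (s : 'I_n -> option 'I_n') : gmap (T n') (T n) :=
  the_gmap (fun f => gmorph 0 f /\ forall X : 'I_n' -> hel,
    f (deg X) (deg X) (tn X (deg X)) = xsign s X *: tn (osel s X) (deg X)).
Arguments place_map {n n'} s i j x : rename.

Lemma tag_osel n n' (s : 'I_n -> option 'I_n') (X : 'I_n' -> hel) i :
  tag (osel s X i) = oapp (fun u => tag (X u)) 0 (s i).
Proof. by rewrite /osel; case: (s i). Qed.

Lemma deg_osel n n' (s : 'I_n -> option 'I_n') (X : 'I_n' -> hel) :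
  placing s -> deg (osel s X) = deg X.
Proof.
move=> ps; rewrite /deg -(big_placing _ (fun u => tag (X u)) ps).
by apply: eq_bigr => i _; rewrite tag_osel.
Qed.

Lemma lin_at_osel n n' (s : 'I_n -> option 'I_n') (X Y Z : 'I_n' -> hel) c u i :
  s i = Some u -> (forall j, s j = Some u -> j = i) ->
  lin_at X Y Z c u -> lin_at (osel s X) (osel s Y) (osel s Z) c i.
Proof.
move=> Ei Ej [[d [x [y [Ex Ey Ez]]]] H]; split; first by exists d, x, y; rewrite /osel Ei.
move=> j ji; rewrite /osel; case E: (s j) => [v|] //; apply: H.
by apply: contra ji => /eqP vu; rewrite vu in E; rewrite (Ej _ E).
Qed.

Lemma placeP n n' (s : 'I_n -> option 'I_n') : placing s ->
  gmorph 0 (place_map s) /\ forall X : 'I_n' -> hel,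
    place_map s (deg X) (deg X) (tn X (deg X)) = xsign s X *: tn (osel s X) (deg X).
Proof.
move=> ps; rewrite /place_map; set P := (X in the_gmap X); apply: (@the_gmapP _ _ _ P).
have [g mg Hg] : exists2 g : gmap (T n') (T n), gmorph 0 g &
    forall X, g (deg X) (deg X + 0) (tn X (deg X)) = xsign s X *: tn (osel s X) (deg X + 0).
  apply: (@tn_univ _ _ T _ _ 0 (fun X d => xsign s X *: tn (osel s X) d)).
    move=> X Y Z c u d XYZ; have [t [st ts]] := ps.
    (* The sign only depends on the degrees, which [lin_at] preserves; this is why the signed
       placement is still multilinear. *)
    have XY : xsign s X = xsign s Z /\ xsign s Y = xsign s Z.
      rewrite /xsign; split; congr ksign; apply/funext => v;
      by case: (lin_at_tag XYZ v).
    have Ht j : s j = Some u -> j = t u by move/ts.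
    rewrite (tn_lin _ _ (lin_at_osel (st u) Ht XYZ)) XY.1 XY.2.
    by rewrite scalerDr !scalerA mulrC.
  move=> X p d Hp; apply: fil_scale.
  rewrite -(big_placing _ p ps); apply: tn_fil => i; rewrite /osel.
  by case: (s i) => [u|] /=; [exact: Hp | exact: fil_all].
by exists g; split=> // X; have := Hg X; rewrite addr0.
Qed.

Lemma gmorph_place n n' (s : 'I_n -> option 'I_n') : placing s -> gmorph 0 (place_map s).
Proof. by case/placeP. Qed.

Lemma placeE n n' (s : 'I_n -> option 'I_n') (X : 'I_n' -> hel) : placing s ->
  place_map s (deg X) (deg X) (tn X (deg X)) = xsign s X *: tn (osel s X) (deg X).
Proof. by case/placeP. Qed.

Lemma tn_uniq0 n (B : cmod k) (g g' : gmap (T n) B) :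
  gmorph 0 g -> gmorph 0 g' ->
  (forall X, g (deg X) (deg X) (tn X (deg X)) =
             g' (deg X) (deg X) (tn X (deg X))) -> g = g'.
Proof. by move=> mg mg' H; apply: (tn_uniq mg mg') => X; rewrite addr0. Qed.

Lemma place_eq n n' (s : 'I_n -> option 'I_n') (f : gmap (T n') (T n)) :
  placing s -> gmorph 0 f ->
  (forall X, f (deg X) (deg X) (tn X (deg X)) = xsign s X *: tn (osel s X) (deg X)) ->
  place_map s = f.
Proof.
by move=> ps mf Hf; apply: (tn_uniq0 (gmorph_place ps) mf) => X; rewrite Hf placeE.
Qed.

Lemma place_id n : place_map (@Some 'I_n) = gid.
Proof.
apply: place_eq => [||X]; [exact: placing_id | exact: gmorph_gid | ].
rewrite gid_diag /xsign ksign_mono ?scale1r // => i j u v ij [<-] [<-].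
exact: ltnW.
Qed.

(** The copies of [a] inserted by [s] have degree 0, which is the default value in [ksign_obind]. *)
Lemma place_comp n n' n'' (s : 'I_n -> option 'I_n') (s' : 'I_n'' -> option 'I_n) :
  placing s -> placing s' ->
  gcomp 0 (place_map s') (place_map s) = place_map (obind s \o s').
Proof.
move=> ps ps'; symmetry; apply: place_eq => [||X].
- exact: placing_obind.
- by have := gmorph_gcomp (gmorph_place ps') (gmorph_place ps).
rewrite /gcomp addr0 placeE // (lin_scale (gmorph_lin (gmorph_place ps') _ _)).
rewrite -(deg_osel X ps) placeE // scalerA; congr (_ *: _).
  rewrite mulrC /xsign -ksign_obind //; congr (_ * _); congr ksign.
  by apply/funext => i; rewrite tag_osel.
suff -> : osel s' (osel s X) = osel (obind s \o s') X by [].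
by apply/funext => i; rewrite /osel /=; case: (s' i).
Qed.

Lemma reorderE n n' (s : 'I_n -> 'I_n') : placing (Some \o s) ->
  reorder s = place_map (Some \o s).
Proof.
move=> ps; have [mp Hp] := placeP ps.
apply: the_gmap_eq; first split=> // dl d h h' x.
  rewrite tens_tn; pose X i := Tagged (fun d => A d) (x i).
  have Ed : deg X = d by rewrite -h addr0.
  rewrite koszul_signE tens_tn -Ed Hp; congr (_ *: _).
move=> g [mg Hg]; symmetry; apply: place_eq => // X.
rewrite (tn_tens _ (addr0 (deg X))).
have h' : \sum_i tag (X (s i)) + 0 = deg X.
  by rewrite addr0 -(deg_osel X ps).
rewrite (Hg _ _ _ h') koszul_signE tens_tn.
suff -> : (fun i => Tagged (fun d => A d) (tagged (X (s i)))) = osel (Some \o s) X by [].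
by apply/funext => i; rewrite /osel /=; case: (X (s i)).
Qed.

Lemma insertE p n :
  insert p a = place_map (fun l : 'I_(p + n) => if split l is inr i then Some i else None).
Proof.
set s := (X in place_map X).
have sl i : s (lshift n i) = None by rewrite /s split_lshift.
have sr i : s (rshift p i) = Some i by rewrite /s split_rshift.
have ps : placing s.
  exists (@rshift p n); split=> // i u.
  by elim/split_ind: i => i; rewrite ?sl ?sr // => -[->].
have key f : gmorph 0 f /\ (forall i (x : T n i),
      f i (0 + i) x = tcat (tens T (sum_zero_deg p) (fun _ => a)) x) -> f = place_map s.
  move=> [mf Hf]; symmetry; apply: place_eq => // X.
  (* The copies of [a] come first and the other entries keep their order, so the placing is monotone
     and has sign 1. *)
  have := Hf _ (tn X (deg X)); rewrite tens_tn.
  pose Y (_ : 'I_p) := Tagged (fun d => A d) a.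
  have Y0 : deg Y = 0 by rewrite /deg big1.
  rewrite -[tn _ 0]/(tn Y 0) (tcat_tn_deg _ (esym Y0) erefl) add0r => ->.
  rewrite /xsign ksign_mono ?scale1r.
    suff -> : hcat Y X = osel s X by [].
    by symmetry; apply: hcat_fun => i; rewrite /osel ?sl ?sr.
  move=> i j u v; elim/split_ind: i => i; elim/split_ind: j => j; rewrite ?sl ?sr //.
  by rewrite /= ltn_add2l => /ltnW ij [<-] [<-].
apply: the_gmap_eq => [|g Hg]; last exact: key.
have lin_tcat i j : linear (fun x : T n i =>
    gid (0 + i) j (tcat (tens T (sum_zero_deg p) (fun _ => a)) x)).
  by move=> c x y; rewrite tcat_lin_r (gmorph_lin (gmorph_gid _)).
rewrite -(key (fun i j x => gid (0 + i) j
   (tcat (tens T (sum_zero_deg p) (fun _ => a)) x))).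
  all: split=> [|i x]; last exact: gid_diag.
  all: split=> // [i j x ji|q i j x qx].
  1,3: by apply: gid_off; rewrite add0r => ij; apply: ji; rewrite ij addr0.
  all: apply: (gmorph_fil (gmorph_gid _)); rewrite -[q]add0n; apply: tcat_fil => //.
  all: exact: fil_all.
Qed.

Section GTens.
Variables (e1 e2 : int) (n1 m1 n2 m2 : nat).

Definition gtens_prop (f : gmap (T n1) (T m1)) (g : gmap (T n2) (T m2))
    (h : gmap (T (n1 + n2)%N) (T (m1 + m2)%N)) : Prop :=
  forall i j (x : T n1 i) (y : T n2 j),
    h (i + j) ((i + e1) + (j + e2)) (tcat x y) =
    sg k (e2 * i) *: tcat (f i (i + e1) x) (g j (j + e2) y).

Lemma gtens_deg (i j : int) : (i + e1) + (j + e2) = (i + j) + (e1 + e2).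
Proof. exact: addrACA. Qed.

(** The universal property only yields the formula on elementary tensors. It is extended to
    arbitrary x and y one variable at a time, by uniqueness of morphisms on each tensor power. *)
Lemma gtens_exists (f : gmap (T n1) (T m1)) (g : gmap (T n2) (T m2)) :
  gmorph e1 f -> gmorph e2 g ->
  exists h, gmorph (e1 + e2) h /\ gtens_prop f g h.
Proof.
move=> mf mg.
(* Here [gid] acts as a cast: it transports the value to the component d if the degrees agree, and
   gives 0 otherwise. *)
pose G i j (x : T n1 i) (y : T n2 j) d : T (m1 + m2)%N d :=
  gid (i + e1 + (j + e2)) d
    (sg k (e2 * i) *: tcat (f i (i + e1) x) (g j (j + e2) y)).
have Gl i j c (x x' : T n1 i) (y : T n2 j) d :
    G i j (c *: x + x') y d = c *: G i j x y d + G i j x' y d.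
  rewrite /G (gmorph_lin mf) tcat_lin_l -(gmorph_lin (gmorph_gid _)) /=.
  by rewrite scalerDr !scalerA mulrC.
have Gr i j c (x : T n1 i) (y y' : T n2 j) d :
    G i j x (c *: y + y') d = c *: G i j x y d + G i j x y' d.
  rewrite /G (gmorph_lin mg) tcat_lin_r -(gmorph_lin (gmorph_gid _)) /=.
  by rewrite scalerDr !scalerA mulrC.
have Gfil i j p q (x : T n1 i) (y : T n2 j) d : fil p x -> fil q y -> fil (p + q) (G i j x y d).
  move=> px qy; apply: (gmorph_fil (gmorph_gid _)); apply: fil_scale; apply: tcat_fil.
    exact: (gmorph_fil mf).
  exact: (gmorph_fil mg).
pose l X : 'I_n1 -> hel := X \o lshift n2; pose r X : 'I_n2 -> hel := X \o @rshift n1 n2.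
pose F (X : 'I_(n1 + n2) -> hel) d := G _ _ (tn (l X) (deg (l X))) (tn (r X) (deg (r X))) d.
have [||h mh Hh] := @tn_univ _ _ T _ _ (e1 + e2) F.
- move=> X Y Z c i d XYZ; rewrite /F.
  have [El Er] : (deg (l X) = deg (l Z) /\ deg (l Y) = deg (l Z)) /\
      (deg (r X) = deg (r Z) /\ deg (r Y) = deg (r Z)).
    have Ht := lin_at_tag XYZ.
    by split; split; apply: eq_bigr => j _; rewrite /l /r /= ?(Ht _).1 ?(Ht _).2.
  rewrite El.1 El.2 Er.1 Er.2; case: XYZ; elim/split_ind: i => i H1 H2.
    have -> : r X = r Z.
      by apply/funext => j; rewrite /r /= (H2 (rshift n1 j) _).1 // eq_rlshift.
    have -> : r Y = r Z.
      by apply/funext => j; rewrite /r /= (H2 (rshift n1 j) _).2 // eq_rlshift.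
    rewrite (@tn_lin _ _ T _ (l X) (l Y) (l Z) c i) ?Gl //; split=> // j ji.
    by apply: H2; rewrite eq_lshift.
  have -> : l X = l Z.
    by apply/funext => j; rewrite /l /= (H2 (lshift n2 j) _).1 // eq_lrshift.
  have -> : l Y = l Z.
    by apply/funext => j; rewrite /l /= (H2 (lshift n2 j) _).2 // eq_lrshift.
  rewrite (@tn_lin _ _ T _ (r X) (r Y) (r Z) c i) ?Gr //; split=> // j ji.
  by apply: H2; rewrite eq_rshift.
- move=> X p d Hp; rewrite big_split_ord /=.
  by apply: Gfil; apply: tn_fil => i; exact: Hp.
exists h; split=> //.
have HX X Y : h (deg X + deg Y) (deg X + e1 + (deg Y + e2))
     (tcat (tn X (deg X)) (tn Y (deg Y))) =
    G _ _ (tn X (deg X)) (tn Y (deg Y)) (deg X + e1 + (deg Y + e2)).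
  rewrite tcat_tn gtens_deg -deg_hcat Hh /F.
  have -> : l (hcat X Y) = X by apply/funext => i; rewrite /l /= hcat_lshift.
  by have -> : r (hcat X Y) = Y by apply/funext => i; rewrite /r /= hcat_rshift.
(* With an elementary second factor fixed, both sides are morphisms in x, of degree
   [deg Y + (e1 + e2)]. *)
have step Y i (x : T n1 i) d : h (i + deg Y) d (tcat x (tn Y (deg Y))) =
    G _ _ x (tn Y (deg Y)) d.
  pose h1 : gmap (T n1) (T (m1 + m2)%N) :=
    fun i d x => h (i + deg Y) d (tcat x (tn Y (deg Y))).
  pose h2 : gmap (T n1) (T (m1 + m2)%N) := fun i d x => G _ _ x (tn Y (deg Y)) d.
  suff E : h1 = h2 by rewrite -[LHS]/(h1 i d x) E.
  apply: (@tn_uniq _ _ T _ _ (deg Y + (e1 + e2))).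
  + split=> [i' j' c x' y'|i' j' x' ji|p i' j' x' px]; rewrite /h1.
    * by rewrite tcat_lin_l (gmorph_lin mh).
    * by apply: (gmorph_off mh); rewrite -addrA.
    * apply: (gmorph_fil mh); rewrite -[p]addn0; apply: tcat_fil => //; exact: fil_all.
  + split=> [i' j' c x' y'|i' j' x' ji|p i' j' x' px]; rewrite /h2.
    * exact: Gl.
    * by apply: gid_off => E; apply: ji; rewrite -E gtens_deg -addrA.
    * rewrite -[p]addn0; apply: Gfil => //; exact: fil_all.
  + by move=> X; rewrite /h1 /h2 addrA -gtens_deg HX.
move=> i j x y; rewrite -[RHS]gid_diag.
pose h1 : gmap (T n2) (T (m1 + m2)%N) := fun j d y => h (i + j) d (tcat x y).
pose h2 : gmap (T n2) (T (m1 + m2)%N) := fun j d y => G i j x y d.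
suff E : h1 = h2 by rewrite -[LHS]/(h1 j _ y) E.
apply: (@tn_uniq _ _ T _ _ (i + (e1 + e2))).
+ split=> [i' j' c x' y'|i' j' x' ji|p i' j' x' px]; rewrite /h1.
  * by rewrite tcat_lin_r (gmorph_lin mh).
  * by apply: (gmorph_off mh); rewrite -addrA addrCA.
  * apply: (gmorph_fil mh); rewrite -[p]add0n; apply: tcat_fil => //; exact: fil_all.
+ split=> [i' j' c x' y'|i' j' x' ji|p i' j' x' px]; rewrite /h2.
  * exact: Gr.
  * by apply: gid_off => E; apply: ji; rewrite -E gtens_deg -addrA addrCA.
  * rewrite -[p]add0n; apply: Gfil => //; exact: fil_all.
+ by move=> Y; rewrite /h1 /h2 step.
Qed.

End GTens.

End Place.
Arguments place_map {k A T} a {n n'} s i j x : rename.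

Section TensorsOfMaps.
Variables (k : fieldType) (A : cmod k) (T : tensor_powers A).
Local Notation tn := (@tn k A T _).

Section GTens.
Variables (e1 e2 : int) (n1 m1 n2 m2 : nat).
Implicit Types (f : gmap (T n1) (T m1)) (g : gmap (T n2) (T m2)).

Lemma gtensP f g : gmorph e1 f -> gmorph e2 g ->
  gmorph (e1 + e2) (gtens e1 e2 f g) /\ gtens_prop e1 e2 f g (gtens e1 e2 f g).
Proof.
move=> mf mg; rewrite /gtens; set P := (X in the_gmap X).
exact: (@the_gmapP _ _ _ P (gtens_exists mf mg)).
Qed.

Lemma gmorph_gtens f g : gmorph e1 f -> gmorph e2 g ->
  gmorph (e1 + e2) (gtens e1 e2 f g).
Proof. by move=> mf mg; case: (gtensP mf mg). Qed.

Lemma gtensE f g i j (x : T n1 i) (y : T n2 j) : gmorph e1 f -> gmorph e2 g ->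
  gtens e1 e2 f g (i + j) ((i + e1) + (j + e2)) (tcat x y) =
    sg k (e2 * i) *: tcat (f i (i + e1) x) (g j (j + e2) y).
Proof. by move=> mf mg; case: (gtensP mf mg) => _; apply. Qed.

Lemma gtens_eq f g h : gmorph e1 f -> gmorph e2 g -> gmorph (e1 + e2) h ->
  gtens_prop e1 e2 f g h -> gtens e1 e2 f g = h.
Proof.
move=> mf mg mh Hh; apply: (tcat_uniq (gmorph_gtens mf mg) mh) => X Y.
by rewrite -gtens_deg Hh gtensE.
Qed.

Lemma gtens_linl c f f' g : gmorph e1 f -> gmorph e1 f' -> gmorph e2 g ->
  gtens e1 e2 (gadd (gscale c f) f') g =
  gadd (gscale c (gtens e1 e2 f g)) (gtens e1 e2 f' g).
Proof.
move=> mf mf' mg; apply: gtens_eq => //; try exact: gmorph_comb.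
  by apply: gmorph_comb; exact: gmorph_gtens.
move=> i j x y; rewrite /gadd /gscale !gtensE // tcat_lin_l scalerDr !scalerA.
by rewrite mulrC.
Qed.

Lemma gtens_linr c f g g' : gmorph e1 f -> gmorph e2 g -> gmorph e2 g' ->
  gtens e1 e2 f (gadd (gscale c g) g') =
  gadd (gscale c (gtens e1 e2 f g)) (gtens e1 e2 f g').
Proof.
move=> mf mg mg'; apply: gtens_eq => //; try exact: gmorph_comb.
  by apply: gmorph_comb; exact: gmorph_gtens.
move=> i j x y; rewrite /gadd /gscale !gtensE // tcat_lin_r scalerDr !scalerA.
by rewrite mulrC.
Qed.

Lemma fshift_gtens p q f g : gmorph e1 f -> gmorph e2 g ->
  fshift p f -> fshift q g -> fshift (p + q) (gtens e1 e2 f g).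
Proof.
move=> mf mg pf qg; apply: (tn_shift (gmorph_gtens mf mg)) => X r Hr.
rewrite (tn_hcat_split X) deg_hcat -tcat_tn -gtens_deg gtensE //.
apply: fil_scale; rewrite big_split_ord /= addnACA.
by apply: tcat_fil; [apply: pf | apply: qg]; apply: tn_fil => i; exact: Hr.
Qed.

End GTens.

(** On x of degree i the two steps contribute the exponents e2' i and e2 (i + e1'); compared with
    the exponent (e2' + e2) i of the right-hand side, the excess is e2 e1', the cost of moving [g]
    past [f']. *)
Lemma gtens_comp e1 e2 e1' e2' l1 l2 n1 m1 n2 m2
    (f : gmap (T n1) (T m1)) (g : gmap (T n2) (T m2))
    (f' : gmap (T l1) (T n1)) (g' : gmap (T l2) (T n2)) :
  gmorph e1 f -> gmorph e2 g -> gmorph e1' f' -> gmorph e2' g' ->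
  gcomp (e1' + e2') (gtens e1 e2 f g) (gtens e1' e2' f' g') =
  gscale (sg k (e2 * e1'))
    (gtens (e1' + e1) (e2' + e2) (gcomp e1' f f') (gcomp e2' g g')).
Proof.
move=> mf mg mf' mg'.
have m1' := gmorph_gcomp mf mf'; have m2' := gmorph_gcomp mg mg'.
apply: (tcat_uniq (e := e1' + e2' + (e1 + e2))) => [||X Y].
- exact: (gmorph_gcomp (gmorph_gtens mf mg) (gmorph_gtens mf' mg')).
- by rewrite addrACA; apply: gmorph_gscale; exact: gmorph_gtens.
move: (deg X) (tn X (deg X)) (deg Y) (tn Y (deg Y)) => i x j y.
have -> : i + j + (e1' + e2' + (e1 + e2)) = (i + (e1' + e1)) + (j + (e2' + e2)).
  by rewrite (addrACA e1') [RHS]addrACA.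
rewrite {1}/gcomp /gscale gtensE // -(gtens_deg e1' e2' i j) gtensE //.
rewrite (lin_scale (gmorph_lin (gmorph_gtens mf mg) _ _)).
rewrite (addrA i) (addrA j) gtensE // /gcomp !scalerA -!sgD; congr (sg k _ *: _).
by ring.
Qed.

End TensorsOfMaps.

(** * Composition along two-vertex graphs *)

Arguments in_order {m1 n1 m2 n2 m n} w l : rename.
Arguments mid_order {m1 n1 m2 n2 m n} w l : rename.
Arguments out_order {m1 n1 m2 n2 m n} w o : rename.

(** Together with its negative counterpart, this reduces the dependent match on membership in the
    definition of [mid_order]. *)
Lemma reflect_matchT (R : Type) (P : Prop) b (r : reflect P b) (F : P -> R)
    (G : ~ P -> R) (h : P) :
  match r with ReflectT h => F h | ReflectF h => G h end = F h.
Proof. by case: r => // h'; congr F; exact: Prop_irrelevance. Qed.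

Lemma reflect_matchF (R : Type) (P : Prop) b (r : reflect P b) (F : P -> R)
    (G : ~ P -> R) (h : ~ P) :
  match r with ReflectT h => F h | ReflectF h => G h end = G h.
Proof. by case: r => // h'; congr G; exact: Prop_irrelevance. Qed.

Section WiringOrders.
Variables m1 n1 m2 n2 m n : nat.
Variable w : wiring m1 n1 m2 n2 m n.

Lemma wiring_inj : injective w.
Proof. by have /and5P[/injectiveP] := wmapP w. Qed.

Lemma wiring_surj s : exists x, w x = s.
Proof.
have /and5P[_ /forallP/(_ s)/codomP[x ->] _ _ _] := wmapP w.
by exists x.
Qed.

Lemma bin_bout i o : w (bin i) <> bout o.
Proof. by have /and5P[_ _ _ /forallP/(_ i) + _] := wmapP w => + E; rewrite E. Qed.

Lemma tin_ginP i : exists j, w (tin i) = gin j.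
Proof.
have := tin_gin w i; case: (w (tin i)) => //= j _; by exists j.
Qed.

Lemma get_ginE (s : source m1 m2 n) (h : is_gin s) : s = gin (get_gin h).
Proof. by move: h; case: s. Qed.

Lemma get_toutE (s : source m1 m2 n) (h : is_tout s) : s = tout (get_tout h).
Proof. by move: h; case: s => [|[]]. Qed.

Lemma in_order_bin i : w (bin (enum_val i)) = gin (in_order w (lshift n2 i)).
Proof. by rewrite /in_order split_lshift -get_ginE. Qed.

Lemma in_order_tin i : w (tin i) = gin (in_order w (rshift #|ext_in w| i)).
Proof. by rewrite /in_order split_rshift -get_ginE. Qed.

Lemma mid_order_ext i j : w (bin i) = gin j ->
  exists2 r : 'I_#|ext_in w|, mid_order w (lshift _ i) = lshift m2 r & enum_val r = i.
Proof.
move=> E; have h : i \in ext_in w by rewrite inE E.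
rewrite /mid_order split_lshift (reflect_matchT _ _ _ h).
by exists (enum_rank_in h i) => //; rewrite enum_rankK_in.
Qed.

Lemma mid_order_int i l : w (bin i) = tout l ->
  mid_order w (lshift _ i) = rshift _ l.
Proof.
move=> E; have h : ~ i \in ext_in w by rewrite inE E.
rewrite /mid_order split_lshift (reflect_matchF _ _ _ h); congr (rshift _ _).
by have [] : tout (get_tout (int_inP (introN idP h))) = tout l :> source m1 m2 n
  by rewrite -get_toutE.
Qed.

Lemma mid_order_out i : mid_order w (rshift n1 i) = rshift _ (enum_val i).
Proof. by rewrite /mid_order split_rshift. Qed.

(** The match in [out_order] carries the proof [erefl]; replacing it by an arbitrary [E] allows the
    value of [w (gout o)] to be substituted. *)
Lemma out_orderE o s (E : w (gout o) = s) :
  out_order w o =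
  match s as s return w (gout o) = s -> 'I_(m1 + #|ext_out w|) with
  | inl i => fun E => match gout_gin E with end
  | inr (inl j) => fun _ => lshift _ j
  | inr (inr l) => fun E => rshift _ (enum_rank_in (ext_outP E) l)
  end E.
Proof. by case: _ / E. Qed.

Lemma out_order_bout o j : w (gout o) = bout j -> out_order w o = lshift _ j.
Proof. by move=> E; rewrite (out_orderE E). Qed.

Lemma out_order_tout o l : w (gout o) = tout l ->
  exists2 r : 'I_#|ext_out w|, out_order w o = rshift m1 r & enum_val r = l.
Proof.
move=> E; rewrite (out_orderE E); exists (enum_rank_in (ext_outP E) l) => //.
by rewrite enum_rankK_in // (ext_outP E).
Qed.

Lemma bin_cases i : (exists j, w (bin i) = gin j) \/ (exists l, w (bin i) = tout l).
Proof.
case E: (w (bin i)) => [j|[o|l]]; [by left; exists j | | by right; exists l].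
by case: (@bin_bout i o).
Qed.

Lemma gout_cases o : (exists j, w (gout o) = bout j) \/ (exists l, w (gout o) = tout l).
Proof.
case E: (w (gout o)) => [j|[j|l]]; [|by left; exists j | by right; exists l].
by case: (gout_gin E).
Qed.

Lemma placing_in_order : placing (Some \o in_order w).
Proof.
apply: placing_inj => [|j].
  move=> l l'; elim/split_ind: l => i; elim/split_ind: l' => i' E.
  - have := in_order_bin i; rewrite E -in_order_bin => /wiring_inj[] /enum_val_inj ->//.
  - by have := in_order_bin i; rewrite E -in_order_tin => /wiring_inj[].
  - by have := in_order_tin i; rewrite E -in_order_bin => /wiring_inj[].
  - by have := in_order_tin i; rewrite E -in_order_tin => /wiring_inj[] ->.
have [[o|[i|i]] E] := wiring_surj (gin j).
- by case: (gout_gin E).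
- have h : i \in ext_in w by rewrite inE E.
  exists (lshift _ (enum_rank_in h i)).
  by have := in_order_bin (enum_rank_in h i); rewrite enum_rankK_in // E => -[].
- by exists (rshift _ i); have := in_order_tin i; rewrite E => -[].
Qed.

Lemma ext_in_gin i : i \in ext_in w -> exists j, w (bin i) = gin j.
Proof. by rewrite inE; case: (w (bin i)) => // j _; exists j. Qed.

Lemma ext_out_tout l : l \in ext_out w -> exists o, w (gout o) = tout l.
Proof. by rewrite inE => /existsP[o /eqP E]; exists o. Qed.

Lemma placing_mid_order : placing (Some \o mid_order w).
Proof.
apply: placing_inj => [l l'|].
  elim/split_ind: l => i; elim/split_ind: l' => i'; rewrite ?mid_order_out.
  - case: (bin_cases i) (bin_cases i') => -[j Ej] [] [j' Ej'].
    + have [r -> <-] := mid_order_ext Ej; have [r' -> <-] := mid_order_ext Ej'.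
      by move=> /lshift_inj ->.
    + have [r -> _] := mid_order_ext Ej; rewrite (mid_order_int Ej') => /eqP.
      by rewrite eq_lrshift.
    + have [r -> _] := mid_order_ext Ej'; rewrite (mid_order_int Ej) => /eqP.
      by rewrite eq_rlshift.
    + rewrite (mid_order_int Ej) (mid_order_int Ej') => /rshift_inj E.
      by move: Ej; rewrite E -Ej' => /wiring_inj[->].
  - case: (bin_cases i) => -[j Ej].
      by have [r -> _] := mid_order_ext Ej => /eqP; rewrite eq_lrshift.
    rewrite (mid_order_int Ej) => /rshift_inj E.
    have [o] := ext_out_tout (enum_valP i'); rewrite -E -Ej => /wiring_inj //.
  - case: (bin_cases i') => -[j Ej].
      by have [r -> _] := mid_order_ext Ej => /eqP; rewrite eq_rlshift.
    rewrite (mid_order_int Ej) => /rshift_inj E.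
    have [o] := ext_out_tout (enum_valP i); rewrite E -Ej => /wiring_inj //.
  - by move=> /rshift_inj/enum_val_inj ->.
move=> u; elim/split_ind: u => u.
  have [j Ej] := ext_in_gin (enum_valP u).
  exists (lshift _ (enum_val u)); have [r -> E] := mid_order_ext Ej.
  by rewrite (enum_val_inj E).
have [[o|[i|i]] E] := wiring_surj (tout u).
- have h : u \in ext_out w := ext_outP E.
  by exists (rshift _ (enum_rank_in h u)); rewrite mid_order_out enum_rankK_in.
- by exists (lshift _ i); rewrite (mid_order_int E).
- by have [j] := tin_ginP i; rewrite E.
Qed.

Lemma placing_out_order : placing (Some \o out_order w).
Proof.
apply: placing_inj => [o o'|].
  case: (gout_cases o) (gout_cases o') => -[j Ej] [] [j' Ej'].
  - rewrite (out_order_bout Ej) (out_order_bout Ej') => /lshift_inj E.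
    by move: Ej; rewrite E -Ej' => /wiring_inj[].
  - rewrite (out_order_bout Ej); have [r -> _] := out_order_tout Ej'.
    by move/eqP; rewrite eq_lrshift.
  - rewrite (out_order_bout Ej'); have [r -> _] := out_order_tout Ej.
    by move/eqP; rewrite eq_rlshift.
  - have [r -> E1] := out_order_tout Ej; have [r' -> E2] := out_order_tout Ej'.
    move=> /rshift_inj E; move: Ej; rewrite -E1 E E2 -Ej' => /wiring_inj[] //.
move=> u; elim/split_ind: u => u.
  have [[o|[i|i]] E] := wiring_surj (bout u).
  - by exists o; rewrite (out_order_bout E).
  - by case: (bin_bout E).
  - by have [j] := tin_ginP i; rewrite E.
have [o E] := ext_out_tout (enum_valP u).
by exists o; have [r -> /enum_val_inj ->] := out_order_tout E.
Qed.

End WiringOrders.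

Section EndComposition.
Variables (k : fieldType) (A : cmod k) (T : tensor_powers A) (a : A 0).
Local Notation tn := (@tn k A T _).
Local Notation place := (@place_map k A T a _ _).

Lemma gtens_place n1 m1 n2 m2 (s : 'I_m1 -> option 'I_n1) (r : 'I_m2 -> option 'I_n2) :
  placing s -> placing r ->
  gtens 0 0 (place s) (place r) = place (osum s r).
Proof.
move=> ps pr; have ms := gmorph_place T a ps; have mr := gmorph_place T a pr.
have psr := placing_osum ps pr.
apply: (tcat_uniq (gmorph_gtens ms mr)) => [|X Y]; first exact: gmorph_place.
have /= := gtensE (tn X (deg X)) (tn Y (deg Y)) ms mr.
rewrite !addr0 => ->; rewrite mul0r scale1r !placeE // tcat_tn.
rewrite tcat_scale (tcat_tn_deg _ (esym (deg_osel a X ps)) (esym (deg_osel a Y pr))).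
rewrite -deg_hcat placeE //.
have -> : hcat (osel a s X) (osel a r Y) = osel a (osum s r) (hcat X Y).
  symmetry; apply: hcat_fun => i; rewrite /osel ?osum_lshift ?osum_rshift.
    by case: (s i) => [u|] //=; rewrite hcat_lshift.
  by case: (r i) => [u|] //=; rewrite hcat_rshift.
congr (_ *: _); rewrite /xsign ksign_osum; congr (_ * _); congr ksign.
  by apply/funext => i /=; rewrite hcat_lshift.
by apply/funext => i /=; rewrite hcat_rshift.
Qed.

Section Interchange.
Variables (n1 m1 l1 n2 m2 l2 : nat) (e : int).

Lemma gtens_l_comp (f : gmap (T n1) (T m1)) (p : gmap (T l1) (T n1))
    (q : gmap (T l2) (T n2)) :
  gmorph e f -> gmorph 0 p -> gmorph 0 q ->
  gcomp 0 (gtens e 0 f gid) (gtens 0 0 p q) = gtens e 0 (gcomp 0 f p) q.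
Proof.
move=> mf mp mq.
have := gtens_comp mf (gmorph_gid _) mp mq; rewrite !addr0 !add0r mul0r => ->.
by rewrite (gcomp_idl mq); apply: gmap_ext => i j x; rewrite /gscale scale1r.
Qed.

Lemma gtens_r_comp (g : gmap (T n2) (T m2)) (p : gmap (T l1) (T n1))
    (q : gmap (T l2) (T n2)) :
  gmorph e g -> gmorph 0 p -> gmorph 0 q ->
  gcomp 0 (gtens 0 e gid g) (gtens 0 0 p q) = gtens 0 e p (gcomp 0 g q).
Proof.
move=> mg mp mq.
have := gtens_comp (gmorph_gid _) mg mp mq; rewrite !addr0 !add0r mulr0 => ->.
by rewrite (gcomp_idl mp); apply: gmap_ext => i j x; rewrite /gscale scale1r.
Qed.

Lemma comp_gtens_l (f : gmap (T n1) (T m1)) (q : gmap (T l2) (T n2)) :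
  gmorph e f -> gmorph 0 q ->
  gcomp e (gtens 0 0 gid q) (gtens e 0 f gid) = gtens e 0 f q.
Proof.
move=> mf mq.
have := gtens_comp (gmorph_gid _) mq mf (gmorph_gid _); rewrite !addr0 mul0r => ->.
by rewrite (gcomp_idl mf) gcomp_idr; apply: gmap_ext => i j x; rewrite /gscale scale1r.
Qed.

Lemma comp_gtens_r (g : gmap (T n2) (T m2)) (p : gmap (T l1) (T n1)) :
  gmorph e g -> gmorph 0 p ->
  gcomp e (gtens 0 0 p gid) (gtens 0 e gid g) = gtens 0 e p g.
Proof.
move=> mg mp.
have := gtens_comp mp (gmorph_gid _) (gmorph_gid _) mg; rewrite !addr0 !add0r mul0r => ->.
by rewrite (gcomp_idl mg) gcomp_idr; apply: gmap_ext => i j x; rewrite /gscale scale1r.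
Qed.

End Interchange.

Lemma gmorph_reorder n n' (s : 'I_n -> 'I_n') :
  placing (Some \o s) -> gmorph 0 (reorder s : gmap (T n') (T n)).
Proof. by move=> ps; rewrite (reorderE T a ps); exact: gmorph_place. Qed.

Lemma fshift_end_comp m1 n1 m2 n2 m n (w : wiring m1 n1 m2 n2 m n) e1 e2 p q
    (f : gmap (T n1) (T m1)) (g : gmap (T n2) (T m2)) :
  gmorph e1 f -> gmorph e2 g -> fshift p f -> fshift q g ->
  fshift (p + q) (end_comp w e1 e2 f g).
Proof.
move=> mf mg pf qg; rewrite /end_comp.
have si := fshift_gmorph (gmorph_reorder (placing_in_order w)).
have sm := fshift_gmorph (gmorph_reorder (placing_mid_order w)).
have so := fshift_gmorph (gmorph_reorder (placing_out_order w)).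
have id0 l := fshift_gmorph (gmorph_gid (T l)).
have := fshift_gcomp (0) (fshift_gtens (gmorph_gid _) mg (id0 _) qg) si.
rewrite addn0 add0n => H; have {H} := fshift_gcomp (e2) sm H.
rewrite add0n => H.
have {H} := fshift_gcomp (e2) (fshift_gtens mf (gmorph_gid _) pf (id0 _)) H.
by rewrite addn0 => H; have {H} := fshift_gcomp (e1 + e2) so H.
Qed.

Lemma gcomp_linr (B C D : cmod k) e e' c (f : gmap C D) (g g' : gmap B C) :
  gmorph e' f -> gcomp e f (gadd (gscale c g) g') =
  gadd (gscale c (gcomp e f g)) (gcomp e f g').
Proof.
by move=> mf; apply: gmap_ext => i j x; rewrite /gcomp /gadd /gscale (gmorph_lin mf).
Qed.

Lemma end_comp_linl m1 n1 m2 n2 m n (w : wiring m1 n1 m2 n2 m n) e1 e2 c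
    (f f' : gmap (T n1) (T m1)) (g : gmap (T n2) (T m2)) :
  gmorph e1 f -> gmorph e1 f' -> gmorph e2 g ->
  end_comp w e1 e2 (gadd (gscale c f) f') g =
  gadd (gscale c (end_comp w e1 e2 f g)) (end_comp w e1 e2 f' g).
Proof.
move=> mf mf' mg; rewrite /end_comp (gtens_linl c mf mf' (gmorph_gid _)).
rewrite -(gcomp_linr _ _ _ _ (gmorph_reorder (placing_out_order w))); congr gcomp.
Qed.

Lemma end_comp_linr m1 n1 m2 n2 m n (w : wiring m1 n1 m2 n2 m n) e1 e2 c
    (f : gmap (T n1) (T m1)) (g g' : gmap (T n2) (T m2)) :
  gmorph e1 f -> gmorph e2 g -> gmorph e2 g' ->
  end_comp w e1 e2 f (gadd (gscale c g) g') =
  gadd (gscale c (end_comp w e1 e2 f g)) (end_comp w e1 e2 f g').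
Proof.
move=> mf mg mg'; rewrite /end_comp (gtens_linr c (gmorph_gid _) mg mg').
rewrite -(gcomp_linr _ _ _ _ (gmorph_reorder (placing_out_order w))); congr gcomp.
rewrite -(gcomp_linr _ _ _ _ (gmorph_gtens mf (gmorph_gid _))); congr gcomp.
by rewrite -(gcomp_linr _ _ _ _ (gmorph_reorder (placing_mid_order w))).
Qed.

End EndComposition.

(** * Filling global inputs of a two-vertex graph *)

Section EndCompPlace.
Variables (k : fieldType) (A : cmod k) (T : tensor_powers A) (a : A 0).
Local Notation place := (@place_map k A T a _ _).

(** Equal sets index tensor powers whose types are not convertible; [c] is the identity between
    their enumerations. *)
Lemma eq_set_enum N (S S' : {set 'I_N}) : S = S' ->
  exists2 c : 'I_#|S| -> 'I_#|S'|, placing (Some \o c) &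
    forall r, enum_val (c r) = enum_val r.
Proof. by move=> <-; exists id; first exact: (@placing_id #|S|). Qed.

(* w' arises from w by filling global inputs of w, and correspondingly inputs
   of the two vertices, as prescribed by s, b1 and b2. *)
Section Filling.
Variables (m1 n1 n1' m2 n2 n2' m n n' : nat).
Variables (w : wiring m1 n1 m2 n2 m n) (w' : wiring m1 n1' m2 n2' m n').
Variables (s : 'I_n -> option 'I_n') (b1 : 'I_n1 -> option 'I_n1')
  (b2 : 'I_n2 -> option 'I_n2').
Hypotheses (ps : placing s) (pb1 : placing b1) (pb2 : placing b2).
Hypothesis gout_bout : forall o j, w (gout o) = bout j -> w' (gout o) = bout j.
Hypothesis gout_tout : forall o l, w (gout o) = tout l -> w' (gout o) = tout l.
Hypothesis bin_gin : forall i j, w (bin i) = gin j ->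
  if b1 i is Some i' then exists2 j', w' (bin i') = gin j' & s j = Some j'
  else s j = None.
Hypothesis bin_tout : forall i l, w (bin i) = tout l ->
  exists2 i', b1 i = Some i' & w' (bin i') = tout l.
Hypothesis tin_gin' : forall i j, w (tin i) = gin j ->
  if b2 i is Some i' then exists2 j', w' (tin i') = gin j' & s j = Some j'
  else s j = None.

Lemma filling_ext_out : ext_out w = ext_out w'.
Proof.
apply/setP => l; apply/idP/idP => /ext_out_tout[o E].
  exact: ext_outP (gout_tout E).
have [[j Ej]|[l' El]] := gout_cases w o.
  by have := gout_bout Ej; rewrite E.
by have := gout_tout El; rewrite E => -[ll]; rewrite -ll in El; exact: ext_outP El.
Qed.

Lemma filling_ext_in i i' : b1 i = Some i' -> (i \in ext_in w) = (i' \in ext_in w').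
Proof.
move=> E; rewrite !inE; have [[j Ej]|[l El]] := bin_cases w i.
  by have := bin_gin Ej; rewrite E Ej => -[j' -> _].
by have [i''] := bin_tout El; rewrite E El => -[<-] ->.
Qed.

(** The restriction of [b1] to the inputs of the bottom vertex that are global inputs, read through
    the enumerations of these sets. *)
Definition ext_fill (r : 'I_#|ext_in w|) : option 'I_#|ext_in w'| :=
  obind (fun i' => [pick r' : 'I_#|ext_in w'| | enum_val r' == i']) (b1 (enum_val r)).

Lemma ext_fill_None r : b1 (enum_val r) = None -> ext_fill r = None.
Proof. by rewrite /ext_fill => ->. Qed.

Lemma ext_fill_Some r i' : b1 (enum_val r) = Some i' ->
  exists2 r', ext_fill r = Some r' & enum_val r' = i'.
Proof.
move=> E; rewrite /ext_fill E /=; have h : i' \in ext_in w'.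
  by rewrite -(filling_ext_in E); exact: enum_valP.
case: pickP => [r' /eqP Er|]; first by exists r'.
by move=> /(_ (enum_rank_in h i')); rewrite enum_rankK_in // eqxx.
Qed.

Lemma placing_ext_fill : placing ext_fill.
Proof.
have [t1 [bt tb]] := pb1.
have h (r' : 'I_#|ext_in w'|) : t1 (enum_val r') \in ext_in w.
  by rewrite (filling_ext_in (bt _)) enum_valP.
pose t (r' : 'I_#|ext_in w'|) := enum_rank_in (h r') (t1 (enum_val r')).
have Et (r' : 'I_#|ext_in w'|) : enum_val (t r') = t1 (enum_val r') by rewrite /t enum_rankK_in.
exists t; split=> [r'|r r'].
  have [|r'' -> /enum_val_inj-> //] := @ext_fill_Some (t r') (enum_val r').
  by rewrite Et bt.
case E: (b1 (enum_val r)) => [i'|]; last by rewrite ext_fill_None.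
have [r'' -> Er] := ext_fill_Some E; case=> <-.
by apply: enum_val_inj; rewrite Et Er (tb _ _ E).
Qed.

(** The placing is moved leftwards through the five factors of [end_comp]: past the input order it
    splits into [ext_fill] and [b2], the latter is absorbed by [g]; past the middle order [ext_fill]
    becomes [b1], which is absorbed by [f]. All placings have degree 0, so the interchanges are free
    of signs. *)
Lemma end_comp_place e1 e2 (f : gmap (T n1) (T m1)) (g : gmap (T n2) (T m2)) :
  gmorph e1 f -> gmorph e2 g ->
  gcomp 0 (end_comp w e1 e2 f g) (place s) =
  end_comp w' e1 e2 (gcomp 0 f (place b1)) (gcomp 0 g (place b2)).
Proof.
move=> mf mg; have [c pc Ec] := eq_set_enum filling_ext_out.
have pr := placing_ext_fill.
have mb1 := gmorph_place T a pb1; have mb2 := gmorph_place T a pb2.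
have mc := gmorph_place T a pc; have mr := gmorph_place T a pr.
have mf1 : gmorph e1 (gcomp 0 f (place b1)) by have := gmorph_gcomp mf mb1; rewrite add0r.
have mg2 : gmorph e2 (gcomp 0 g (place b2)) by have := gmorph_gcomp mg mb2; rewrite add0r.
have in_s : gcomp 0 (reorder (in_order w)) (place s) =
    gcomp 0 (gtens 0 0 (place ext_fill) (place b2)) (reorder (in_order w')).
  rewrite !(reorderE T a) ?gtens_place //; try exact: placing_in_order.
  rewrite !place_comp //; try exact: placing_in_order; try exact: placing_osum.
  congr (place_map a _); apply/funext => l /=; elim/split_ind: l => i.
    rewrite osum_lshift; have Ei := in_order_bin i; have := bin_gin Ei.
    case Eb: (b1 (enum_val i)) => [i'|]; last by rewrite ext_fill_None.
    have [r -> Er] := ext_fill_Some Eb; rewrite -Er in_order_bin => -[j' [<-] ->].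
    by [].
  rewrite osum_rshift; have := tin_gin' (in_order_tin w i).
  by case: (b2 i) => [i'|] //; rewrite in_order_tin => -[j' [<-] ->].
have mid_s : gcomp 0 (reorder (mid_order w)) (gtens 0 0 (place ext_fill) gid) =
    gcomp 0 (gtens 0 0 (place b1) (place (Some \o c))) (reorder (mid_order w')).
  rewrite -(place_id T a) !(reorderE T a) ?gtens_place //;
    try exact: placing_mid_order; try exact: placing_id.
  rewrite !place_comp //;
    try exact: placing_mid_order; try (apply: placing_osum => //; exact: placing_id).
  congr (place_map a _); apply/funext => l /=; elim/split_ind: l => i.
    rewrite osum_lshift; have [[j Ej]|[l El]] := bin_cases w i; last first.
      rewrite (mid_order_int El) osum_rshift; have [i' -> Ei'] := bin_tout El.
      by rewrite /= (mid_order_int Ei').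
    have [r -> Er] := mid_order_ext Ej; rewrite osum_lshift.
    have := bin_gin Ej; rewrite -Er.
    case Eb: (b1 (enum_val r)) => [i'|] H; last by rewrite ext_fill_None.
    have [r' -> Er'] := ext_fill_Some Eb; case: H => j' Ej' _ /=.
    have [r'' -> Er''] := mid_order_ext Ej'.
    by congr (Some (lshift _ _)); apply: enum_val_inj; rewrite Er' Er''.
  by rewrite osum_rshift /= !mid_order_out osum_rshift /= Ec.
have out_s : gcomp 0 (reorder (out_order w)) (gtens 0 0 gid (place (Some \o c))) =
    reorder (out_order w').
  rewrite -(place_id T a) !(reorderE T a) ?gtens_place //;
    try exact: placing_out_order; try exact: placing_id.
  rewrite !place_comp //;
    try exact: placing_out_order; try (apply: placing_osum => //; exact: placing_id).
  congr (place_map a _); apply/funext => o /=.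
  have [[j Ej]|[l El]] := gout_cases w o.
    by rewrite (out_order_bout Ej) osum_lshift (out_order_bout (gout_bout Ej)).
  have [r -> Er] := out_order_tout El; rewrite osum_rshift /=.
  have [r' -> Er'] := out_order_tout (gout_tout El).
  by congr (Some (rshift _ _)); apply: enum_val_inj; rewrite Ec Er Er'.
rewrite /end_comp !gcompA0 in_s -(gcompA0 _ (gtens 0 e2 gid g)) gtens_r_comp // -(comp_gtens_r mg2 mr).
rewrite gcompA0 -(gcomp0A _ (reorder (mid_order w))) mid_s gcomp0A.
rewrite -(gcomp0A _ (gtens e1 0 f gid)) gtens_l_comp // -(comp_gtens_l mf1 mc).
by rewrite gcompAD -(gcomp0A _ (reorder (out_order w))) out_s.
Qed.

End Filling.
End EndCompPlace.

Section EndCompInsert.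
Variables (k : fieldType) (A : cmod k) (T : tensor_powers A) (a : A 0).
Local Notation tn := (@tn k A T _).
Local Notation place := (@place_map k A T a _ _).

Definition pad n q (l : 'I_(n + q)) : option 'I_n :=
  if split l is inl i then Some i else None.

Lemma placing_pad n q : placing (@pad n q).
Proof.
exists (@lshift n q); split=> [u|l u]; first by rewrite /pad split_lshift.
by elim/split_ind: l => i; rewrite /pad ?split_lshift ?split_rshift // => -[->].
Qed.

Lemma padE n q i j (x : T n i) :
  place (@pad n q) i j x = gid (i + 0) j (tcat x (tn (fun=> Tagged (fun d => A d) a) 0)).
Proof.
set u0 := tn _ 0; have u0E : u0 = tn (fun _ : 'I_q => Tagged (fun d => A d) a) 0 by [].
have mp := gmorph_place T a (placing_pad n q).
suff -> : place (@pad n q) = (fun i j x => gid (i + 0) j (tcat x u0)) by [].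
apply: (tn_uniq0 mp) => [|X].
  split=> [i' j' c y z|i' j' y ji|p i' j' y py].
  - by rewrite tcat_lin_l (gmorph_lin (gmorph_gid _)).
  - by apply: gid_off => E; apply: ji; rewrite E.
  - apply: (gmorph_fil (gmorph_gid _)); rewrite -[p]addn0.
    by apply: tcat_fil => //; exact: fil_all.
have d0 : 0 = deg (fun _ : 'I_q => Tagged (fun d => A d) a) by rewrite /deg big1.
rewrite u0E (tcat_tn_deg _ erefl d0) addr0 gid_diag placeE; last exact: placing_pad.
rewrite /xsign ksign_mono ?scale1r.
  suff -> : osel a (@pad n q) X = hcat X (fun=> Tagged (fun d => A d) a) by [].
  by apply: hcat_fun => l; rewrite /osel /pad ?split_lshift ?split_rshift.
move=> l l' u v; rewrite /pad.
elim/split_ind: l => l; elim/split_ind: l' => l'; rewrite ?split_lshift ?split_rshift //.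
by move=> /ltnW ll [<-] [<-].
Qed.

(** The second factor is the identity, of degree 0, so [f] acts beside the appended copies of [a]
    without sign. *)
Lemma gtens_pad n m q e (f : gmap (T n) (T m)) : gmorph e f ->
  gcomp 0 (gtens e 0 f gid) (place (@pad n q)) = gcomp e (place (@pad m q)) f.
Proof.
move=> mf; have mg := gmorph_gtens mf (gmorph_gid (T q)).
have mn := gmorph_place T a (placing_pad n q).
have mm := gmorph_place T a (placing_pad m q).
apply: gmap_ext => i j x; rewrite /gcomp.
have [->|/eqP ji] := eqVneq j (i + e); last first.
  by rewrite [LHS](gmorph_off mg) ?[RHS](gmorph_off mm) ?addr0.
rewrite !padE gid_diag; set u := tn _ 0.
(* [gtensE] requires the target degree in exactly this form; the variable l stands for the
   propositionally equal degree that actually occurs. *)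
have key l : l = i + e + (0 + 0) -> gtens e 0 f gid (i + 0) l (tcat x u) =
    gid (i + e + 0) l (tcat (f i (i + e) x) u).
  move=> ->; rewrite gtensE //; last exact: gmorph_gid.
  by rewrite mul0r scale1r !gid_diag.
by apply: key; rewrite !addr0.
Qed.

Section PlugWiring.
Variables (m1 n1 m n : nat) (w : wiring m1 n1 1 0 m n).

Lemma wiring10_tout : exists i, w (bin i) = tout ord0.
Proof.
have /and5P[_ _ _ _ /andP[_ /existsP[i Hi]]] := wmapP w; exists i.
by case: (w (bin i)) Hi => [|[|l]] // _; rewrite (ord1 l).
Qed.

(** The only output of the top vertex is used up by the internal edge that connectedness
    requires. *)
Lemma wiring10_bout o : exists j, w (gout o) = bout j.
Proof.
have [//|[l E]] := gout_cases w o; have [i Ei] := wiring10_tout.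
by move: Ei; rewrite [ord0](esym (ord1 l) : ord0 = l) -E => /wiring_inj.
Qed.

Lemma wiring10_outs : m1 = m.
Proof.
pose s o := projT1 (cid (wiring10_bout o)).
have Es o : w (gout o) = bout (s o) by rewrite /s; case: cid.
have s_inj : injective s.
  by move=> o o' E; have := Es o; rewrite E -Es => /wiring_inj[].
apply/eqP; rewrite eqn_leq; apply/andP; split; last first.
  by have := leq_card s s_inj; rewrite !card_ord.
have t_ex j : exists o, w (gout o) = bout j.
  have [[o|[i|i]] E] := wiring_surj w (bout j); first by exists o.
    by case: (bin_bout E).
  by case: i {E}.
pose t j := projT1 (cid (t_ex j)).
have Et j : w (gout (t j)) = bout j by rewrite /t; case: cid.
have t_inj : injective t.
  by move=> j j' E; have := Et j; rewrite E Et => -[].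
by have := leq_card t t_inj; rewrite !card_ord.
Qed.

(** A wiring is a bijection between m + n1 sinks and n + m1 + 1 sources, and m1 = m. *)
Lemma wiring10_ins : n1 = n.+1.
Proof.
have wb : bijective w.
  exists (fun s => projT1 (cid (wiring_surj w s))) => [x|s]; last by case: cid.
  by case: cid => y /= /wiring_inj.
have := bij_eq_card wb; rewrite !card_sum !card_ord addn0 wiring10_outs.
by rewrite (addnCA n) addn1 => /addnI.
Qed.

End PlugWiring.

Lemma plug_gout m n (i : 'I_n.+1) o : plug m i (gout o) = bout o.
Proof. by rewrite /plug /= ffunE. Qed.

Lemma plug_bin m n (i : 'I_n.+1) j :
  plug m i (bin j) = if unlift i j is Some j' then gin j' else tout ord0.
Proof. by rewrite /plug /= ffunE. Qed.

(** A graph with a top vertex of arity (1,0) is determined by the labels of its bottom vertex, so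
    relabelling that vertex alone reaches all of them. This is what lets equivariance identify their
    contributions. *)
Lemma plug_relabels m n (w : wiring m n.+1 1 0 m n) :
  exists (s : 'S_m) (t : 'S_n.+1), relabels 1%g 1%g s t 1%g 1%g (plug m (ord0 : 'I_n.+1)) w.
Proof.
pose s o := projT1 (cid (wiring10_bout w o)).
have Es o : w (gout o) = bout (s o) by rewrite /s; case: cid.
have s_inj : injective s.
  by move=> o o' E; have := Es o; rewrite E -Es => /wiring_inj[].
pose t i : 'I_n.+1 := if w (bin i) is inl j then lift ord0 j else ord0.
have t_inj : injective t.
  move=> i i'; rewrite /t.
  case: (bin_cases w i) (bin_cases w i') => -[j Ej] [] [j' Ej'];
    rewrite Ej Ej' //=.
  - by move/lift_inj => E; move: Ej; rewrite E -Ej' => /wiring_inj[].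
  - by move=> _; move: Ej; rewrite [j](etrans (ord1 j) (esym (ord1 j'))) -Ej' => /wiring_inj[].
exists (perm s_inj), (perm t_inj); apply/forallP => -[o|[i|[]//]]; apply/eqP.
  by rewrite plug_gout /= permE Es perm1.
rewrite -[inr (inl i)]/(bin i) plug_bin permE /t.
have [[j Ej]|[j Ej]] := bin_cases w i; rewrite Ej /=.
  by rewrite liftK /= perm1.
by rewrite unlift_none /= perm1 (ord1 j).
Qed.

Lemma unlift_placing n (i : 'I_n.+1) : placing (unlift i).
Proof.
exists (lift i); split=> [u|j u]; first exact: liftK.
by case: unliftP => [v ->|] // -[->].
Qed.

Lemma placing_perm n (t : 'S_n) : placing (Some \o t).
Proof. by apply: placing_bij; exact: (Bijective (permK t) (permKV t)). Qed.

Lemma end_comp_insert m n (w : wiring m n.+1 1 0 m n) (s : 'S_m) (t : 'S_n.+1)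
    e (f : gmap (T n.+1) (T m)) : gmorph e f ->
  relabels 1%g 1%g s t 1%g 1%g (plug m (ord0 : 'I_n.+1)) w ->
  end_comp w e 0 f (insert 1 a) =
  gcomp e (reorder s) (gcomp 0 f (place (unlift (ord0 : 'I_n.+1) \o t))).
Proof.
move=> mf /forallP ww.
have Eg o : w (gout o) = bout (s o).
  by have /eqP -> := ww (gout o); rewrite /= ffunE /= perm1.
have Eb i : w (bin i) = if unlift ord0 (t i) is Some j then gin j else tout ord0.
  have /eqP -> := ww (bin i); rewrite /= plug_bin.
  by case: (unlift _ _) => [j|] /=; rewrite perm1.
set r := unlift ord0 \o t.
have pt : placing r by have := placing_obind (unlift_placing ord0) (placing_perm t).
have pa : placing (fun _ : 'I_(1 + 0) => None : option 'I_0).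
  by have := placing_pad 0 1; congr placing; apply/funext => l; rewrite /pad; case: split => // -[].
have -> : insert 1 a = place (fun _ : 'I_(1 + 0) => None : option 'I_0).
  rewrite insertE; congr (place_map a _); apply/funext => l.
  by case: split => // -[].
(* The set [ext_out w] is empty, but its cardinal is not convertible to 0; [pad] keeps track of the
   corresponding trivial tensor factor until the output order removes it. *)
have mid : gcomp 0 (reorder (mid_order w)) (gcomp 0 (gtens 0 0 gid
     (place (fun _ : 'I_(1 + 0) => None : option 'I_0))) (reorder (in_order w))) =
   gcomp 0 (place (@pad n.+1 #|ext_out w|)) (place r).
  rewrite -(place_id T a) gtens_place //; last exact: placing_id.
  rewrite !(reorderE T a); try exact: placing_mid_order; try exact: placing_in_order.
  have pi := placing_in_order w; have po := placing_osum (@placing_id #|ext_in w|) pa.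
  rewrite (place_comp T a pi po) (place_comp T a (placing_obind pi po) (placing_mid_order w)).
  rewrite (place_comp T a pt (placing_pad _ _)).
  congr (place_map a _); apply/funext => l /=; elim/split_ind: l => i; last first.
    have [o] := ext_out_tout (enum_valP i).
    by rewrite Eg.
  rewrite /pad split_lshift /= /r /=; have := Eb i.
  case: (unlift _ _) => [j|] Ei.
    have [l -> El] := mid_order_ext Ei; rewrite /= osum_lshift /=.
    by move: Ei; rewrite -El in_order_bin => -[->].
  by rewrite (mid_order_int Ei) /= osum_rshift.
rewrite /end_comp mid -(gcompA0 0 (gtens e 0 f gid)) gtens_pad // gcompA0 addr0.
have ps := placing_perm s; have po := placing_out_order w.
rewrite -(gcomp0A e (reorder (out_order w))) (reorderE T a ps) (reorderE T a po).
rewrite (place_comp T a (placing_pad _ _) po).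
congr (gcomp e (place_map a _) _); apply/funext => o /=.
by rewrite (out_order_bout (Eg o)) /pad split_lshift.
Qed.

End EndCompInsert.

(** * Adding an input to a two-vertex graph *)

Section AddInput.
Variables (m1 m2 m n : nat).

Definition lift_source (s : source m1 m2 n) : source m1 m2 n.+1 :=
  match s with inl j => gin (lift ord0 j) | inr x => inr x end.

Lemma lift_source_inj : injective lift_source.
Proof.
case=> [j|s] [j'|s'] //= E; last by case: E => ->.
have /lift_inj -> // : lift ord0 j = lift ord0 j'.
exact: (congr1 (fun s => if s is inl x then x else ord0) E).
Qed.

Lemma lift_source_neq s : lift_source s <> gin ord0.
Proof. by case: s. Qed.

Lemma lift_sourceP s : s <> gin ord0 -> exists s', lift_source s' = s.
Proof.
case: s => [j|x]; last by exists (inr x).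
by case: (unliftP ord0 j) => [j' ->|->] // _; exists (gin j').
Qed.

(* Graphs with a marked sink z, attached to the first global input, correspond
   to graphs without that sink and that global input. *)
Section AddSink.
Variables (n1 n1' n2 n2' : nat).
Variables (d : sink n1' n2' m -> option (sink n1 n2 m))
  (d' : sink n1 n2 m -> sink n1' n2' m) (z : sink n1' n2' m).
Hypotheses (dd' : forall y, d (d' y) = Some y)
  (d'd : forall x y, d x = Some y -> x = d' y)
  (dz : d z = None) (zd : forall x, d x = None -> x = z)
  (d'_gout : forall o, d' (gout o) = gout o)
  (d'_bin : forall i, exists i', d' (bin i) = bin i')
  (d'_tin : forall i, exists i', d' (tin i) = tin i').

Definition add_fun (w : wiring m1 n1 m2 n2 m n) :
    {ffun sink n1' n2' m -> source m1 m2 n.+1} :=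
  [ffun x => if d x is Some y then lift_source (w y) else gin ord0].

Lemma add_ok (w : wiring m1 n1 m2 n2 m n) : wiring_ok (add_fun w).
Proof.
apply/and5P; split; last (apply/andP; split).
- apply/injectiveP => x x'; rewrite !ffunE.
  case E: (d x) => [y|]; case E': (d x') => [y'|].
  + by move=> /lift_source_inj/wiring_inj yy; rewrite (d'd E) (d'd E') yy.
  + by move/lift_source_neq.
  + by move/esym/lift_source_neq.
  + by rewrite (zd E) (zd E').
- apply/forallP => s; apply/codomP; have [->|/eqP] := eqVneq s (gin ord0).
    by exists z; rewrite ffunE dz.
  case/lift_sourceP => s' <-; have [y <-] := wiring_surj w s'.
  by exists (d' y); rewrite ffunE dd'.
- apply/forallP => i; rewrite ffunE; case E: (d _) => [y|] //.
  have := d'd E; case: y {E} => [o|[j|j]]; first by rewrite d'_gout.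
    by have [j' ->] := d'_bin j.
  by have [j' ->] := tin_ginP w j.
- apply/forallP => i; rewrite ffunE; case E: (d _) => [y|] //.
  have := d'd E; case: y {E} => [o|[j|j]]; first by rewrite d'_gout.
    by have [[j' ->]|[j' ->]] := bin_cases w j.
  by have [j' ->] := d'_tin j.
- by apply/forallP => o; rewrite ffunE -d'_gout dd'; have [[j ->]|[j ->]] := gout_cases w o.
- have /and5P[_ _ _ _ /andP[_ /existsP[i Hi]]] := wmapP w.
  have [i' Ei] := d'_bin i; apply/existsP; exists i'; rewrite ffunE -Ei dd'.
  by case: (w (bin i)) Hi => [|[]].
Qed.

Definition add_wiring w : wiring m1 n1' m2 n2' m n.+1 := Wiring (add_ok w).

Lemma add_wiringE w x :
  add_wiring w x = if d x is Some y then lift_source (w y) else gin ord0.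
Proof. by rewrite /add_wiring /= ffunE. Qed.

Lemma add_wiring_inj : injective add_wiring.
Proof.
move=> w w' E; apply: val_inj; apply/ffunP => y.
have := congr1 (fun w : wiring _ _ _ _ _ _ => w (d' y)) E.
by rewrite /= !ffunE dd' => /lift_source_inj.
Qed.

Lemma add_wiring_surj (w : wiring m1 n1' m2 n2' m n.+1) :
  w z = gin ord0 -> exists w', w = add_wiring w'.
Proof.
move=> wz; have ex y : exists s, lift_source s = w (d' y).
  apply: lift_sourceP => E; have /wiring_inj Ez : w (d' y) = w z by rewrite E wz.
  by have := dd' y; rewrite Ez dz.
pose f : {ffun sink n1 n2 m -> source m1 m2 n} := [ffun y => projT1 (cid (ex y))].
have fE y : lift_source (f y) = w (d' y) by rewrite ffunE; case: cid.
have f_ok : wiring_ok f.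
  apply/and5P; split; last (apply/andP; split).
  - apply/injectiveP => y y' E; have /wiring_inj E' : w (d' y) = w (d' y') by rewrite -!fE E.
    by have := dd' y; rewrite E' dd' => -[].
  - apply/forallP => s; apply/codomP; have [x Ex] := wiring_surj w (lift_source s).
    case E: (d x) => [y|]; last first.
      by move: Ex; rewrite (zd E) wz => /esym/lift_source_neq.
    by exists y; apply: lift_source_inj; rewrite fE -(d'd E) Ex.
  - apply/forallP => i; have := fE (tin i); have [i' ->] := d'_tin i.
    by have [j ->] := tin_ginP w i'; case: (f _).
  - apply/forallP => i; have := fE (bin i); have [i' ->] := d'_bin i.
    by have [[j ->]|[j ->]] := bin_cases w i'; case: (f _) => [|[]].
  - apply/forallP => o; have := fE (gout o); rewrite d'_gout.
    by have [[j ->]|[j ->]] := gout_cases w o; case: (f _).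
  (* An internal edge survives the removal of [z], because [z] is joined to a global input. *)
  - have /and5P[_ _ _ _ /andP[_ /existsP[i Hi]]] := wmapP w.
    have Ei : d (bin i) != None.
      by apply: contraTneq Hi => /zd ->; rewrite wz.
    case E: (d (bin i)) Ei => [y|] // _; have := d'd E.
    case: y {E} => [o|[j|j]].
    + by rewrite d'_gout.
    + move=> Ej; apply/existsP; exists j; have := fE (bin j).
      by rewrite -[inr (inl j)]/(bin j) in Ej; rewrite -Ej; case: (w (bin i)) Hi => [|[|]] //; case: (f _) => [|[]].
    + by have [j' ->] := d'_tin j.
exists (Wiring f_ok); apply: val_inj; apply/ffunP => x.
rewrite /= [RHS]ffunE; case E: (d x) => [y|]; last by rewrite (zd E).
by rewrite -[LHS]/(w x) (d'd E) -fE.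
Qed.

Lemma sum_add_wiring (V : nmodType) (F : wiring m1 n1' m2 n2' m n.+1 -> V) :
  \sum_(w : wiring m1 n1' m2 n2' m n.+1 | w z == gin ord0) F w =
  \sum_(w : wiring m1 n1 m2 n2 m n) F (add_wiring w).
Proof.
rewrite -(big_imset F (h := add_wiring) (A := predT)) => [|w w' _ _]; last first.
  exact: add_wiring_inj.
apply: eq_bigl => w; apply/eqP/imsetP => [/add_wiring_surj[w' ->]|[w' _ ->]].
  by exists w'.
by rewrite add_wiringE dz.
Qed.

End AddSink.

Section Bottom.
Variables (n1 n2 : nat) (i : 'I_n1.+1).
Definition bin_down (x : sink n1.+1 n2 m) : option (sink n1 n2 m) :=
  match x with
  | inl o => Some (gout o)
  | inr (inl j) => omap bin (unlift i j)
  | inr (inr j) => Some (tin j)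
  end.
Definition bin_up (x : sink n1 n2 m) : sink n1.+1 n2 m :=
  match x with
  | inl o => gout o
  | inr (inl j) => bin (lift i j)
  | inr (inr j) => tin j
  end.
Lemma bin_upK y : bin_down (bin_up y) = Some y.
Proof. by case: y => [|[]] //= j; rewrite liftK. Qed.
Lemma bin_downK x y : bin_down x = Some y -> x = bin_up y.
Proof.
case: x => [o|[j|j]] /=; [by case=> <- | | by case=> <-].
by case: unliftP => [j' ->|] //= [<-].
Qed.
Lemma bin_down_mark : bin_down (bin i) = None.
Proof. by rewrite /= unlift_none. Qed.
Lemma bin_down_None x : bin_down x = None -> x = bin i.
Proof. by case: x => [|[j|]] //=; case: unliftP => [|->]. Qed.

(** [locked] prevents simplification from unfolding the wiring; its values are read off with
    [add_binE]. *)
Definition add_bin (w : wiring m1 n1 m2 n2 m n) : wiring m1 n1.+1 m2 n2 m n.+1 :=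
  locked (add_wiring bin_upK bin_downK bin_down_mark bin_down_None (fun=> erefl)
    (fun j => ex_intro _ (lift i j) erefl) (fun j => ex_intro _ j erefl) w).

Lemma add_binE w x :
  add_bin w x = if bin_down x is Some y then lift_source (w y) else gin ord0.
Proof. by rewrite /add_bin -lock add_wiringE. Qed.

Lemma sum_add_bin (V : nmodType) (F : wiring m1 n1.+1 m2 n2 m n.+1 -> V) :
  \sum_(w : wiring m1 n1.+1 m2 n2 m n.+1 | w (bin i) == gin ord0) F w =
  \sum_(w : wiring m1 n1 m2 n2 m n) F (add_bin w).
Proof. by rewrite /add_bin; unlock; exact: sum_add_wiring. Qed.

(** The side condition of [pcomp_tops], with the unit and the top vertex both sitting above the
    bottom vertex. *)
Lemma nest_add_bin (w : wiring m1 n1 m2 n2 m n) l :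
  nest_bot (plug m ord0) (add_bin w) l =
  omap swapBC (nest_bot w (plug m1 i) (swapBC l)).
Proof.
have Pg o : plug m (ord0 : 'I_n.+1) (gout o) = bout o by rewrite plug_gout.
have Pb j : plug m (ord0 : 'I_n.+1) (bin (lift ord0 j)) = gin j by rewrite plug_bin liftK.
have P0 : plug m (ord0 : 'I_n.+1) (bin ord0) = tout ord0 by rewrite plug_bin unlift_none.
move: (plug m _) Pg Pb P0 => P Pg Pb P0.
have Qg o : plug m1 i (gout o) = bout o by rewrite plug_gout.
have Qb j := plug_bin m1 i j; move: (plug m1 _) Qg Qb => q Qg Qb.
case: l => [o|[j|[j|[]//]]]; rewrite /= ?Pg /= ?Qb ?add_binE /=.
- by have [[j ->]|[j ->]] := gout_cases w o; rewrite /= ?Qg.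
- case: (unlift i j) => [j'|] /=; last by rewrite P0.
  by have [[l ->]|[l ->]] := bin_cases w j'; rewrite /= ?Pb.
- by have [l ->] := tin_ginP w j; rewrite /= Pb.
Qed.

End Bottom.

Section Top.
Variables (n1 n2 : nat) (i : 'I_n2.+1).
Definition tin_down (x : sink n1 n2.+1 m) : option (sink n1 n2 m) :=
  match x with
  | inl o => Some (gout o)
  | inr (inl j) => Some (bin j)
  | inr (inr j) => omap tin (unlift i j)
  end.
Definition tin_up (x : sink n1 n2 m) : sink n1 n2.+1 m :=
  match x with
  | inl o => gout o
  | inr (inl j) => bin j
  | inr (inr j) => tin (lift i j)
  end.
Lemma tin_upK y : tin_down (tin_up y) = Some y.
Proof. by case: y => [|[]] //= j; rewrite liftK. Qed.
Lemma tin_downK x y : tin_down x = Some y -> x = tin_up y.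
Proof.
case: x => [o|[j|j]] /=; [by case=> <- | by case=> <- | ].
by case: unliftP => [j' ->|] //= [<-].
Qed.
Lemma tin_down_mark : tin_down (tin i) = None.
Proof. by rewrite /= unlift_none. Qed.
Lemma tin_down_None x : tin_down x = None -> x = tin i.
Proof. by case: x => [|[|j]] //=; case: unliftP => [|->]. Qed.

Definition add_tin (w : wiring m1 n1 m2 n2 m n) : wiring m1 n1 m2 n2.+1 m n.+1 :=
  locked (add_wiring tin_upK tin_downK tin_down_mark tin_down_None (fun=> erefl)
    (fun j => ex_intro _ j erefl) (fun j => ex_intro _ (lift i j) erefl) w).

Lemma add_tinE w x :
  add_tin w x = if tin_down x is Some y then lift_source (w y) else gin ord0.
Proof. by rewrite /add_tin -lock add_wiringE. Qed.

Lemma sum_add_tin (V : nmodType) (F : wiring m1 n1 m2 n2.+1 m n.+1 -> V) :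
  \sum_(w : wiring m1 n1 m2 n2.+1 m n.+1 | w (tin i) == gin ord0) F w =
  \sum_(w : wiring m1 n1 m2 n2 m n) F (add_tin w).
Proof. by rewrite /add_tin; unlock; exact: sum_add_wiring. Qed.

(** The side condition of [pcomp_chain]: the unit sits above the top vertex. *)
Lemma nest_add_tin (w : wiring m1 n1 m2 n2 m n) :
  nest_bot (plug m ord0) (add_tin w) =1 nest_top w (plug m2 i).
Proof.
have Pg o : plug m (ord0 : 'I_n.+1) (gout o) = bout o by rewrite plug_gout.
have Pb j : plug m (ord0 : 'I_n.+1) (bin (lift ord0 j)) = gin j by rewrite plug_bin liftK.
have P0 : plug m (ord0 : 'I_n.+1) (bin ord0) = tout ord0 by rewrite plug_bin unlift_none.
move: (plug m _) Pg Pb P0 => P Pg Pb P0.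
have Qg o : plug m2 i (gout o) = bout o by rewrite plug_gout.
have Qb j := plug_bin m2 i j; move: (plug m2 _) Qg Qb => q Qg Qb.
case=> [o|[j|[j|[]//]]]; rewrite /= ?Pg /= ?Qb ?add_tinE /=.
- by have [[j ->]|[j ->]] := gout_cases w o; rewrite /= ?Qg.
- by have [[l ->]|[l ->]] := bin_cases w j; rewrite /= ?Pb ?Qg.
- case: (unlift i j) => [j'|] /=; last by rewrite P0.
  by have [l ->] := tin_ginP w j'; rewrite /= Pb.
Qed.

End Top.

(** The first global input is attached to exactly one sink, and this sink cannot be a global output.
    The two sums are the two terms of the Leibniz rule. *)
Lemma sum_first_input n1 n2 (V : nmodType) (F : wiring m1 n1 m2 n2 m n.+1 -> V) :
  \sum_(w : wiring m1 n1 m2 n2 m n.+1) F w =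
  \sum_(i : 'I_n1) \sum_(w : wiring m1 n1 m2 n2 m n.+1 | w (bin i) == gin ord0) F w +
  \sum_(i : 'I_n2) \sum_(w : wiring m1 n1 m2 n2 m n.+1 | w (tin i) == gin ord0) F w.
Proof.
have one (w : wiring m1 n1 m2 n2 m n.+1) :
    F w = \sum_(x : sink n1 n2 m | w x == gin ord0) F w.
  have [x Ex] := wiring_surj w (gin ord0).
  rewrite (big_pred1 x) // => y; rewrite -Ex; exact: (inj_eq (@wiring_inj _ _ _ _ _ _ w)).
under eq_bigr => w _ do rewrite one big_mkcond.
rewrite exchange_big /= big_sumType /= big1 ?add0r => [|o _]; last first.
  by apply: big1 => w _; case: eqP => // /gout_gin.
rewrite big_sumType /=.
by congr (_ + _); apply: eq_bigr => i _; rewrite -big_mkcond.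
Qed.

End AddInput.

Section AddedInputs.
Variables (k : fieldType) (A : cmod k) (T : tensor_powers A) (a : A 0).
Local Notation place := (@place_map k A T a _ _).

Lemma insert1E n : insert 1 a = place (unlift (ord0 : 'I_n.+1)).
Proof.
rewrite insertE; congr (place_map a _); apply/funext; apply: split_ind => i.
  by rewrite split_lshift; case: unliftP => // j Ej; rewrite (ord1 i) in Ej.
rewrite split_rshift; suff -> : rshift 1 i = lift ord0 i by rewrite liftK.
exact: val_inj.
Qed.

(** The case of [end_comp_place] where a single input of the bottom vertex is filled and the top
    vertex is left alone. *)
Lemma end_comp_add_bin m1 n1 m2 n2 m n (w : wiring m1 n1 m2 n2 m n) (i : 'I_n1.+1)
    e1 e2 (f : gmap (T n1.+1) (T m1)) (g : gmap (T n2) (T m2)) :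
  gmorph e1 f -> gmorph e2 g ->
  gcomp 0 (end_comp (add_bin i w) e1 e2 f g) (place (unlift ord0)) =
  end_comp w e1 e2 (gcomp 0 f (place (unlift i))) g.
Proof.
move=> mf mg.
rewrite (@end_comp_place _ _ _ a _ _ _ _ _ _ _ _ _ _ w _ (unlift i) (@Some _)) //.
- by rewrite place_id gcomp_idr.
- exact: unlift_placing.
- exact: unlift_placing.
- exact: placing_id.
- move=> o j; rewrite add_binE /=.
  by have [[j' ->]|[j' ->]] := gout_cases w o => //= -[->].
- move=> o j; rewrite add_binE /=.
  by have [[j' ->]|[j' ->]] := gout_cases w o => //= -[->].
- move=> j l; rewrite add_binE /=; case: (unlift i j) => [j'|] /=; last first.
    by move=> [<-]; rewrite unlift_none.
  have [[l' ->]|[l' ->]] := bin_cases w j' => //= -[<-].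
  by exists l'; rewrite ?liftK.
- move=> j l; rewrite add_binE /=; case: (unlift i j) => [j'|] //=.
  have [[l' E]|[l' E]] := bin_cases w j'; rewrite E //= => -[<-].
  by exists j'.
- move=> j l; rewrite add_binE /=; have [l' ->] := tin_ginP w j => /= -[<-].
  by exists l'; rewrite ?liftK.
Qed.

Lemma end_comp_add_tin m1 n1 m2 n2 m n (w : wiring m1 n1 m2 n2 m n) (i : 'I_n2.+1)
    e1 e2 (f : gmap (T n1) (T m1)) (g : gmap (T n2.+1) (T m2)) :
  gmorph e1 f -> gmorph e2 g ->
  gcomp 0 (end_comp (add_tin i w) e1 e2 f g) (place (unlift ord0)) =
  end_comp w e1 e2 f (gcomp 0 g (place (unlift i))).
Proof.
move=> mf mg.
rewrite (@end_comp_place _ _ _ a _ _ _ _ _ _ _ _ _ _ w _ (@Some _) (unlift i)) //.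
- by rewrite place_id gcomp_idr.
- exact: unlift_placing.
- exact: placing_id.
- exact: unlift_placing.
- move=> o j; rewrite add_tinE /=.
  by have [[j' ->]|[j' ->]] := gout_cases w o => //= -[->].
- move=> o j; rewrite add_tinE /=.
  by have [[j' ->]|[j' ->]] := gout_cases w o => //= -[->].
- move=> j l; rewrite add_tinE /=.
  have [[l' ->]|[l' ->]] := bin_cases w j => //= -[<-].
  by exists l'; rewrite ?liftK.
- move=> j l; rewrite add_tinE /=.
  have [[l' E]|[l' E]] := bin_cases w j; rewrite E //= => -[<-].
  by exists j.
- move=> j l; rewrite add_tinE /=; case: (unlift i j) => [j'|] /=; last first.
    by move=> [<-]; rewrite unlift_none.
  have [l' ->] := tin_ginP w j' => /= -[<-].
  by exists l'; rewrite ?liftK.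
Qed.

End AddedInputs.

(** * Counting the graphs whose top vertex has arity (1,0) *)

Section PlugCount.
Variables m n : nat.

Definition relabelled_plug_fun (st : 'S_m * 'S_n.+1) :
    {ffun sink n.+1 0 m -> source m 1 n} :=
  [ffun x => match x with
             | inl o => bout (st.1 o)
             | inr (inl i) => if unlift ord0 (st.2 i) is Some j then gin j else tout ord0
             | inr (inr i) => tout ord0
             end].

Lemma relabelled_plug_ok st : wiring_ok (relabelled_plug_fun st).
Proof.
apply/and5P; split; last (apply/andP; split).
- apply/injectiveP => -[o|[j|[]//]] [o'|[j'|[]//]]; rewrite !ffunE //=.
  + by case=> /perm_inj ->.
  + by case: unlift.
  + by case: unlift.
  + case: unliftP => [l El|El]; case: unliftP => [l' El'|El'] // E;
      congr (inr (inl _)); apply: (@perm_inj _ st.2); rewrite El El' //.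
    by case: E => ->.
- apply/forallP => -[j|[o|o]]; apply/codomP.
  + by exists (bin (st.2^-1%g (lift ord0 j))); rewrite ffunE /= permKV liftK.
  + by exists (gout (st.1^-1%g o)); rewrite ffunE /= permKV.
  + by exists (bin (st.2^-1%g ord0)); rewrite ffunE /= permKV unlift_none (ord1 o).
- by apply/forallP => -[].
- by apply/forallP => j; rewrite ffunE /=; case: unlift.
- by apply/forallP => o; rewrite ffunE.
- by apply/existsP; exists (st.2^-1%g ord0); rewrite ffunE /= permKV unlift_none.
Qed.

Definition relabelled_plug st : wiring m n.+1 1 0 m n := Wiring (relabelled_plug_ok st).

(** With a single internal edge there are no automorphisms, so the relabellings by pairs of
    permutations are distinct, and they exhaust all wirings. The number is the normalisation by
    which [star] divides. *)
Lemma card_wiring_plug : #|{: wiring m n.+1 1 0 m n}| = (m`! * n.+1`!)%N.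
Proof.
rewrite -!card_Sn -card_prod; apply/esym/(@bij_eq_card _ _ relabelled_plug).
apply: inj_card_bij.
  move=> [s t] [s' t'] E; have Ex x := congr1 (fun w : wiring _ _ _ _ _ _ => w x) E.
  congr pair; apply/permP => i.
    by have := Ex (gout i); rewrite /= !ffunE /= => -[].
  have := Ex (bin i); rewrite /= !ffunE /=.
  case: unliftP => [l ->|->]; case: unliftP => [l' ->|->] //.
  by case=> ->.
have surj w : exists st, relabelled_plug st = w.
  have [s [t /forallP wE]] := plug_relabels w; exists (s, t); apply: val_inj.
  apply/ffunP => -[o|[i|[]//]].
    by rewrite /= ffunE /= (eqP (wE (gout o))) plug_gout /= perm1.
  rewrite /= ffunE /= (eqP (wE (bin i))) plug_bin.
  by case: unlift => [j|] /=; rewrite perm1.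
pose g w := projT1 (cid (surj w)).
have gK : cancel g relabelled_plug by move=> w; rewrite /g; case: cid.
exact: leq_card (can_inj gK).
Qed.

End PlugCount.

(** * Finite sums of tensors as bilinear forms *)

Section Bilinear.
Variables (k : fieldType) (V W X : lmodType k) (B : dual V -> dual W -> X).
Hypotheses (B_linl : forall c f f' g, B (c *: f + f') g = c *: B f g + B f' g)
  (B_linr : forall c f g g', B f (c *: g + g') = c *: B f g + B f g').

(* The tensor product of dual spaces embeds in the space of bilinear forms. *)
Lemma bilinear_sum0 (l : seq (dual V * dual W)) :
  (forall x y, \sum_(p <- l) p.1 x * p.2 y = 0 :> k) ->
  \sum_(p <- l) B p.1 p.2 = 0.
Proof.
have [s] := ubnP (size l); elim: s l => // s IH [|[p1 p2] l] /=; first by rewrite big_nil.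
rewrite ltnS => ls H; have [p20|] := pselect (forall y, p2 y = 0 :> k).
  have -> : p2 = 0 by exact: dual_ext.
  have Bp0 : B p1 0 = 0 by exact: (lin_zero (fun c g g' => B_linr c p1 g g')).
  rewrite big_cons /= Bp0 add0r; apply: IH => // x y.
  by have := H x y; rewrite big_cons /= p20 mulr0 add0r.
move=> /existsNP[y0 /eqP p2y0].
(* Evaluation at [y0] expresses [p1] through the other first factors. Substituting it shortens the
   sum: the pair q becomes (q.1, q.2 - c q p2), to which the induction hypothesis applies. *)
pose c (q : dual V * dual W) : k := q.2 y0 / p2 y0.
have p1E : p1 = - \sum_(q <- l) c q *: q.1.
  apply: dual_ext => x; have := H x y0; rewrite big_cons /=.
  move=> /(canRL (addrK _)); rewrite sub0r => /(canRL (mulfK p2y0)) ->.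
  rewrite mulNr; congr (- _).
  have -> : (\sum_(q <- l) c q *: q.1 : dual V) x = \sum_(q <- l) c q * q.1 x.
    by elim/big_ind2: _ => // f f' g g' Ef Eg; rewrite -Ef -Eg.
  by rewrite mulr_suml; apply: eq_bigr => q _; rewrite /c [RHS]mulrC mulrA.
have := IH [seq (q.1, q.2 - c q *: p2) | q <- l].
rewrite size_map => /(_ ls); rewrite !big_map /= => H'.
have Bl g := fun c f f' => B_linl c f f' g.
rewrite big_cons /= p1E -scaleN1r (lin_scale (Bl p2)) (lin_sum (Bl p2)) scaleN1r.
rewrite -sumrN -big_split /= -[RHS]H' => [|x y].
  apply: eq_bigr => q _; rewrite (lin_scale (Bl p2)) addrC -scaleNr addrC.
  by rewrite [q.2 - _]addrC -scaleNr B_linr.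
rewrite big_map /=; have := H x y; rewrite big_cons /= p1E.
have -> : (- \sum_(q <- l) c q *: q.1 : dual V) x = - \sum_(q <- l) c q * q.1 x.
  congr (- _).
  by elim/big_ind2: _ => // f f' g g' Ef Eg; rewrite -Ef -Eg.
move=> E0; rewrite -[RHS]E0 mulNr mulr_suml -sumrN -big_split /=; apply: eq_bigr => q _.
by rewrite mulrBr mulrA [q.1 x * c q]mulrC addrC.
Qed.

Lemma bilinear_sum_eq (l l' : seq (dual V * dual W)) :
  (forall x y, \sum_(p <- l) p.1 x * p.2 y = \sum_(p <- l') p.1 x * p.2 y :> k) ->
  \sum_(p <- l) B p.1 p.2 = \sum_(p <- l') B p.1 p.2.
Proof.
move=> H; apply/eqP; rewrite -subr_eq0; apply/eqP.
have := @bilinear_sum0 (l ++ [seq (- p.1, p.2) | p <- l']).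
have BN f g : B (- f) g = - B f g.
  by rewrite -[- f]scaleN1r (lin_scale (fun c f f' => B_linl c f f' g)) scaleN1r.
rewrite big_cat big_map /=; under [X in _ + X]eq_bigr do rewrite BN.
rewrite sumrN; apply=> x y; rewrite big_cat big_map /= H.
by under [X in _ + X]eq_bigr do rewrite mulNr; rewrite sumrN subrr.
Qed.

End Bilinear.

Lemma sum_support (I : eqType) (V : nmodType) (L S : seq I) (F : I -> V) :
  uniq L -> uniq S -> {subset S <= L} -> (forall x, x \notin S -> F x = 0) ->
  \sum_(x <- L) F x = \sum_(x <- S) F x.
Proof.
move=> uL uS SL F0; rewrite (bigID (mem S)) /= [X in _ + X]big1 ?addr0 => [|x]; last exact: F0.
rewrite -big_filter; apply: perm_big; apply: uniq_perm => //; first exact: filter_uniq.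
by move=> x; rewrite mem_filter; apply/andP/idP => [[]|xS] //; split=> //; exact: SL.
Qed.

(** * Plugging a in the convolution algebra *)

Arguments star {k A T Q} e1 e2 f g d m n phi i j x : rename.
Arguments elt_conv {k A T Q} u a d m n phi i j x : rename.
Arguments cscale {k A T Q} c f d m n phi i j x : rename.
Arguments cadd {k A T Q} f g d m n phi i j x : rename.
Arguments czero {k A T Q} d m n phi i j x : rename.
Arguments twist_term {k A T Q} u a f p d m n phi i j x : rename.
Arguments gauge_term {k A T Q} u a f p d m n phi i j x : rename.
Arguments bracket {k A T Q} e1 e2 f g d m n phi i j x : rename.
Arguments counit_conv {k A T Q} dA d m n phi i j x : rename.

Section Convolution.
Variables (k : fieldType) (A : cmod k) (T : tensor_powers A) (Q : properad k).
Local Notation conv := (conv T Q).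

Lemma conv_ext (f g : conv) : (forall d m n phi, f d m n phi = g d m n phi) -> f = g.
Proof.
move=> H; apply: functional_extensionality_dep => d.
apply: functional_extensionality_dep => m.
by apply: functional_extensionality_dep => n; apply/funext => phi.
Qed.

Lemma conv_eqE (f g : conv) : conv_eq f g <-> f = g.
Proof.
split=> [H|-> //]; apply: conv_ext => d m n phi.
by apply: gmap_ext => i j x; exact: H.
Qed.

Section ConvElt.
Variables (e : int) (f : conv).
Hypothesis fe : conv_elt e f.

Lemma conv_gmorph d m n (phi : gdual Q d m n) : gmorph (d + e) (f phi).
Proof. by case: fe. Qed.

Lemma conv_lin d m n c (phi psi : gdual Q d m n) :
  f (c *: phi + psi) = gadd (gscale c (f phi)) (f psi).
Proof. by apply: gmap_ext => i j x; case: fe. Qed.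

Lemma conv_act d m n s t (phi : gdual Q d m n) :
  f (sact s t phi) = end_act s t (f phi).
Proof. by apply: gmap_ext => i j x; case: fe. Qed.

End ConvElt.

Lemma end_actE m n (s : 'S_m) (t : 'S_n) e (f : gmap (T n) (T m)) : gmorph e f ->
  end_act s t f = gcomp e (reorder s) (gcomp 0 f (reorder t)).
Proof.
move=> mf; apply: gmap_ext => i j x; rewrite /end_act /gcomp addr0.
have [->//|/eqP ji] := eqVneq j (i + e).
have mr := gmorph_reorder T (0 : A 0) (placing_perm s) : gmorph 0 (reorder s : gmap (T m) (T m)).
by rewrite (gmorph_off mf) // (lin_zero (gmorph_lin mr _ _)) (gmorph_off mr) // addr0.
Qed.

Variables (u : Q 0 1%N 0%N) (a : A 0).
Local Notation place := (@place_map k A T a _ _).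

Lemma pshift_subproof d m n (i : 'I_n.+1) (phi : gdual Q d m n) :
  scalar (fun x : Q (- d) m n.+1 => (phi : dual _) (pcomp (addr0 (- d)) (plug m i) x u)).
Proof. by move=> c x y; rewrite pcomp_linl linearP. Qed.

Definition pshift d m n (i : 'I_n.+1) (phi : gdual Q d m n) : gdual Q d m n.+1 :=
  mkdual (pshift_subproof i phi).

Lemma pshift_lin d m n (i : 'I_n.+1) c (phi psi : gdual Q d m n) :
  pshift i (c *: phi + psi) = c *: pshift i phi + pshift i psi.
Proof. exact: dual_ext. Qed.

(* This operator is ad_{-a} (bracket_elt), and its iterates are the twist terms
   up to the factor 1/p! (twist_termE). *)
Definition plug_in (f : conv) : conv := fun d m n phi =>
  gcomp 0 (f d m n.+1 (pshift ord0 phi)) (insert 1 a).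

Lemma unlift_lift_perm n (i j l : 'I_n.+1) (t : 'S_n) :
  unlift j (lift_perm i j t l) = omap t (unlift i l).
Proof.
case: (unliftP i l) => [l' ->|->]; first by rewrite lift_perm_lift liftK.
by rewrite lift_perm_id unlift_none.
Qed.

(** An instance of [pcomp_act]: renumbering the inputs of x moves the unit from one input to
    another, and [lift_perm] is the permutation that does so and induces [t] on the other inputs. *)
Lemma plug_act d m n (i i' : 'I_n.+1) (s : 'S_m) (t : 'S_n) (x : Q d m n.+1) :
  pcomp (addr0 d) (plug m i') x u =
  sact s t (pcomp (addr0 d) (plug m i)
    (sact s^-1 (lift_perm i' i t^-1) x) u).
Proof.
rewrite -[in RHS](sact1 u); symmetry; apply: pcomp_act; apply/forallP.
case=> [o|[j|[]//]]; apply/eqP.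
  by rewrite plug_gout /= plug_gout permK.
rewrite -[inr (inl j)]/(bin j) !plug_bin unlift_lift_perm.
by case: unlift => [l|] /=; rewrite ?permKV ?perm1.
Qed.

Lemma pshift_act d m n s t (phi : gdual Q d m n) :
  pshift ord0 (sact s t phi) = sact s (lift_perm ord0 ord0 t) (pshift ord0 phi).
Proof.
apply: dual_ext => x /=; congr (phi _).
by rewrite (plug_act ord0 ord0 s t x) sactM mulVg mulgV sact1 -lift_permV.
Qed.

Lemma pshift_ord0 d m n (i : 'I_n.+1) (phi : gdual Q d m n) :
  pshift i phi = sact 1%g (lift_perm ord0 i 1) (pshift ord0 phi).
Proof.
apply: dual_ext => x /=; congr (phi _).
by rewrite (plug_act ord0 i 1 1 x) sact1 -lift_permV.
Qed.

Lemma reorder_place n n' (s : 'S_n) (r : 'I_n -> option 'I_n') : placing r ->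
  gcomp 0 (reorder s) (place r) = place (r \o s).
Proof.
move=> pr; rewrite (reorderE T a (placing_perm s)) place_comp //; exact: placing_perm.
Qed.

Lemma place_reorder n n' (s : 'S_n') (r : 'I_n -> option 'I_n') : placing r ->
  gcomp 0 (place r) (reorder s) = place (omap s \o r).
Proof.
move=> pr; rewrite (reorderE T a (placing_perm s)) place_comp //; exact: placing_perm.
Qed.

Lemma reorder1 n : reorder (1%g : 'S_n) = gid :> gmap (T n) (T n).
Proof.
rewrite (reorderE T a (placing_perm _)) -(place_id T a).
by congr (place_map a _); apply/funext => i /=; rewrite perm1.
Qed.

(** By equivariance of [f] the input at which the unit and [a] are plugged is immaterial, provided
    it is the same for both. The Leibniz rule needs every i, since [a] may arrive at any input of a
    vertex. *)
Lemma plug_inE e f d m n (i : 'I_n.+1) (phi : gdual Q d m n) : conv_elt e f ->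
  gcomp 0 (f d m n.+1 (pshift i phi)) (place (unlift i)) = plug_in f phi.
Proof.
move=> fe; rewrite pshift_ord0 (conv_act fe).
have mf := conv_gmorph fe (pshift ord0 phi).
rewrite (end_actE _ _ mf) reorder1 gcomp_idl; last first.
  have mr := gmorph_reorder T a (placing_perm (lift_perm ord0 i 1)) : gmorph 0 (reorder _ : gmap (T n.+1) (T n.+1)).
  by have := gmorph_gcomp mf mr; rewrite add0r.
rewrite gcompA0 reorder_place; last exact: unlift_placing.
rewrite /plug_in insert1E; congr (gcomp 0 _ (place_map a _)).
apply/funext => l /=; rewrite unlift_lift_perm.
by case: unlift => //= j; rewrite perm1.
Qed.

Lemma plug_in_elt e f : conv_elt e f -> conv_elt e (plug_in f).
Proof.
move=> fe; split=> [d m n phi|d m n c phi psi i j x|d m n s t phi i j x].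
- have := gmorph_gcomp (conv_gmorph fe (pshift ord0 phi)) (gmorph_place T a (unlift_placing ord0)).
  by rewrite add0r /plug_in insert1E.
- by rewrite /plug_in pshift_lin (conv_lin fe).
- have mi : gmorph 0 (insert 1 a : gmap (T n) (T n.+1)).
    by rewrite insert1E; apply/gmorph_place/unlift_placing.
  have mf := conv_gmorph fe (pshift ord0 phi).
  have ml : gmorph (d + e) (plug_in f phi).
    by have := gmorph_gcomp mf mi; rewrite add0r.
  rewrite {1}/plug_in pshift_act (conv_act fe) (end_actE _ _ mf) (end_actE _ _ ml).
  rewrite !gcompA0 /plug_in insert1E reorder_place; last exact: unlift_placing.
  rewrite place_reorder; last exact: unlift_placing.
  suff -> : unlift ord0 \o lift_perm ord0 ord0 t = omap t \o unlift ord0 by [].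
  by apply/funext => l /=; rewrite unlift_lift_perm.
Qed.

End Convolution.
Arguments plug_in {k A T Q} u a f d m n phi i j x : rename.

(** * The Leibniz rule for plugging a *)

Section Star.
Variables (k : fieldType) (A : cmod k) (T : tensor_powers A) (Q : properad k).
Hypothesis Qinf : inf_coproperad Q.
Local Notation conv := (conv T Q).

Lemma decompP d m n (phi : gdual Q d m n) : is_decomp phi (decomp phi).
Proof.
have [q Hq] := Qinf phi; rewrite /decomp; case: pselect => [e|[]]; last by exists q.
by case: cid.
Qed.

Lemma opp_deg (d1 d2 d : int) : d1 + d2 = d -> - d1 + - d2 = - d.
Proof. by move<-; rewrite opprD. Qed.

(** The right-hand side does not involve [q]: this is how two decompositions are compared. *)
Lemma decomp_pairing d m n (phi : gdual Q d m n) q (b t : prof)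
    (hd : pdeg b + pdeg t = d) (w : wiring_of b t m n)
    (x : Q (- pdeg b) (pouts b) (pins b)) (y : Q (- pdeg t) (pouts t) (pins t)) :
  is_decomp phi q ->
  \sum_(p <- gterms q hd w) (p.1 : dual _) x * (p.2 : dual _) y =
  sg k (pdeg t * pdeg b) * (phi : dual _) (pcomp (opp_deg hd) w x y).
Proof.
move=> Hq; rewrite (Hq _ _ hd) mulr_sumr; apply: eq_bigr => p _.
by rewrite !mulrA sg_sqr mul1r.
Qed.

Definition snorm (e2 : int) (b t : prof) : k :=
  (((pouts b)`! * (pins b)`! * (pouts t)`! * (pins t)`!)%N%:R)^-1
    * sg k (e2 * pdeg b).

Section Values.
Variables (e1 e2 : int).
Variables (f g : conv).

Definition vterm (b t : prof) m n (w : wiring_of b t m n) (p1 : at_prof (gdual Q) b)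
    (p2 : at_prof (gdual Q) t) : gmap (T n) (T m) :=
  end_comp w (pdeg b + e1) (pdeg t + e2) (f p1) (g p2).

Arguments vterm b t {m n} w p1 p2 i j x : rename.

Definition vsum d m n (q : gsum (gdual Q) d m n) i j (x : T n i) b t h w : T m j :=
  \sum_(p <- gterms q h w) vterm b t w p.1 p.2 i j x.

Definition star_part d m n (q : gsum (gdual Q) d m n) i j (x : T n i) (bt : prof * prof) : T m j :=
  if @eqP _ (pdeg bt.1 + pdeg bt.2) d is ReflectT h
  then snorm e2 bt.1 bt.2 *: \sum_(w : wiring_of bt.1 bt.2 m n) vsum q j x h w
  else 0.

Lemma starE d m n (phi : gdual Q d m n) i j (x : T n i) :
  star e1 e2 f g d m n phi i j x =
  \sum_(bt <- gsupp (decomp phi)) star_part (decomp phi) j x bt.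
Proof.
rewrite /star /gsum_eval; apply: eq_bigr => bt _; rewrite /star_part.
case: eqP => // h; rewrite scaler_sumr; apply: eq_bigr => w _.
by rewrite scaler_sumr.
Qed.

Lemma star_partE d m n (q : gsum (gdual Q) d m n) i j (x : T n i) b t
    (h : pdeg b + pdeg t = d) :
  star_part q j x (b, t) = snorm e2 b t *: \sum_(w : wiring_of b t m n) vsum q j x h w.
Proof.
rewrite /star_part; case: eqP => //= h'.
by rewrite (eq_irrelevance h' h).
Qed.

Lemma star_part_deg d m n (q : gsum (gdual Q) d m n) i j (x : T n i) b t :
  pdeg b + pdeg t <> d -> star_part q j x (b, t) = 0.
Proof. by rewrite /star_part; case: eqP. Qed.

Lemma star_part_off d m n (q : gsum (gdual Q) d m n) i j (x : T n i) bt :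
  bt \notin gsupp q -> star_part q j x bt = 0.
Proof.
case: bt => b t H; rewrite /star_part; case: eqP => // h.
by rewrite big1 ?scaler0 // => w _; rewrite /vsum gterms_out ?big_nil.
Qed.

(** Sums over the supports of different decompositions can be compared once both are taken over a
    common list. *)
Lemma star_widen d m n (phi : gdual Q d m n) i j (x : T n i) L :
  uniq L -> {subset gsupp (decomp phi) <= L} ->
  star e1 e2 f g d m n phi i j x = \sum_(bt <- L) star_part (decomp phi) j x bt.
Proof.
move=> uL SL; rewrite starE; symmetry; apply: sum_support => //.
  exact: gsupp_uniq.
by move=> bt; exact: star_part_off.
Qed.

Hypotheses (fe : conv_elt e1 f) (ge : conv_elt e2 g).

Lemma vterm_linl b t m n (w : wiring_of b t m n) i j (x : T n i) c p1 p1' p2 :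
  vterm b t w (c *: p1 + p1') p2 i j x = c *: vterm b t w p1 p2 i j x + vterm b t w p1' p2 i j x.
Proof.
rewrite /vterm (conv_lin fe) (end_comp_linl (0 : A 0)) //.
- exact: (conv_gmorph fe).
- exact: (conv_gmorph fe).
- exact: (conv_gmorph ge).
Qed.

Lemma vterm_linr b t m n (w : wiring_of b t m n) i j (x : T n i) c p1 p2 p2' :
  vterm b t w p1 (c *: p2 + p2') i j x = c *: vterm b t w p1 p2 i j x + vterm b t w p1 p2' i j x.
Proof.
rewrite /vterm (conv_lin ge) (end_comp_linr (0 : A 0)) //.
- exact: (conv_gmorph fe).
- exact: (conv_gmorph ge).
- exact: (conv_gmorph ge).
Qed.

(** The value of a graph is bilinear in its two decorations, so it depends on the list of tensors
    only through the bilinear form they define. *)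
Lemma vsum_indep b t m n (w : wiring_of b t m n) i j (x : T n i)
    (l l' : seq (at_prof (gdual Q) b * at_prof (gdual Q) t)) :
  (forall y z, \sum_(p <- l) (p.1 : dual _) y * (p.2 : dual _) z =
     \sum_(p <- l') (p.1 : dual _) y * (p.2 : dual _) z) ->
  \sum_(p <- l) vterm b t w p.1 p.2 i j x = \sum_(p <- l') vterm b t w p.1 p.2 i j x.
Proof.
apply: (@bilinear_sum_eq k (Q (- pdeg b) (pouts b) (pins b))
   (Q (- pdeg t) (pouts t) (pins t)) _ (fun p1 p2 => vterm b t w p1 p2 i j x)).
- by move=> *; exact: vterm_linl.
- by move=> *; exact: vterm_linr.
Qed.

End Values.
Arguments vterm e1 e2 f g b t {m n} w p1 p2 i j x : rename.

Variables (u : Q 0 1%N 0%N) (a : A 0).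
Local Notation pshift := (pshift u).
Local Notation plug_in := (plug_in u a).

Section Leibniz.
Variables (e1 e2 : int) (f g : conv).
Hypotheses (fe : conv_elt e1 f) (ge : conv_elt e2 g).
Variables (d : int) (m n : nat) (phi : gdual Q d m n) (i j : int) (x : T n i).
Let psi := pshift ord0 phi.
Let x' : T n.+1 (i + 0) := insert 1 a i (i + 0) x.

(** The terms of phi^(1) along [add_bin l w] may be replaced by those of phi along [w] with shifted
    bottom factors: by [pcomp_tops] both define the same bilinear form. Then [end_comp_add_bin]
    moves [a] into [f]. *)
Lemma vsum_bin mb nb (db : int) (t : prof) (h : db + pdeg t = d) (l : 'I_nb.+1)
    (w : wiring mb nb (pouts t) (pins t) m n) :
  vsum (b := (mb, nb.+1, db)) e1 e2 f g (decomp psi) j x' h (add_bin l w) =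
  vsum (b := (mb, nb, db)) e1 e2 (plug_in f) g (decomp phi) j x h w.
Proof.
rewrite /vsum.
pose L := [seq (pshift l p.1, p.2) | p <- gterms (decomp phi) (h : pdeg (mb, nb, db) + _ = d)
   (w : wiring_of (mb, nb, db) t m n)].
rewrite (vsum_indep (b := (mb, nb.+1, db)) fe ge (add_bin l w) j x' (l' := L)).
  rewrite /L big_map; apply: eq_bigr => p _.
  have := end_comp_add_bin a w l (conv_gmorph fe (pshift l p.1)) (conv_gmorph ge p.2).
  rewrite (plug_inE u a l p.1 fe) /= /vterm /= => <-.
  by rewrite /x' insert1E.
move=> y z; rewrite /L big_map.
rewrite (decomp_pairing (b := (mb, nb.+1, db)) h (add_bin l w) _ _ (decompP psi)).
have /= -> := decomp_pairing (b := (mb, nb, db)) h w (pcomp (addr0 (- db)) (plug mb l) y u) z (decompP phi).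
congr (_ * _); congr ((phi : dual _) _).
rewrite (pcomp_tops _ _ (addr0 (- db)) (opp_deg h) _ _ _ (nest_add_bin l w)).
(* The sign of [pcomp_tops] is trivial because the unit has degree 0. *)
by rewrite mulr0 scale1r.
Qed.

Lemma vsum_tin mt nt (dt : int) (b : prof) (h : pdeg b + dt = d) (l : 'I_nt.+1)
    (w : wiring (pouts b) (pins b) mt nt m n) :
  vsum (t := (mt, nt.+1, dt)) e1 e2 f g (decomp psi) j x' h (add_tin l w) =
  vsum (t := (mt, nt, dt)) e1 e2 f (plug_in g) (decomp phi) j x h w.
Proof.
rewrite /vsum.
pose L := [seq (p.1, pshift l p.2) | p <- gterms (decomp phi) (h : _ + pdeg (mt, nt, dt) = d)
   (w : wiring_of b (mt, nt, dt) m n)].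
rewrite (vsum_indep (t := (mt, nt.+1, dt)) fe ge (add_tin l w) j x' (l' := L)).
  rewrite /L big_map; apply: eq_bigr => p _.
  have := end_comp_add_tin a w l (conv_gmorph fe p.1) (conv_gmorph ge (pshift l p.2)).
  rewrite (plug_inE u a l p.2 ge) /= /vterm /= => <-.
  by rewrite /x' insert1E.
move=> y z; rewrite /L big_map.
rewrite (decomp_pairing (t := (mt, nt.+1, dt)) h (add_tin l w) _ _ (decompP psi)).
have /= -> := decomp_pairing (t := (mt, nt, dt)) h w y (pcomp (addr0 (- dt)) (plug mt l) z u) (decompP phi).
congr (_ * _); congr ((phi : dual _) _).
exact: (pcomp_chain _ _ (addr0 (- dt)) (opp_deg h) _ _ _ (nest_add_tin l w)).
Qed.

Hypothesis char0 : [pchar k] =i pred0.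

Lemma natr_neq0 l : (l != 0)%N -> l%:R != 0 :> k.
Proof. by move/pcharf0P: char0 => ->. Qed.

(** The nb + 1 inputs at which [a] may arrive turn 1/(nb+1)! into 1/nb!. *)
Lemma snorm_bin mb nb (db : int) t :
  snorm e2 (mb, nb.+1, db) t * nb.+1%:R = snorm e2 (mb, nb, db) t.
Proof.
rewrite /snorm /= mulrAC; congr (_ * _).
rewrite factS mulnCA -!mulnA natrM invfM mulrC mulrA divff ?mul1r //.
exact: natr_neq0.
Qed.

Lemma snorm_tin mt nt (dt : int) b :
  snorm e2 b (mt, nt.+1, dt) * nt.+1%:R = snorm e2 b (mt, nt, dt).
Proof.
rewrite /snorm /= mulrAC; congr (_ * _).
rewrite factS mulnCA natrM invfM mulrC mulrA divff ?mul1r //.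
exact: natr_neq0.
Qed.

(** The contribution of the graphs in which the bottom vertex receives [a]: removing that input
    lowers its arity by one. A bottom vertex without inputs receives nothing, whence the value 0. *)
Definition down_bin (bt : prof * prof) : T m j :=
  if bt is ((mb, nb.+1, db), t)
  then star_part e1 e2 (plug_in f) g (decomp phi) j x ((mb, nb, db), t) else 0.

Definition down_tin (bt : prof * prof) : T m j :=
  if bt is (b, (mt, nt.+1, dt))
  then star_part e1 e2 f (plug_in g) (decomp phi) j x (b, (mt, nt, dt)) else 0.

Lemma star_part_down bt :
  star_part e1 e2 f g (decomp psi) j x' bt = down_bin bt + down_tin bt.
Proof.
case: bt => [[[mb nb] db] [[mt nt] dt]]; rewrite /down_bin /down_tin.
have [h|/eqP h] := eqVneq (db + dt) d; last first.
  by rewrite star_part_deg //; case: nb nt => [|nb] [|nt]; rewrite ?star_part_deg ?addr0.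
rewrite (star_partE e1 e2 f g (decomp psi) j x' (b := (mb, nb, db)) (t := (mt, nt, dt)) h).
rewrite sum_first_input scalerDr; congr (_ + _).
  case: nb => [|nb]; first by rewrite big_ord0 scaler0.
  rewrite (star_partE _ _ _ _ _ _ _ (b := (mb, nb, db)) (t := (mt, nt, dt)) h).
  under eq_bigr => l _ do
    rewrite (sum_add_bin l) (eq_bigr _ (fun w _ => vsum_bin (t := (mt, nt, dt)) h l w)).
  by rewrite sumr_const card_ord -scaler_nat scalerA snorm_bin.
case: nt => [|nt]; first by rewrite big_ord0 scaler0.
rewrite (star_partE _ _ _ _ _ _ _ (b := (mb, nb, db)) (t := (mt, nt, dt)) h).
under eq_bigr => l _ do
  rewrite (sum_add_tin l) (eq_bigr _ (fun w _ => vsum_tin (b := (mb, nb, db)) h l w)).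
by rewrite sumr_const card_ord -scaler_nat scalerA snorm_tin.
Qed.

Definition up_bin (bt : prof * prof) : prof * prof :=
  let: ((mb, nb, db), t) := bt in ((mb, nb.+1, db), t).
Definition up_tin (bt : prof * prof) : prof * prof :=
  let: (b, (mt, nt, dt)) := bt in (b, (mt, nt.+1, dt)).

Lemma up_bin_inj : injective up_bin.
Proof. by case=> [[[mb nb] db] t] [[[mb' nb'] db'] t'] [-> -> -> ->]. Qed.
Lemma up_tin_inj : injective up_tin.
Proof. by case=> [b [[mb nb] db]] [b' [[mb' nb'] db']] [-> -> -> ->]. Qed.

Lemma star_plug_in_at :
  star e1 e2 f g d m n.+1 psi (i + 0) j x' =
  star e1 e2 (plug_in f) g d m n phi i j x + star e1 e2 f (plug_in g) d m n phi i j x.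
Proof.
set S := gsupp (decomp phi).
(* Arities on the side of phi are one lower, so its support enters twice, with an input added at the
   bottom or at the top. *)
pose L := undup (gsupp (decomp psi) ++ map up_bin S ++ map up_tin S).
have uS : uniq S := gsupp_uniq _.
rewrite (@star_widen e1 e2 f g _ _ _ psi _ j x' L) ?undup_uniq //; last first.
  by move=> bt; rewrite mem_undup !mem_cat => ->.
under eq_bigr => bt _ do rewrite star_part_down.
rewrite big_split /=; congr (_ + _).
  rewrite (@sum_support _ _ L (map up_bin S)) ?undup_uniq //.
  - rewrite big_map starE; apply: eq_bigr => -[[[mb nb] db] t] _ //.
  - by rewrite map_inj_uniq //; exact: up_bin_inj.
  - by move=> bt; rewrite mem_undup !mem_cat => ->; rewrite orbT.
  case=> [[[mb [|nb]] db] t] H //=; apply: star_part_off.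
  by apply: contra H => H; apply/mapP; exists ((mb, nb, db), t).
rewrite (@sum_support _ _ L (map up_tin S)) ?undup_uniq //.
- rewrite big_map starE; apply: eq_bigr => -[b [[mt nt] dt]] _ //.
- by rewrite map_inj_uniq //; exact: up_tin_inj.
- by move=> bt; rewrite mem_undup !mem_cat => ->; rewrite !orbT.
case=> [b [[mt [|nt]] dt]] H //=; apply: star_part_off.
by apply: contra H => H; apply/mapP; exists (b, (mt, nt, dt)).
Qed.

End Leibniz.

Lemma plug_in_star (char0 : [pchar k] =i pred0) e1 e2 (f g : conv) :
  conv_elt e1 f -> conv_elt e2 g ->
  plug_in (star e1 e2 f g) = cadd (star e1 e2 (plug_in f) g) (star e1 e2 f (plug_in g)).
Proof.
move=> fe ge; apply: conv_ext => d m n phi; apply: gmap_ext => i j x.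
exact: star_plug_in_at.
Qed.

End Star.

Section EndCompZero.
Variables (k : fieldType) (A : cmod k) (T : tensor_powers A).
Variables (m1 n1 m2 n2 m n : nat) (w : wiring m1 n1 m2 n2 m n) (e1 e2 : int).

Lemma end_comp0r (f : gmap (T n1) (T m1)) : gmorph e1 f ->
  end_comp w e1 e2 f gzero = gzero :> gmap (T n) (T m).
Proof.
move=> mf; have m0 := gmorph_gzero (T n2) (T m2) e2.
have := end_comp_linr (0 : A 0) w (-1) mf m0 m0.
have -> : gadd (gscale (-1) gzero) gzero = gzero :> gmap (T n2) (T m2).
  by apply: gmap_ext => i j x; rewrite /gadd /gscale /gzero scaler0 addr0.
by move=> ->; apply: gmap_ext => i j x; rewrite /gadd /gscale scaleN1r addNr.
Qed.

Lemma end_comp0l (g : gmap (T n2) (T m2)) : gmorph e2 g ->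
  end_comp w e1 e2 gzero g = gzero :> gmap (T n) (T m).
Proof.
move=> mg; have m0 := gmorph_gzero (T n1) (T m1) e1.
have := end_comp_linl (0 : A 0) w (-1) m0 m0 mg.
have -> : gadd (gscale (-1) gzero) gzero = gzero :> gmap (T n1) (T m1).
  by apply: gmap_ext => i j x; rewrite /gadd /gscale /gzero scaler0 addr0.
by move=> ->; apply: gmap_ext => i j x; rewrite /gadd /gscale scaleN1r addNr.
Qed.

Lemma gaddg0 B C (f : gmap B C) : gadd f gzero = f :> gmap (k := k) B C.
Proof. by apply: gmap_ext => i j x; rewrite /gadd addr0. Qed.

Lemma gscaleg0 B C c : gscale c gzero = gzero :> gmap (k := k) B C.
Proof. by apply: gmap_ext => i j x; rewrite /gscale scaler0. Qed.

Lemma end_comp_scaler c (f : gmap (T n1) (T m1)) (g : gmap (T n2) (T m2)) :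
  gmorph e1 f -> gmorph e2 g ->
  end_comp w e1 e2 f (gscale c g) = gscale c (end_comp w e1 e2 f g).
Proof.
move=> mf mg; rewrite -[gscale c g]gaddg0 (end_comp_linr (0 : A 0)) //; last exact: gmorph_gzero.
by rewrite end_comp0r // gaddg0.
Qed.

End EndCompZero.

(** * The adjoint action of a and the two series *)

Section UnitStar.
Variables (k : fieldType) (A : cmod k) (T : tensor_powers A) (Q : properad k).
Hypotheses (Qinf : inf_coproperad Q) (char0 : [pchar k] =i pred0).
Local Notation conv := (conv T Q).
Variables (u : Q 0 1%N 0%N) (a : A 0).
Local Notation pshift := (pshift u).
Local Notation plug_in := (plug_in u a).
Local Notation place := (@place_map k A T a _ _).
Local Notation elt := (elt_conv u a).

Lemma gmorph_insert1 n : gmorph 0 (insert 1 a : gmap (T n) (T n.+1)).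
Proof. by rewrite insert1E; exact/gmorph_place/unlift_placing. Qed.

Lemma elt_conv_off (t : prof) (phi : gdual Q (pdeg t) (pouts t) (pins t)) :
  t <> (1%N, 0%N, 0) -> elt (pdeg t) (pouts t) (pins t) phi = gzero :> gmap (T _) (T _).
Proof.
by case: t phi => [[[|[|m]] [|n]] [[|d]|d]] phi //= [].
Qed.

(** Writing [w] as a relabelled standard plug, the permutations relating [psi] to the shift of phi
    cancel those introduced by [end_comp_insert], so the value does not depend on [w]. *)
Lemma plug_cycle d m n e (f : conv) (phi : gdual Q d m n)
    (w : wiring m n.+1 1 0 m n) (psi : gdual Q d m n.+1) : conv_elt e f ->
  (forall y, (psi : dual _) y = (phi : dual _) (pcomp (addr0 (- d)) w y u)) ->
  end_comp w (d + e) 0 (f d m n.+1 psi) (insert 1 a) = plug_in f d m n phi.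
Proof.
move=> fe psiE; have [s [t ww]] := plug_relabels w.
rewrite (end_comp_insert a (conv_gmorph fe psi) ww).
have -> : psi = sact s^-1%g t^-1%g (pshift ord0 phi).
  apply: dual_ext => y; rewrite psiE /= !invgK; congr ((phi : dual _) _).
  by rewrite -(pcomp_act _ _ _ ww) !sact1.
have mf := conv_gmorph fe (pshift ord0 phi).
rewrite (conv_act fe) (end_actE _ _ mf) gcompA0 gcompA0 reorder_place; last first.
  by have := placing_obind (unlift_placing ord0) (placing_perm t).
rewrite -gcomp0A (reorderE T a (placing_perm s^-1)) (reorder_place T a s (placing_perm s^-1)).
have -> : (Some \o s^-1%g) \o s = Some by apply/funext => o /=; rewrite permK.
rewrite place_id gcomp_idl; last first.
  have pt : placing ((unlift ord0 \o t) \o t^-1%g).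
    by have := placing_obind (placing_obind (unlift_placing ord0) (placing_perm t)) (placing_perm t^-1).
  by have := gmorph_gcomp mf (gmorph_place T a pt); rewrite add0r.
rewrite /plug_in insert1E.
suff -> : (unlift ord0 \o t) \o t^-1%g = unlift ord0 by [].
by apply/funext => o /=; rewrite permKV.
Qed.

(** Since [a] lives in profile (1,0,0), the arities of the wiring and the degree leave a single pair
    of profiles. *)
Lemma star_elt e c (f : conv) : conv_elt e f ->
  star e 0 f (cscale c elt) = cscale c (plug_in f).
Proof.
move=> fe; apply: conv_ext => d m n phi; apply: gmap_ext => i j x.
pose b0 : prof := (m, n.+1, d); pose t0 : prof := (1%N, 0%N, 0).
pose L := undup ((b0, t0) :: gsupp (decomp phi)).
rewrite (@star_widen _ _ _ _ e 0 f (cscale c elt) _ _ _ phi i j x L) ?undup_uniq //; last first.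
  by move=> bt; rewrite mem_undup inE => ->; rewrite orbT.
rewrite (@sum_support _ _ L [:: (b0, t0)]) ?undup_uniq //; first 1 last.
- by move=> bt; rewrite inE => /eqP ->; rewrite mem_undup inE eqxx.
- case=> b t; rewrite inE => bt0.
  have [tE|/eqP tN] := eqVneq t t0; last first.
    have [h|/eqP h] := eqVneq (pdeg b + pdeg t) d; last by rewrite star_part_deg.
    rewrite (star_partE _ _ _ _ _ _ _ h) big1 ?scaler0 // => w _.
    rewrite /vsum big1 // => p _; rewrite /vterm /cscale elt_conv_off // gscaleg0.
    by rewrite end_comp0r //; exact: (conv_gmorph fe).
  subst t; case: b bt0 => [[mb nb] db] bt0.
  have [h|/eqP h] := eqVneq (db + 0) d; last by rewrite star_part_deg.
  rewrite (star_partE _ _ _ _ _ _ _ (b := (mb, nb, db)) (t := t0) h) big1 ?scaler0 // => w _.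
  have Em : mb = m := wiring10_outs w; have En : nb = n.+1 := wiring10_ins w.
  by case/negP: bt0; rewrite /b0 Em En -h addr0.
rewrite big_seq1.
have h : d + 0 = d by exact: addr0.
rewrite (star_partE _ _ _ _ _ _ _ (b := b0) (t := t0) h).
have key w : vsum e 0 f (cscale c elt) (decomp phi) (b := b0) (t := t0) j x h w =
    c *: plug_in f d m n phi i j x.
  (* Only the value at [u] of the top factors enters [elt_conv], so the tensor is contracted with
     [u] before [plug_cycle] is applied. *)
  pose psi : gdual Q d m n.+1 := \sum_(p <- gterms (decomp phi) (b := b0) (t := t0) h w)
    (p.2 : dual _) u *: p.1.
  have psiE y : (psi : dual _) y = (phi : dual _) (pcomp (addr0 (- d)) w y u).
    have := decomp_pairing (b := b0) (t := t0) h w y u (decompP Qinf phi).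
    rewrite mul0r mul1r (eq_irrelevance (opp_deg h) (addr0 (- d))) => <-.
    rewrite /psi; elim/big_rec2: _ => // p f1 f2 _ <-.
    by rewrite /= mulrC.
  rewrite -(plug_cycle fe psiE) /vsum.
  have mf phi' : gmorph (d + e) (f d m n.+1 phi') := conv_gmorph fe phi'.
  have E (p1 : gdual Q d m n.+1) (p2 : gdual Q 0 1 0) :
      vterm (b := b0) (t := t0) e 0 f (cscale c elt) w p1 p2 j x =
      c *: ((p2 : dual _) u *: end_comp w (d + e) 0 (f d m n.+1 p1) (insert 1 a) i j x).
    rewrite -[LHS]/(end_comp w (d + e) 0 (f d m n.+1 p1)
      (gscale c (gscale ((p2 : dual _) u) (insert 1 a))) i j x).
    by rewrite !end_comp_scaler //; [exact: gmorph_insert1 | exact/gmorph_gscale/gmorph_insert1].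
  under eq_bigr => p _ do rewrite E.
  rewrite -scaler_sumr; congr (_ *: _).
  have lin_end : linear (fun p1 => end_comp w (d + e) 0 (f d m n.+1 p1) (insert 1 a) i j x).
    move=> c' p1 p2; rewrite (conv_lin fe) (end_comp_linl a) //; exact: gmorph_insert1.
  rewrite (lin_sum lin_end); apply: eq_bigr => p _.
  by rewrite (lin_scale lin_end).
under eq_bigr => w _ do rewrite key.
rewrite sumr_const card_wiring_plug -scaler_nat scalerA /snorm /= mul0r !muln1 mulr1 mulVf ?scale1r //.
by apply: natr_neq0 => //; rewrite muln_eq0 negb_or -!lt0n !fact_gt0.
Qed.

(** The internal edge of a two-vertex graph ends at an input of the bottom vertex, and the vertex
    carrying [a] has none. *)
Lemma elt_star e c (f : conv) : conv_elt e f -> star 0 e (cscale c elt) f = czero.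
Proof.
move=> fe; apply: conv_ext => d m n phi; apply: gmap_ext => i j x.
rewrite starE big1 // => -[b t] _.
have [h|/eqP h] := eqVneq (pdeg b + pdeg t) d; last by rewrite star_part_deg.
rewrite (star_partE _ _ _ _ _ _ _ h) big1 ?scaler0 // => w _.
have [bE|/eqP bN] := eqVneq b (1%N, 0%N, 0).
  subst b; have /and5P[_ _ _ _ /andP[_ /existsP[[]//]]] := wmapP w.
rewrite /vsum big1 // => p _; rewrite /vterm /cscale elt_conv_off // gscaleg0.
by rewrite end_comp0l //; exact: (conv_gmorph fe).
Qed.

(** The sign of -a cancels the sign of the second term of the commutator, as [a] has degree 0. *)
Lemma bracket_elt (f : conv) : conv_elt (-1) f ->
  bracket 0 (-1) (cscale (-1) elt) f = plug_in f.
Proof.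
move=> fe; rewrite /bracket (elt_star _ fe) (star_elt _ fe).
apply: conv_ext => d m n phi; apply: gmap_ext => i j x.
by rewrite /cadd /cscale /gadd /gscale /czero /gzero add0r mul0r !scaleN1r opprK.
Qed.

Lemma iter_plug_in_elt e p (f : conv) : conv_elt e f -> conv_elt e (iter p plug_in f).
Proof. by move=> fe; elim: p => //= p; exact: plug_in_elt. Qed.

Lemma gauge_termE (f : conv) p : conv_elt (-1) f ->
  gauge_term u a f p = cscale p`!%:R^-1 (iter p plug_in f).
Proof.
move=> fe; rewrite /gauge_term; congr cscale.
by elim: p => //= p ->; rewrite bracket_elt //; exact: iter_plug_in_elt.
Qed.

Lemma insertS p n : gcomp 0 (insert 1 a) (insert p a) = insert p.+1 a :> gmap (T n) _.
Proof.
rewrite insert1E !insertE place_comp; last 1 first.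
- exact: unlift_placing.
- congr (place_map a _); apply/funext => l /=.
  case: (unliftP ord0 l) => [l' ->|->] /=; last first.
    by have -> : ord0 = lshift n (ord0 : 'I_p.+1) by [exact: val_inj]; rewrite split_lshift.
  elim/split_ind: l' => i; rewrite ?split_lshift ?split_rshift.
    by have -> : lift ord0 (lshift n i) = lshift n (lift ord0 i) by [exact: val_inj]; rewrite split_lshift.
  have -> : lift ord0 (rshift p i) = rshift p.+1 i by exact: val_inj.
  by rewrite split_rshift.
exists (@rshift p n); split=> [v|l v]; first by rewrite split_rshift.
by elim/split_ind: l => i; rewrite ?split_lshift ?split_rshift // => -[->].
Qed.

(** Like [plug_units], the iteration always uses the first input, and [insertS] assembles the copies
    of [a] accordingly. *)
Lemma iter_plug_in p (f : conv) d m n (phi : gdual Q d m n) :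
  iter p plug_in f d m n phi = gcomp 0 (f d m (p + n)%N (unit_shift u p phi)) (insert p a).
Proof.
elim: p f => [|p IH] f.
  rewrite insertE /=; have -> : unit_shift u 0 phi = phi by exact: dual_ext.
  suff -> : place (fun l : 'I_(0 + n) => if split l is inr i then Some i else None) = gid.
    by rewrite gcomp_idr.
  rewrite -(place_id T a); congr (place_map a _); apply/funext; apply: split_ind => [[]//|i].
  by rewrite split_rshift; congr Some; exact: val_inj.
rewrite iterSr IH /plug_in gcompA0 insertS.
by congr (gcomp 0 (f _ _ _ _) _); exact: dual_ext.
Qed.

Lemma twist_termE (f : conv) p :
  twist_term u a f p = cscale p`!%:R^-1 (iter p plug_in f).
Proof.
apply: conv_ext => d m n phi; rewrite /cscale iter_plug_in.
by apply: gmap_ext.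
Qed.

End UnitStar.

(** * The twisted Maurer-Cartan element *)

Section StarAlgebra.
Variables (k : fieldType) (A : cmod k) (T : tensor_powers A) (Q : properad k).
Local Notation conv := (conv T Q).

Definition cshift p (f : conv) : Prop := forall d m n phi, fshift p (f d m n phi).

Lemma conv_elt0 e : conv_elt e (czero : conv).
Proof.
split=> [d m n phi|d m n c phi psi i j x|d m n s t phi i j x].
- exact: gmorph_gzero.
- by rewrite /czero /gzero scaler0 addr0.
- have mr := gmorph_reorder T (0 : A 0) (placing_perm s).
  by rewrite /end_act /czero /gzero (lin_zero (gmorph_lin mr _ _)).
Qed.

Lemma conv_elt_comb e c (f g : conv) :
  conv_elt e f -> conv_elt e g -> conv_elt e (cadd (cscale c f) g).
Proof.
move=> fe ge; split=> [d m n phi|d m n c' phi psi i j x|d m n s t phi i j x].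
- by apply: gmorph_comb; [exact: (conv_gmorph fe) | exact: (conv_gmorph ge)].
- rewrite /cadd /cscale (conv_lin fe) (conv_lin ge) /gadd /gscale.
  by rewrite !scalerDr !scalerA [c * c']mulrC addrACA.
- rewrite /cadd /cscale (conv_act fe) (conv_act ge) /end_act /gadd /gscale.
  have mr := gmorph_reorder T (0 : A 0) (placing_perm s).
  by rewrite (gmorph_lin mr).
Qed.

Lemma conv_elt_scale e c (f : conv) : conv_elt e f -> conv_elt e (cscale c f).
Proof.
move=> fe; have := conv_elt_comb c fe (conv_elt0 e); congr (conv_elt e _).
apply: conv_ext => d m n phi; apply: gmap_ext => i j x.
by rewrite /cadd /gadd /czero /gzero addr0.
Qed.

Lemma conv_elt_add e (f g : conv) : conv_elt e f -> conv_elt e g -> conv_elt e (cadd f g).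
Proof.
move=> fe ge; have := conv_elt_comb 1 fe ge; congr (conv_elt e _).
apply: conv_ext => d m n phi; apply: gmap_ext => i j x.
by rewrite /cadd /cscale /gadd /gscale scale1r.
Qed.

Lemma gsum_eval_comb d m n (q : gsum (gdual Q) d m n) (V : lmodType k) c
    (F F' G : forall b t, pdeg b + pdeg t = d -> wiring_of b t m n ->
         at_prof (gdual Q) b -> at_prof (gdual Q) t -> V) :
  (forall b t h w p1 p2, G b t h w p1 p2 = c *: F b t h w p1 p2 + F' b t h w p1 p2) ->
  gsum_eval (V := V) q G = c *: gsum_eval (V := V) q F + gsum_eval (V := V) q F'.
Proof.
move=> GE; rewrite /gsum_eval scaler_sumr -big_split; apply: eq_bigr => bt _ /=.
case: eqP => [h|_]; last by rewrite scaler0 addr0.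
rewrite scaler_sumr -big_split; apply: eq_bigr => w _ /=.
by rewrite scaler_sumr -big_split; apply: eq_bigr => p _; rewrite GE.
Qed.

Lemma star_linr e1 e2 c (f g g' : conv) :
  conv_elt e1 f -> conv_elt e2 g -> conv_elt e2 g' ->
  star e1 e2 f (cadd (cscale c g) g') =
  cadd (cscale c (star e1 e2 f g)) (star e1 e2 f g').
Proof.
move=> fe ge ge'; apply: conv_ext => d m n phi; apply: gmap_ext => i j x.
apply: gsum_eval_comb => b t h w p1 p2; rewrite /cadd /cscale.
rewrite (end_comp_linr (0 : A 0)); first by rewrite /gadd /gscale scalerDr !scalerA mulrC.
- exact: (conv_gmorph fe).
- exact: (conv_gmorph ge).
- exact: (conv_gmorph ge').
Qed.

Lemma star_linl e1 e2 c (f f' g : conv) :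
  conv_elt e1 f -> conv_elt e1 f' -> conv_elt e2 g ->
  star e1 e2 (cadd (cscale c f) f') g =
  cadd (cscale c (star e1 e2 f g)) (star e1 e2 f' g).
Proof.
move=> fe fe' ge; apply: conv_ext => d m n phi; apply: gmap_ext => i j x.
apply: gsum_eval_comb => b t h w p1 p2; rewrite /cadd /cscale.
rewrite (end_comp_linl (0 : A 0)); first by rewrite /gadd /gscale scalerDr !scalerA mulrC.
- exact: (conv_gmorph fe).
- exact: (conv_gmorph fe').
- exact: (conv_gmorph ge).
Qed.

Lemma caddf0 (f : conv) : cadd f czero = f.
Proof.
apply: conv_ext => d m n phi; apply: gmap_ext => i j x.
by rewrite /cadd /gadd /czero /gzero addr0.
Qed.

Lemma star0l e1 e2 (g : conv) : conv_elt e2 g -> star e1 e2 czero g = czero.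
Proof.
move=> ge; have := star_linl (-1) (conv_elt0 e1) (conv_elt0 e1) ge.
rewrite caddf0; have -> : cscale (-1) czero = czero :> conv.
  apply: conv_ext => d m n phi; apply: gmap_ext => i j x.
  by rewrite /cscale /gscale /czero /gzero scaler0.
move=> ->; apply: conv_ext => d m n phi; apply: gmap_ext => i j x.
by rewrite /cadd /cscale /gadd /gscale scaleN1r addNr.
Qed.

Lemma star0r e1 e2 (f : conv) : conv_elt e1 f -> star e1 e2 f czero = czero.
Proof.
move=> fe; have := star_linr (-1) fe (conv_elt0 e2) (conv_elt0 e2).
rewrite caddf0; have -> : cscale (-1) czero = czero :> conv.
  apply: conv_ext => d m n phi; apply: gmap_ext => i j x.
  by rewrite /cscale /gscale /czero /gzero scaler0.
move=> ->; apply: conv_ext => d m n phi; apply: gmap_ext => i j x.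
by rewrite /cadd /cscale /gadd /gscale scaleN1r addNr.
Qed.

Lemma star_scalel e1 e2 c (f g : conv) : conv_elt e1 f -> conv_elt e2 g ->
  star e1 e2 (cscale c f) g = cscale c (star e1 e2 f g).
Proof.
move=> fe ge; rewrite -[cscale c f]caddf0 star_linl //; last exact: conv_elt0.
by rewrite star0l // caddf0.
Qed.

Lemma star_scaler e1 e2 c (f g : conv) : conv_elt e1 f -> conv_elt e2 g ->
  star e1 e2 f (cscale c g) = cscale c (star e1 e2 f g).
Proof.
move=> fe ge; rewrite -[cscale c g]caddf0 star_linr //; last exact: conv_elt0.
by rewrite star0r // caddf0.
Qed.

Lemma cscale1 (f : conv) : cscale 1 f = f.
Proof.
apply: conv_ext => d m n phi; apply: gmap_ext => i j x.
by rewrite /cscale /gscale scale1r.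
Qed.

(** Multiplicativity of the filtration on the convolution algebra, inherited from the tensor product
    of maps since reorderings preserve the filtration. *)
Lemma cshift_star e1 e2 p q (f g : conv) : conv_elt e1 f -> conv_elt e2 g ->
  cshift p f -> cshift q g -> cshift (p + q) (star e1 e2 f g).
Proof.
move=> fe ge pf qg d m n phi r i j x rx; rewrite starE; apply: fil_sum => -[b t] _.
have [h|/eqP h] := eqVneq (pdeg b + pdeg t) d; last by rewrite star_part_deg //; exact: fil_zero.
rewrite (star_partE _ _ _ _ _ _ _ h); apply: fil_scale; apply: fil_sum => w _.
apply: fil_sum => pp _; apply: (fshift_end_comp (0 : A 0)) => //.
- exact: (conv_gmorph fe).
- exact: (conv_gmorph ge).
Qed.

End StarAlgebra.

Section TwistedElement.
Variables (k : fieldType) (A : cmod k) (T : tensor_powers A) (Q : properad k).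
Hypotheses (Qinf : inf_coproperad Q) (char0 : [pchar k] =i pred0).
Local Notation conv := (conv T Q).
Variables (u : Q 0 1%N 0%N) (a : A 0).
Hypothesis aF1 : fil 1 a.
Local Notation plug_in := (@plug_in k A T Q u a).

Lemma fshift_insert1 n : fshift 1 (insert 1 a : gmap (T n) (T n.+1)).
Proof.
apply: (tn_shift (gmorph_insert1 T a n)) => X q Hq; rewrite addr0 insert1E.
rewrite placeE; last exact: unlift_placing.
apply: fil_scale; pose q' (l : 'I_n.+1) := oapp q 1%N (unlift ord0 l).
have -> : (1 + \sum_i q i = \sum_i q' i)%N.
  by rewrite big_ord_recl /q' unlift_none; congr (_ + _)%N; apply: eq_bigr => i _; rewrite liftK.
apply: tn_fil => l; rewrite /osel /q'; by case: unlift.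
Qed.

Lemma cshift_plug_in p (f : conv) : cshift p f -> cshift p.+1 (plug_in f).
Proof.
move=> pf d m n phi; rewrite -addn1; apply: fshift_gcomp; first exact: pf.
exact: fshift_insert1.
Qed.

Variable alpha : conv.
Hypothesis alpha_elt : conv_elt (-1) alpha.

Definition twist_part p : conv := cscale p`!%:R^-1 (iter p plug_in alpha).
Arguments twist_part p d m n phi i j x : clear implicits.

Lemma twist_part_elt p : conv_elt (-1) (twist_part p).
Proof. exact/conv_elt_scale/iter_plug_in_elt. Qed.

Lemma twist_part_shift p : cshift p (twist_part p).
Proof.
have : cshift p (iter p plug_in alpha).
  elim: p => [|p IH]; last exact: cshift_plug_in.
  by move=> d m n phi; apply: fshift_gmorph; exact: (conv_gmorph alpha_elt).
by move=> H d m n phi q i j x qx; apply: fil_scale; exact: H.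
Qed.

(** The divided powers t_p of D applied to [alpha] satisfy D t_p = (p+1) t_(p+1). *)
Lemma plug_in_term p : plug_in (twist_part p) = cscale p.+1%:R (twist_part p.+1).
Proof.
have E : plug_in (twist_part p) = cscale p`!%:R^-1 (iter p.+1 plug_in alpha) by [].
rewrite E; apply: conv_ext => d m n phi; apply: gmap_ext => i j x.
rewrite /twist_part /cscale /gscale scalerA factS natrM invfM mulrA divff ?mul1r //.
exact: natr_neq0.
Qed.

Definition psum N : conv := fun d m n phi i j x => \sum_(l < N) twist_part l d m n phi i j x.

Lemma psumS N : psum N.+1 = cadd (psum N) (twist_part N).
Proof.
apply: conv_ext => d m n phi; apply: gmap_ext => i j x.
by rewrite /psum big_ord_recr.
Qed.

Lemma psum0 : psum 0 = czero.
Proof.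
by apply: conv_ext => d m n phi; apply: gmap_ext => i j x; rewrite /psum big_ord0.
Qed.

Lemma psum_elt N : conv_elt (-1) (psum N).
Proof.
elim: N => [|N IH]; first by rewrite psum0; exact: conv_elt0.
by rewrite psumS; apply: conv_elt_add => //; exact: twist_part_elt.
Qed.

Lemma twisted_exists d m n (phi : gdual Q d m n) i j (x : T n i) :
  exists y : T m j, forall p, fil p (y - psum p phi j x).
Proof.
apply: fil_complete => p; rewrite psumS /cadd /gadd addrC addKr.
by have := @twist_part_shift p d m n phi 0%N i j x (fil_all _); rewrite addn0.
Qed.

Definition twisted : conv := fun d m n phi i j x =>
  projT1 (cid (twisted_exists phi j x)).
Arguments twisted d m n phi i j x : clear implicits.
Arguments psum N d m n phi i j x : clear implicits.

Lemma twistedP d m n (phi : gdual Q d m n) i j (x : T n i) p :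
  fil p (twisted d m n phi i j x - psum p d m n phi i j x).
Proof. by rewrite /twisted; case: cid. Qed.

Lemma twisted_uniq d m n (phi : gdual Q d m n) i j (x : T n i) y :
  (forall p, fil p (y - psum p d m n phi i j x)) -> y = twisted d m n phi i j x.
Proof.
move=> H; apply/eqP; rewrite -subr_eq0; apply/eqP; apply: fil_sep => p.
rewrite -(subrK (psum p d m n phi i j x) y) -addrA; apply: fil_add; first exact: H.
by rewrite -opprB -scaleN1r; apply: fil_scale; exact: twistedP.
Qed.

(** The defining estimate of the limit ignores the filtration of x; comparing with the partial sum
    of index N + q first makes the remainder raise every filtration step by N. *)
Lemma twisted_rest N d m n (phi : gdual Q d m n) q i j (x : T n i) : fil q x ->
  fil (N + q) (twisted d m n phi i j x - psum N d m n phi i j x).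
Proof.
move=> qx; rewrite -(subrK (psum (N + q)%N d m n phi i j x) (twisted _ _ _ _ _ _ _)) -addrA.
apply: fil_add; first exact: twistedP.
have : forall M, fil (N + q) (psum (N + M)%N d m n phi i j x - psum N d m n phi i j x).
  elim=> [|M IH]; first by rewrite addn0 subrr; exact: fil_zero.
  rewrite addnS psumS /cadd /gadd addrAC; apply: fil_add => //.
  apply: (fil_le _ (@twist_part_shift (N + M)%N d m n phi q i j x qx)).
  by rewrite leq_add2r leq_addr.
exact.
Qed.

Lemma twisted_elt : conv_elt (-1) twisted.
Proof.
split=> [d m n phi|d m n c phi psi i j x|d m n s t phi i j x].
- split=> [i j c x y|i j x ji|p i j x px].
  + symmetry; apply: twisted_uniq => p.
    rewrite (gmorph_lin (conv_gmorph (psum_elt p) phi)) opprD addrACA -scalerBr.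
    by apply: fil_lin; exact: twistedP.
  + apply: fil_sep => p; have := twistedP phi j x p.
    by rewrite (gmorph_off (conv_gmorph (psum_elt p) phi)) // subr0.
  + by have := @twisted_rest 0 _ _ _ phi p i j x px; rewrite psum0 subr0.
- symmetry; apply: twisted_uniq => p.
  rewrite (conv_lin (psum_elt p)) /gadd /gscale opprD addrACA -scalerBr.
  by apply: fil_lin; exact: twistedP.
- symmetry; apply: twisted_uniq => p; rewrite (conv_act (psum_elt p)) /end_act.
  have mr := gmorph_reorder T (0 : A 0) (placing_perm s).
  set y := reorder t _ _ x.
  have -> (z z' : T m j) : reorder s j j z - reorder s j j z' = reorder s j j (z - z').
    by rewrite -[in RHS]scaleN1r addrC [in RHS]addrC (gmorph_lin mr) scaleN1r.
  by apply: (gmorph_fil mr); exact: twistedP.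
Qed.

Definition rest N : conv := cadd (cscale (-1) (psum N)) twisted.

Lemma rest_elt N : conv_elt (-1) (rest N).
Proof. by apply: conv_elt_comb; [exact: psum_elt | exact: twisted_elt]. Qed.

Lemma rest_shift N : cshift N (rest N).
Proof.
move=> d m n phi q i j x qx; rewrite /rest /cadd /cscale /gadd /gscale.
by rewrite scaleN1r addrC; exact: twisted_rest.
Qed.

Lemma twisted_split N : twisted = cadd (psum N) (rest N).
Proof.
apply: conv_ext => d m n phi; apply: gmap_ext => i j x.
by rewrite /rest /cadd /cscale /gadd /gscale scaleN1r addNKr.
Qed.

Local Notation star := (star (-1) (-1)).

Lemma star_addl (f f' g : conv) :
  conv_elt (-1) f -> conv_elt (-1) f' -> conv_elt (-1) g ->
  star (cadd f f') g = cadd (star f g) (star f' g).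
Proof.
move=> fe fe' ge; rewrite -[f in LHS]cscale1 star_linl //.
by rewrite cscale1.
Qed.

Lemma star_addr (f g g' : conv) :
  conv_elt (-1) f -> conv_elt (-1) g -> conv_elt (-1) g' ->
  star f (cadd g g') = cadd (star f g) (star f g').
Proof.
move=> fe ge ge'; rewrite -[g in LHS]cscale1 star_linr //.
by rewrite cscale1.
Qed.

Lemma star_psuml N (g : conv) d m n phi i j x : conv_elt (-1) g ->
  star (psum N) g d m n phi i j x = \sum_(p < N) star (twist_part p) g d m n phi i j x.
Proof.
move=> ge; elim: N => [|N IH]; first by rewrite psum0 star0l ?big_ord0.
rewrite psumS star_addl //; [|exact: psum_elt|exact: twist_part_elt].
by rewrite big_ord_recr /= -IH.
Qed.

Lemma star_psumr N (f : conv) d m n phi i j x : conv_elt (-1) f ->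
  star f (psum N) d m n phi i j x = \sum_(p < N) star f (twist_part p) d m n phi i j x.
Proof.
move=> fe; elim: N => [|N IH]; first by rewrite psum0 star0r ?big_ord0.
rewrite psumS star_addr //; [|exact: psum_elt|exact: twist_part_elt].
by rewrite big_ord_recr /= -IH.
Qed.

Definition diagonal r : conv := fun d m n phi i j x =>
  \sum_(p < r.+1) star (twist_part p) (twist_part (r - p)) d m n phi i j x.
Arguments diagonal r d m n phi i j x : clear implicits.

(** For p + q = r + 1 the product of t_p and t_q arises p times from t_(p-1) and t_q, and q times
    from t_p and t_(q-1), by the Leibniz rule; the coefficients add up to r + 1. *)
Lemma plug_in_diagonal r : plug_in (diagonal r) = cscale r.+1%:R (diagonal r.+1).
Proof.
apply: conv_ext => d m n phi; apply: gmap_ext => i j x.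
pose S p q := star (twist_part p) (twist_part q) d m n phi i j x.
rewrite -[RHS]/(r.+1%:R *: \sum_(p < r.+2) S p (r.+1 - p)%N).
transitivity (\sum_(p < r.+1) plug_in (star (twist_part p) (twist_part (r - p))) d m n phi i j x); first by [].
under eq_bigr => p _.
  rewrite (plug_in_star Qinf u a char0 (twist_part_elt p) (twist_part_elt _)) !plug_in_term.
  rewrite (star_scalel _ (twist_part_elt p.+1) (twist_part_elt _)).
  rewrite (star_scaler _ (twist_part_elt p) (twist_part_elt (r - p).+1)).
  rewrite -[cadd _ _ _ _ _ _ _ _ _]/(p.+1%:R *: S p.+1 (r - p)%N +
     (r - p).+1%:R *: S p (r - p).+1).
  over.
rewrite big_split /= scaler_sumr.
have -> : \sum_(p < r.+2) r.+1%:R *: S p (r.+1 - p)%N =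
    \sum_(p < r.+2) p%:R *: S p (r.+1 - p)%N + \sum_(p < r.+2) (r.+1 - p)%:R *: S p (r.+1 - p)%N.
  rewrite -big_split; apply: eq_bigr => p _ /=.
  by rewrite -scalerDl -natrD subnKC // -ltnS ltn_ord.
congr (_ + _).
  rewrite [RHS]big_ord_recl /= scale0r add0r; apply: eq_bigr => p _.
  by rewrite /bump add1n subSS.
rewrite [RHS]big_ord_recr /= subnn scale0r addr0; apply: eq_bigr => p _.
by rewrite subSn // -ltnS ltn_ord.
Qed.

Hypothesis alpha_MC : star alpha alpha = czero.

Lemma diagonal0 r : diagonal r = czero.
Proof.
elim: r => [|r IH]; apply: conv_ext => d m n phi; apply: gmap_ext => i j x.
  rewrite /diagonal big_ord1 subn0.
  have -> : twist_part 0 = alpha by rewrite /twist_part fact0 invr1 cscale1.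
  by rewrite alpha_MC.
have := congr1 (fun f : conv => f d m n phi i j x) (plug_in_diagonal r).
rewrite IH -[plug_in czero d m n phi i j x]/(0 : T m j) /cscale /gscale => /esym/eqP.
by rewrite scaler_eq0 (negPf (natr_neq0 char0 _)) // => /eqP.
Qed.

Lemma triangular_sum (V : nmodType) N (S : nat -> nat -> V) :
  \sum_(p < N) \sum_(q < N - p) S p q = \sum_(r < N) \sum_(p < r.+1) S p (r - p)%N.
Proof.
elim: N => [|N IH]; first by rewrite !big_ord0.
rewrite [RHS]big_ord_recr -IH /= big_ord_recr [X in _ = _ + X]big_ord_recr /= addrA.
rewrite subSn // subnn big_ord1; congr (_ + _).
rewrite -big_split; apply: eq_bigr => p _ /=.
by rewrite subSn ?big_ord_recr // ltnW.
Qed.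

(** Modulo F_N the left factor may be cut after N terms, and next to t_p the right factor after N -
    p terms. The products t_p, t_q with p + q < N that remain are grouped into the diagonals, which
    vanish. *)
Lemma twisted_MC : star twisted twisted = czero.
Proof.
apply: conv_ext => d m n phi; apply: gmap_ext => i j x; apply: fil_sep => N.
rewrite {1}(twisted_split N) star_addl; [|exact: psum_elt|exact: rest_elt|exact: twisted_elt].
apply: fil_add; last first.
  have tw0 : cshift 0 twisted.
    by move=> *; apply: fshift_gmorph; exact: (conv_gmorph twisted_elt).
  have := cshift_star (rest_elt N) twisted_elt (@rest_shift N) tw0 phi j (fil_all x).
  by rewrite !addn0.
rewrite star_psuml; last exact: twisted_elt.
have -> : \sum_(p < N) star (twist_part p) twisted d m n phi i j x =
    \sum_(p < N) star (twist_part p) (rest (N - p)) d m n phi i j x.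
  transitivity (\sum_(p < N) (\sum_(q < N - p) star (twist_part p) (twist_part q) d m n phi i j x +
       star (twist_part p) (rest (N - p)) d m n phi i j x)).
    apply: eq_bigr => p _; rewrite -star_psumr; last exact: twist_part_elt.
    by rewrite [in LHS](twisted_split (N - p)) star_addr //;
       [exact: twist_part_elt | exact: psum_elt | exact: rest_elt].
  rewrite big_split /= (triangular_sum _ (fun p q => star (twist_part p) (twist_part q) d m n phi i j x)).
  rewrite big1 ?add0r // => r _.
  exact: (congr1 (fun f : conv => f d m n phi i j x) (diagonal0 r)).
apply: fil_sum => p _; have pN : (p + (N - p) = N)%N by rewrite subnKC // ltnW.
have := cshift_star (twist_part_elt p) (rest_elt (N - p)) (@twist_part_shift p) (@rest_shift (N - p))
  phi j (fil_all x).
by rewrite addn0 pN.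
Qed.

Lemma series_to_twisted (s : nat -> conv) : (forall p, s p = twist_part p) -> series_to s twisted.
Proof.
move=> sE p; exists p => N pN d m n phi q i j x qx.
under eq_bigr do rewrite sE.
apply: (fil_le _ (@twisted_rest N d m n phi q i j x qx)).
by rewrite leq_add2r.
Qed.

End TwistedElement.

(** * Factorization through the Koszul dual coproperad *)

Section FunctionalExtension.
Variables (k : fieldType) (V0 V : lmodType k) (c : V0 -> V) (psi : dual V0).
Hypotheses (c_lin : linear c) (c_inj : injective c).

(* Zorn's lemma is applied to the graphs of functionals on subspaces of V which
   agree with psi on the image of c. *)
Let graph (G : V * k -> Prop) : Prop :=
  (forall b x r y s, G (x, r) -> G (y, s) -> G (b *: x + y, b * r + s)) /\
  (forall v r, G (c v, r) -> r = psi v).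

(** The empty set satisfies [graph], as is needed for the union of the empty chain; the origin is
    therefore adjoined before a graph is extended. *)
Let G0 (G : V * k -> Prop) (p : V * k) : Prop := G p \/ p = (0, 0).

Let graph0 G : graph G -> graph (G0 G).
Proof.
case=> Glin Gpsi; split=> [b x r y s|v r].
- have GZ d z q : G (z, q) -> G (d *: z, d * q).
    move=> Gz; have := Glin (d - 1) _ _ _ _ Gz Gz.
    by rewrite -{2}[z]scale1r -{2}[q]mul1r -scalerDl -mulrDl subrK.
  case=> [Gx|[-> ->]]; case=> [Gy|[-> ->]]; rewrite ?scaler0 ?mulr0 ?add0r ?addr0.
  + by left; exact: Glin.
  + by left; exact: GZ.
  + by left.
  + by right.
- case=> [/Gpsi //|[Ev ->]]; have -> : v = 0 by apply: c_inj; rewrite Ev (lin_zero c_lin).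
  by rewrite linear0.
Qed.

Let span G v t (p : V * k) : Prop :=
  exists x r l, G0 G (x, r) /\ p = (x + l *: v, r + l * t).

Let graph_span G v t : graph G ->
  (forall x r l w, G0 G (x, r) -> x + l *: v = c w -> r + l * t = psi w) ->
  graph (span G v t).
Proof.
move=> gG H; have [Glin _] := graph0 gG; split=> [b x r y s|w q].
- move=> [x1 [r1 [l1 [H1 [-> ->]]]]] [x2 [r2 [l2 [H2 [-> ->]]]]].
  exists (b *: x1 + x2), (b * r1 + r2), (b * l1 + l2); split; first exact: Glin.
  rewrite scalerDr scalerDl scalerA mulrDr mulrDl mulrA.
  by congr pair; exact: addrACA.
- by move=> [x [r [l [Hx [E ->]]]]]; apply: H Hx _; rewrite E.
Qed.

Lemma functional_extension : exists phi : dual V, forall v, phi (c v) = psi v :> k.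
Proof.
have [|G [gG Gmax]] := @classical_sets.Zorn_bigcup (V * k)%type graph.
  move=> F FP Ftot; split=> [b x r y s|v r].
    move=> [G1 F1 H1] [G2 F2 H2].
    have [/(_ _ H1) H1'|/(_ _ H2) H2'] := Ftot _ _ F1 F2.
      by exists G2 => //; apply: (FP _ F2).1.
    by exists G1 => //; apply: (FP _ F1).1.
  by move=> [G1 F1 H1]; exact: (FP _ F1).2 H1.
have max B : graph B -> (forall p, G p -> B p) -> forall p, B p -> G p.
  move=> gB GB; apply: contrapT => nBG; apply: (Gmax B) gB.
  exact: (conj GB nBG).
have [Glin Gpsi] := gG; have [G0lin G0psi] := graph0 gG.
have Gsub v t p : G p -> span G v t p.
  case: p => x r Gx; exists x, r, 0; split; first by left.
  by rewrite scale0r mul0r !addr0.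
have Gv v t : graph (span G v t) -> G (v, t).
  move=> gS; apply: (max _ gS (Gsub v t)); exists 0, 0, 1.
  by split; [right | rewrite scale1r mul1r !add0r].
have Gc v : G (c v, psi v).
  apply/Gv/graph_span => // x r l w Hx E.
  (* The value psi v is consistent at c v: x lies in the image of [c], where the graph already
     agrees with psi. *)
  have Ex : x = c (w - l *: v).
    rewrite addrC -scaleNr c_lin scaleNr -E addrC addrK //.
  rewrite Ex in Hx; rewrite (G0psi _ _ Hx) addrC.
  by rewrite linearB linearZ /= addrC subrK.
have G00 : G (0, 0) by have := Gc 0; rewrite (lin_zero c_lin) linear0.
have GZ d z q : G (z, q) -> G (d *: z, d * q).
  by move=> Gz; have := Glin d _ _ _ _ Gz G00; rewrite !addr0.
have Gtot v : exists t, G (v, t).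
  (* If v has no value yet, the value 0 is admissible: a relation x + l v = c w with l nonzero would
     put v in the domain already, since x and the image of [c] are there. *)
  apply: contrapT => nv; apply: (nv); exists 0; apply/Gv/graph_span => // x r l w Hx E.
  have {}Hx : G (x, r) by case: Hx => // ->.
  have [l0|l0] := eqVneq l 0.
    by move: E Hx; rewrite l0 scale0r mul0r !addr0 => -> /Gpsi.
  case: nv; exists (l^-1 * (psi w - r)).
  have -> : v = l^-1 *: (c w - x) by rewrite -E addrC addKr scalerA mulVf ?scale1r.
  apply: GZ; have := Glin (-1) _ _ _ _ Hx (Gc w).
  by rewrite scaleN1r mulN1r addrC [- r + _]addrC.
have Guniq v r s : G (v, r) -> G (v, s) -> r = s.
  move=> Gr Gs; have := Glin (-1) _ _ _ _ Gs Gr.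
  rewrite scaleN1r mulN1r addNr -(lin_zero c_lin) => /Gpsi.
  by rewrite linear0 addrC => /eqP; rewrite subr_eq0 => /eqP.
pose phi v := projT1 (cid (Gtot v)).
have phiP v : G (v, phi v) by rewrite /phi; case: cid.
have phi_lin : scalar phi.
  by move=> b x y; apply: Guniq (phiP _) _; exact: Glin.
by exists (mkdual phi_lin) => v; exact: Guniq (phiP _) (Gc v).
Qed.

End FunctionalExtension.

(** * Pulling back along the projection of coproperads *)

Section Projection.
Variables (k : fieldType) (Q : quad_data k) (chi : chi_datum (sdual Q)).
Local Notation P := (dualP Q).
Local Notation uP := (udualP chi).

Lemma canon_pid : canon chi (pid P) = pid uP.
Proof. exact: canonE. Qed.

Lemma canon_act d m n s t (x : P d m n) : canon chi (sact s t x) = sact s t (canon chi x).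
Proof.
have [r ->] := presP x.
transitivity (canon chi (pres_act s t (cl (quad_rel (orth (@qrel k Q))) r))); first by [].
by rewrite pres_actE !canonE; symmetry; exact: pres_actE.
Qed.

Lemma canon_comp (d1 d2 d : int) m1 n1 m2 n2 m n (h : d1 + d2 = d)
    (w : wiring m1 n1 m2 n2 m n) (x : P d1 m1 n1) (y : P d2 m2 n2) :
  canon chi (pcomp h w x y) = pcomp h w (canon chi x) (canon chi y).
Proof.
have [r ->] := presP x; have [r' ->] := presP y.
transitivity (canon chi (pres_comp h w (cl (quad_rel (orth (@qrel k Q))) r) (cl _ r'))).
  by [].
by rewrite pres_compE !canonE; symmetry; exact: pres_compE.
Qed.

Lemma proj_lin d m n c (phi psi : gdual uP d m n) :
  proj (c *: phi + psi) = c *: proj phi + proj psi.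
Proof. exact: dual_ext. Qed.

Lemma proj_act d m n s t (phi : gdual uP d m n) :
  proj (sact s t phi) = sact s t (proj phi).
Proof. by apply: dual_ext => x /=; rewrite canon_act. Qed.

Lemma proj_surj d m n (psi : gdual P d m n) :
  (forall d m n, injective (@canon k (sdual Q) (orth (@qrel k Q)) chi d m n)) ->
  exists phi : gdual uP d m n, proj phi = psi.
Proof.
move=> inj; have [phi Hphi] := functional_extension psi (@canon_lin _ _ _ chi _ _ _) (@inj _ _ _).
by exists phi; apply: dual_ext => x /=; exact: Hphi.
Qed.

Variables (A : cmod k) (T : tensor_powers A).

Lemma counit_conv_proj (dA : gmap (T 1%N) (T 1%N)) d m n (phi : gdual uP d m n) :
  counit_conv dA d m n phi = counit_conv dA d m n (proj phi).
Proof.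
case: d m n phi => [[|d]|d] [|[|m]] [|[|n]] phi //.
by congr gscale; rewrite -canon_pid.
Qed.

(** The counit factors through the projection because [canon] preserves the identity; hence all of
    alpha is pulled back, and its Maurer-Cartan equation reduces to the given one. *)
Lemma extendedE dA (abar : conv T P) :
  extended chi dA abar = pull chi (cadd (counit_conv dA) abar).
Proof.
apply: conv_ext => d m n phi; apply: gmap_ext => i j x.
by rewrite /extended /pull /cadd /gadd counit_conv_proj.
Qed.

Lemma pull_elt e (f : conv T P) : conv_elt e f -> conv_elt e (pull chi f).
Proof.
move=> fe; split=> [d m n phi|d m n c phi psi i j x|d m n s t phi i j x].
- exact: (conv_gmorph fe).
- by rewrite /pull proj_lin (conv_lin fe).
- by rewrite /pull proj_act (conv_act fe).
Qed.

Section ProjDecomposition.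
Variables (d : int) (m n : nat) (q : gsum (gdual uP) d m n).

Definition proj_terms (b t : prof) (h : pdeg b + pdeg t = d) (w : wiring_of b t m n) :
    seq (at_prof (gdual P) b * at_prof (gdual P) t) :=
  [seq (proj (p.1 : gdual uP _ _ _), proj (p.2 : gdual uP _ _ _)) | p <- gterms q h w].

Lemma proj_terms_out b t h (w : wiring_of b t m n) :
  (b, t) \notin gsupp q -> proj_terms h w = [::].
Proof. by move=> H; rewrite /proj_terms gterms_out. Qed.

Definition proj_gsum : gsum (gdual P) d m n := GSum (gsupp_uniq q) proj_terms_out.

(** Dual to the compatibility of [canon] with compositions. *)
Lemma proj_decomp (phi : gdual uP d m n) :
  is_decomp phi q -> is_decomp (proj phi) proj_gsum.
Proof.
move=> Hq b t hd h w x y; rewrite /= canon_comp (Hq _ _ hd).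
by rewrite /proj_terms big_map.
Qed.

End ProjDecomposition.

(** This frees [star] from the choice made in [decomp]; it is applied to the projection of a
    decomposition, which need not be the chosen one. *)
Lemma decomp_eq (R : properad k) e1 e2 (f g : conv T R) d m n (phi : gdual R d m n) q i j
    (x : T n i) :
  conv_elt e1 f -> conv_elt e2 g -> is_decomp phi q ->
  star e1 e2 f g d m n phi i j x = \sum_(bt <- gsupp q) star_part e1 e2 f g q j x bt.
Proof.
move=> fe ge Hq; have Hd : is_decomp phi (decomp phi).
  by rewrite /decomp; case: pselect => [e|[]]; [case: cid | exists q].
pose L := undup (gsupp (decomp phi) ++ gsupp q).
rewrite (@star_widen _ _ _ _ e1 e2 f g _ _ _ phi i j x L) ?undup_uniq //; last first.
  by move=> bt; rewrite mem_undup mem_cat => ->.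
rewrite -(@sum_support _ _ L (gsupp q) (star_part e1 e2 f g q j x)) ?undup_uniq ?gsupp_uniq //.
- apply: eq_bigr => -[b t] _.
  have [h|/eqP h] := eqVneq (pdeg b + pdeg t) d; last by rewrite !star_part_deg.
  rewrite !(star_partE _ _ _ _ _ _ _ h); congr (_ *: _); apply: eq_bigr => w _.
  apply: (vsum_indep fe ge) => y z.
  by rewrite (decomp_pairing h w y z Hd) (decomp_pairing h w y z Hq).
- by move=> bt; rewrite mem_undup mem_cat => ->; rewrite orbT.
- by move=> bt; exact: star_part_off.
Qed.

Lemma star_pull e1 e2 (f g : conv T P) : inf_coproperad uP ->
  conv_elt e1 f -> conv_elt e2 g ->
  star e1 e2 (pull chi f) (pull chi g) = pull chi (star e1 e2 f g).
Proof.
move=> uinf fe ge; apply: conv_ext => d m n phi; apply: gmap_ext => i j x.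
rewrite /pull (decomp_eq _ _ fe ge (proj_decomp (decompP uinf phi))) starE.
apply: eq_bigr => -[b t] _.
have [h|/eqP h] := eqVneq (pdeg b + pdeg t) d; last by rewrite !star_part_deg.
rewrite !(star_partE _ _ _ _ _ _ _ h); congr (_ *: _); apply: eq_bigr => w _.
by rewrite /vsum /= /proj_terms big_map.
Qed.

(** A preimage under [proj] is chosen for each functional, with no linearity or equivariance. Since
    [f] vanishes on the kernel its value does not depend on this choice, so the factor inherits both
    properties. *)
Lemma kernel_factor (f : conv T uP) :
  (forall d m n, injective (@canon k (sdual Q) (orth (@qrel k Q)) chi d m n)) ->
  conv_elt (-1) f -> vanishes_on_kernel f ->
  exists2 g : conv T P, conv_elt (-1) g & conv_eq f (pull chi g).
Proof.
move=> inj fe f0.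
pose ext d m n (psi : gdual P d m n) := projT1 (cid (proj_surj psi inj)).
have extK d m n (psi : gdual P d m n) : proj (ext d m n psi) = psi.
  by rewrite /ext; case: cid.
have f_eq d m n (phi phi' : gdual uP d m n) : proj phi = proj phi' ->
    f d m n phi = f d m n phi'.
  move=> E; apply: gmap_ext => i j x; apply/eqP; rewrite -subr_eq0; apply/eqP.
  have ker : in_kernel (-1 *: phi' + phi).
    by rewrite /in_kernel proj_lin E scaleN1r addNr.
  have := f0 _ _ _ _ ker i j x; rewrite (conv_lin fe) /gadd /gscale => <-.
  by rewrite scaleN1r addrC.
exists (fun d m n psi => f d m n (ext d m n psi)).
  split=> [d m n phi|d m n c phi psi i j x|d m n s t phi i j x].
  - exact: (conv_gmorph fe).
  - rewrite (f_eq _ _ _ _ (c *: ext _ _ _ phi + ext _ _ _ psi)) ?(conv_lin fe) //.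
    by rewrite proj_lin !extK.
  - rewrite (f_eq _ _ _ _ (sact s t (ext _ _ _ phi))) ?(conv_act fe) //.
    by rewrite proj_act !extK.
by move=> d m n phi i j x; rewrite /pull (f_eq _ _ _ phi (ext _ _ _ (proj phi))) ?extK.
Qed.

End Projection.

Theorem theorem4p14 (k : fieldType) (char0 : [pchar k] =i pred0)
  (Q : quad_data k) (Qfin : fin_dim_sbimod Q)
  (chi : chi_datum (sdual Q)) (Qtw : twistable_by chi)
  (A : cmod k) (T : tensor_powers A)
  (dA : gmap (T 1%N) (T 1%N)) (abar : conv T (dualP Q))
  (abarP : Pinf_gebra dA abar)
  (a : A 0) (aF1 : fil 1 a) :
  let alpha := extended chi dA abar in
  MC alpha /\
  exists beta : conv T (udualP chi),
    [/\ is_gauge a alpha beta,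
        is_twist a alpha beta,
        MC beta &
        is_Pinf beta <-> vanishes_on_kernel beta].
Proof.
move=> alpha; have [[_ inj] uinf] := Qtw.
have [_ _ _ [elt0 /conv_eqE MC0]] := abarP.
have alphaE : alpha = pull chi (cadd (counit_conv dA) abar) := extendedE chi dA abar.
have alpha_elt : conv_elt (-1) alpha by rewrite alphaE; exact: pull_elt.
have alpha_MC : star (-1) (-1) alpha alpha = czero.
  by rewrite alphaE star_pull // MC0.
split; first by split=> //; apply/conv_eqE.
pose beta := twisted (unit_of chi) aF1 alpha_elt.
have beta_elt : conv_elt (-1) beta := twisted_elt (unit_of chi) aF1 alpha_elt.
have beta_MC : MC beta by split=> //; apply/conv_eqE; exact: twisted_MC.
exists beta; split=> //.
- apply: series_to_twisted => p; exact: gauge_termE.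
- by apply: series_to_twisted => p; exact: twist_termE.
(* The direct implication only uses that [g] is linear, hence sends the zero functional [proj phi]
   to 0. *)
split=> [[_ [g ge beta_g]] d m n phi phi0 i j x|beta0]; last first.
  by split=> //; exact: kernel_factor.
rewrite beta_g /pull phi0.
have g_lin : linear (fun psi => g d m n psi i j x).
  by move=> c psi psi'; rewrite (conv_lin ge).
exact: (lin_zero g_lin).
Qed.
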